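(* For $G\in\mathcal B$ without isolated vertices and $c\in(0,1)$ we have $$ d_W\big(\widetilde W_n^G,\mathcal N\big)\lesssim \begin{cases} \dfrac{\sqrt{\mathbb{E}[X^4]}}{n\sqrt{1-p_n}\,\mathrm{Var}[X]} & \text{if } 0<c<p_n,\\[3mm] \dfrac{\sqrt{\mathbb{E}[X^4]}}{n\sqrt{p_n}\,\mathbb{E}[X^2]} & \text{if } n^{-(v_G-2)/(e_G-1)}<p_n\le c,\\[3mm] \dfrac{\sqrt{\mathbb{E}[X^4]}}{n^{v_G/2}p_n^{e_G/2}\,\mathbb{E}[X^2]} & \text{if } 0<p_n\le n^{-(v_G-2)/(e_G-1)}, \end{cases} $$ where $a_n\lesssim b_n$ means that there exists a constant $C$ depending only on $G$ such that $a_n<Cb_n$ for all $n$.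
   Context: $v_H$ and $e_H$ denote the numbers of vertices and edges of a graph $H$, and $H\subset G$ means that $H$ is a (not necessarily induced) subgraph of $G$. $\mathcal B$ is the class of all graphs $G$ with at least three vertices such that $$\max_{\substack{H\subset G\\ v_H\ge3}}\frac{e_H-1}{v_H-2}=\frac{e_G-1}{v_G-2}.$$ $\mathbb{G}(n,p_n)$ is the Erdős–Rényi random graph obtained by independently retaining each edge of the complete graph $K_n$ on $n$ vertices with probability $p_n\in(0,1)$. Every edge is assigned an independent sample of a random nonnegative weight $X$, independently of the random graph. The weight of a graph is the sum of the weights of its edges, and $W_n^G$ is the combined weight of the (not necessarily induced) subgraphs of $\mathbb{G}(n,p_n)$ isomorphic to $G$, i.e. $W_n^G=\sum_{G'}\mathbf 1_{\{G'\subset\mathbb{G}(n,p_n)\}}\sum_{e\in E(G')}X_e$, where the first sum is over all subgraphs $G'$ of $K_n$ isomorphic to $G$, $E(G')$ is the edge set of $G'$, and $X_e$ is the weight of the edge $e$. The renormalization is $\widetilde W_n^G=(W_n^G-\mathbb{E}[W_n^G])/\sqrt{\mathrm{Var}[W_n^G]}$. $\mathcal N$ is a standard normal random variable, and $d_W(Y,Z)=\sup_{h\in \mathrm{Lip}(1)}|\mathbb{E}[h(Y)]-\mathbb{E}[h(Z)]|$ is the Wasserstein distance between the laws of random variables $Y$, $Z$, where $\mathrm{Lip}(1)$ is the class of real-valued Lipschitz functions with Lipschitz constant less than or equal to $1$.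
   Formalization: The constant C may depend on c as well as on G: with C depending only on G the claim fails (triangle, X=1, n large and fixed, p_n=c tending to 1, where the distance stays bounded below but the second bound is about C/n). It is also assumed that 0<E[X^2]<∞. *)

(* Defs.v *)
From HB Require Import structures.
From mathcomp Require Import all_boot all_order all_algebra.
From mathcomp Require Import all_classical all_reals all_analysis.

Set Implicit Arguments.
Unset Strict Implicit.
Unset Printing Implicit Defensive.

Import Order.TTheory GRing.Theory Num.Theory.
Import numFieldNormedType.Exports.

Local Open Scope ring_scope.

(* Finite simple graphs whose vertices lie in an ambient finite type [V].  The
   vertex set is a component of the graph, so that subgraphs need be neither
   spanning nor induced. *)
Record graph (V : finType) := Graph {
  graph_pair :> {set V} * {set {set V}};
  _ : [forall e in graph_pair.2, (#|e| == 2) && (e \subset graph_pair.1)] }.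

HB.instance Definition _ (V : finType) := [isSub for @graph_pair V].
HB.instance Definition _ (V : finType) := [Finite of graph V by <:].

Definition vset (V : finType) (G : graph V) : {set V} := (graph_pair G).1.
Definition eset (V : finType) (G : graph V) : {set {set V}} := (graph_pair G).2.
Definition nv (V : finType) (G : graph V) : nat := #|vset G|.
Definition ne (V : finType) (G : graph V) : nat := #|eset G|.

Definition subgraph (V : finType) (H G : graph V) : bool :=
  (vset H \subset vset G) && (eset H \subset eset G).

Definition isomorphic (V U : finType) (G : graph V) (H : graph U) : bool :=
  [exists f : {ffun V -> U},
    [&& [forall x in vset G, forall y in vset G, (f x == f y) ==> (x == y)],
        f @: vset G == vset H &
        (fun e : {set V} => f @: e) @: eset G == eset H]].

Definition no_isolated (V : finType) (G : graph V) : bool :=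
  [forall x in vset G, exists e in eset G, x \in e].

Definition density (V : finType) (G : graph V) : rat :=
  ((ne G)%:R - 1) / ((nv G)%:R - 2).

(* The class B.  The default value [density G] of the iterated maximum is
   itself one of the values of the range, the one at [H = G]. *)
Definition class_B (V : finType) (G : graph V) : Prop :=
  (3 <= nv G)%N /\
  \big[Num.max/density G]_(H : graph V | subgraph H G && (3 <= nv H)%N)
     density H = density G.

(* The edges of the complete graph K_n. *)
Definition edge (n : nat) := {e : {set 'I_n} | #|e| == 2}.

Definition mutually_independent d (T : measurableType d) (R : realType)
    (P : probability T R) (I : finType) (F : I -> set (set T)) : Prop :=
  forall (J : {set I}) (E : I -> set T), (forall i, i \in J -> F i (E i)) ->
    P (\bigcap_(i in [set` J]) E i)%classic = (\prod_(i in J) P (E i))%E.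

Definition edge_event (T : Type) (n : nat) (GG : T -> graph 'I_n) (e : edge n)
  : set T := [set w | val e \in eset (GG w)]%classic.

(* [GG] is the random graph G(n,p) and the [Xe e], for [e] an edge of K_n, are
   independent copies of [X], independent of [GG].  The values of [Xe] at sets
   that are not edges of K_n are irrelevant. *)
Definition weighted_Gnp (R : realType)
    dS (S : measurableType dS) (Q : probability S R) (X : {RV Q >-> R})
    (n : nat) (p : R)
    d (T : measurableType d) (P : probability T R)
    (GG : T -> graph 'I_n) (Xe : {set 'I_n} -> {RV P >-> R}) : Prop :=
  [/\ forall w, vset (GG w) = [set: 'I_n],
      forall e, measurable (edge_event GG e) /\ P (edge_event GG e) = p%:E,
      forall (e : edge n) (A : set R), measurable A ->
        distribution P (Xe (val e)) A = distribution Q X A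
    & mutually_independent P (fun i : edge n + edge n =>
        match i with
        | inl e => [set edge_event GG e]%classic
        | inr e => preimage_set_system [set: T]%classic (Xe (val e)) measurable
        end)].

(* The combined weight W_n^G. *)
Definition subgraph_weight (R : realType) (V : finType) (G : graph V) (n : nat)
    (T : Type) (GG : T -> graph 'I_n) (Xe : {set 'I_n} -> T -> R) : T -> R :=
  fun w => \sum_(H : graph 'I_n | isomorphic G H)
    (subgraph H (GG w))%:R * \sum_(e in eset H) Xe e w.

Definition renormalized (R : realType) d (T : measurableType d)
    (P : probability T R) (W : T -> R) : T -> R :=
  fun w => (W w - fine 'E_P[W]%E) / Num.sqrt (fine 'V_P[W]%E).

Definition wasserstein (R : realType)
    d (T : measurableType d) (P : probability T R) (Y : T -> R)
    d' (S : measurableType d') (Q : probability S R) (Z : S -> R) : \bar R :=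
  ereal_sup [set `| 'E_P[h \o Y] - 'E_Q[h \o Z] |%E
            | h in [set h : R -> R | 1.-lipschitz h]]%classic.

(* Main.v *)
(** Let Y_a be the centered weight of the copy a of G in K_n.  Copies without a common edge are
    independent, so Stein's method for local dependence bounds the Wasserstein distance by a
    constant times the sum of E|Y_a Y_b Y_c| + E|Y_a Y_b| E|Y_c| over the triples in which b
    shares an edge with a, and c with a or b, divided by the cube of the standard deviation.
    The numerator is at most a constant times E[X^3] times the sum of p^|a u b u c|; the
    covariance of two overlapping copies is at least
    p^|a u b| max(Var X, (1 - p) E[X^2]).  If every nonempty subgraph with vertex set U and edge
    set F of a copy satisfies n^|U| p^|F| >= psi, gluing three copies gives a triple sum of order
    (n^v p^e)^3 / psi^2.  For G in B the minimum of n^|U| p^|F| is attained at a single edge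
    (n^2 p) above the threshold and at G itself (n^v p^e) below it; for p > c it is at least
    c^e n^2.  With E[X^3] <= sqrt(E[X^2] E[X^4]), this one inequality yields all three rates. *)

Require Import Defs.
From mathcomp Require Import all_boot all_order all_algebra.
From mathcomp Require Import all_classical all_reals all_analysis.
From mathcomp Require Import measurable_realfun.
From mathcomp Require Import ring lra zify.

Import Order.TTheory GRing.Theory Num.Theory.
Import numFieldNormedType.Exports.

Local Open Scope ring_scope.

Set Implicit Arguments.
Unset Strict Implicit.
Unset Printing Implicit Defensive.

(** * Copies of a graph in the complete graph *)

Section subgraph_copies.
Import mathcomp.boot.fintype mathcomp.boot.finset.

(** The cube of the standard deviation is bounded below as the variance times its square root, with
    a separate lower bound for each factor. For p > c the first factor uses Var X and the second (1
    - p) E[X^2]; otherwise both use a multiple of E[X^2]. The factor sqrt(E[X^2]) of the second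
    cancels against the bound on E[X^3], which explains the moments in the rates. The scale psi must
    also be attained in the variance: the pair sum is at least of order (n^v p^e)^2 / psi, through
    pairs with a common edge when psi is n^2 p and through b = a when psi is n^v p^e. The quotient
    is then of order psi^(-1/2). The constant is fixed before the law of X, p and n, so every
    estimate is nonasymptotic: n < v is treated apart, and the Stein solution needs bounds uniform
    over all 1-Lipschitz h. As h need not be differentiable, no second derivative of the solution f
    is used; the Lipschitz bound on f' comes from the equation satisfied by the increments of f. *)

Lemma eset_card2 (V : finType) (G : graph V) e : e \in eset G -> #|e| = 2.
Proof.
by move=> eG; have /forallP/(_ e) := valP G; rewrite -/(eset G) eG /= => /andP[/eqP].
Qed.

Lemma eset_sub (V : finType) (G : graph V) e : e \in eset G -> e \subset vset G.
Proof.
by move=> eG; have /forallP/(_ e) := valP G; rewrite -/(eset G) eG /= => /andP[_].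
Qed.

(** Edges of size two cover the vertices, so [nv G] is at most twice [ne G]. This makes [ne G - 1],
    the denominator of the threshold exponent, positive. *)
Lemma no_isolated_ne (V : finType) (G : graph V) :
  no_isolated G -> (3 <= nv G)%N -> (2 <= ne G)%N.
Proof.
move=> iG v3.
have vE : vset G \subset cover (eset G).
  apply/subsetP => x xG.
  have /forallP/(_ x) := iG; rewrite xG => /existsP[e /andP[eG xe]].
  by apply/bigcupP; exists e.
have := leq_trans (subset_leq_card vE) (leq_card_cover _).
rewrite (eq_bigr (fun=> 2%N)); last by move=> e; exact: eset_card2.
rewrite sum_nat_const -/(ne G) -/(nv G) => h.
have := leq_trans v3 h; case: (ne G) => [|[|]]//.
Qed.

Section isomorphic_copy.
Variables (V U : finType) (G : graph V) (H : graph U) (f : V -> U).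
Hypothesis finj : {in vset G &, injective f}.
Hypothesis fv : f @: vset G = vset H.
Hypothesis fe : (fun e : {set V} => f @: e) @: eset G = eset H.

Lemma copy_inj_edge (e1 e2 : {set V}) :
  e1 \subset vset G -> e2 \subset vset G -> f @: e1 = f @: e2 -> e1 = e2.
Proof.
move=> s1 s2 E.
suff sub (a b : {set V}) : a \subset vset G -> b \subset vset G -> f @: a = f @: b ->
    a \subset b.
  by apply/eqP; rewrite eqEsubset (sub e1 e2)// (sub e2 e1).
move=> sa sb ab; apply/subsetP => x xa.
have : f x \in f @: b by rewrite -ab imset_f.
case/imsetP => y yb /finj -> //; first exact: (subsetP sa).
exact: (subsetP sb).
Qed.

Lemma copy_nv : nv H = nv G.
Proof. by rewrite /nv -fv card_in_imset. Qed.

Lemma copy_ne : ne H = ne G.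
Proof.
rewrite /ne -fe card_in_imset// => e1 e2 /eset_sub s1 /eset_sub s2.
exact: copy_inj_edge.
Qed.

(** Pulled back along [f], the pair [(A, F)] is a subgraph of [G], to which the maximality in
    [class_B] applies. Clearing denominators leaves an inequality of natural numbers that also makes
    sense for [#|A| = 2], where the density has denominator 0. *)
Lemma copy_density (A : {set U}) (F : {set {set U}}) : class_B G ->
  A \subset vset H -> F \subset eset H -> (forall e, e \in F -> e \subset A) ->
  F != set0 ->
  (2 <= #|A|)%N /\ ((#|F| - 1) * (nv G - 2) <= (ne G - 1) * (#|A| - 2))%N.
Proof.
move=> [v3 maxG] AH FH FA F0.
have A2 : (2 <= #|A|)%N.
  case/set0Pn: F0 => e eF.
  apply: leq_trans (subset_leq_card (FA _ eF)).
  by rewrite (@eset_card2 _ H e) ?(subsetP FH).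
split => //.
(* On two vertices [F] is the single edge [A], and the left-hand side is 0. *)
have [A2'|A3] := leqP #|A| 2.
  have AE : #|A| = 2 by apply/eqP; rewrite eqn_leq A2' A2.
  suff : (#|F| <= 1)%N by case: #|F| => [|[|]].
  have FsA : F \subset [set A].
    apply/subsetP => e eF; rewrite inE eqEcard FA//= AE.
    by rewrite (@eset_card2 _ H e) ?(subsetP FH).
  by rewrite (leq_trans (subset_leq_card FsA))// cards1.
pose A' := [set x in vset G | f x \in A].
pose F' := [set e in eset G | f @: e \in F].
have KP : [forall e in (A', F').2, (#|e| == 2) && (e \subset (A', F').1)].
  apply/forallP => e; apply/implyP; rewrite inE => /andP[eG eF] /=.
  rewrite (eset_card2 eG) eqxx; apply/subsetP => x xe; rewrite inE.
  rewrite (subsetP (eset_sub eG))//=.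
  by apply: (subsetP (FA _ eF)); rewrite imset_f.
pose K := Graph KP.
have vK : nv K = #|A|.
  rewrite /nv /vset /= -(card_in_imset (f := f)); last first.
    by move=> x y; rewrite !inE => /andP[xG _] /andP[yG _]; exact: finj.
  congr #|pred_of_set _|; apply/setP => y; apply/imsetP/idP.
    by case=> x; rewrite inE => /andP[_ fxA] ->.
  move=> yA; have : y \in vset H by exact: (subsetP AH).
  rewrite -fv => /imsetP[x xG yE]; exists x => //.
  by rewrite inE xG -yE.
have eK : ne K = #|F|.
  rewrite /ne /eset /= -(card_in_imset (f := fun e : {set V} => f @: e)); last first.
    move=> x y; rewrite !inE => /andP[xG _] /andP[yG _].
    by apply: copy_inj_edge; exact: eset_sub.
  congr #|pred_of_set _|; apply/setP => y; apply/imsetP/idP.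
    by case=> x; rewrite inE => /andP[_ fxA] ->.
  move=> yF; have : y \in eset H by exact: (subsetP FH).
  rewrite -fe => /imsetP[x xG yE]; exists x => //.
  by rewrite inE xG -yE.
have KG : subgraph K G.
  apply/andP; split; apply/subsetP => x; rewrite /vset /eset/= inE; by case/andP.
have : density K <= density G.
  rewrite -maxG.
  by apply: le_bigmax_cond; rewrite KG vK.
have e1 : (1 <= ne G)%N.
  have : (0 < #|F|)%N by rewrite card_gt0.
  move=> /leq_trans; apply; rewrite -copy_ne; exact: subset_leq_card.
have F1 : (1 <= #|F|)%N by rewrite card_gt0.
rewrite /density eK vK.
rewrite -(natrB _ F1) -(natrB _ e1) -!natrB//; last exact: ltnW.
rewrite ler_pdivrMr ?ltr0n ?subn_gt0// mulrAC ler_pdivlMr ?ltr0n ?subn_gt0//.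
by rewrite -!natrM ler_nat.
Qed.

End isomorphic_copy.

Lemma isomorphicP (V U : finType) (G : graph V) (H : graph U) :
  reflect (exists f : {ffun V -> U}, [/\ {in vset G &, injective f},
     f @: vset G = vset H & (fun e : {set V} => f @: e) @: eset G = eset H])
   (isomorphic G H).
Proof.
apply: (iffP existsP) => -[f].
  move=> /and3P[fi /eqP fv /eqP fe]; exists f; split=> // x y xG yG /eqP fxy.
  have /forallP/(_ x) := fi; rewrite xG => /forallP/(_ y); rewrite yG fxy /=.
  by move/eqP.
move=> [fi fv fe]; exists f; rewrite fv fe !eqxx !andbT.
apply/forallP => x; apply/implyP => xG; apply/forallP => y; apply/implyP => yG.
by apply/implyP => /eqP fxy; apply/eqP/fi.
Qed.

Lemma iso_nv (V U : finType) (G : graph V) (H : graph U) :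
  isomorphic G H -> nv H = nv G.
Proof. by case/isomorphicP => f [fi fv fe]; exact: copy_nv fi fv. Qed.

Lemma iso_ne (V U : finType) (G : graph V) (H : graph U) :
  isomorphic G H -> ne H = ne G.
Proof. by case/isomorphicP => f [fi fv fe]; apply: copy_ne fi fe. Qed.

Lemma iso_density (V U : finType) (G : graph V) (H : graph U)
    (A : {set U}) (F : {set {set U}}) : isomorphic G H -> class_B G ->
  A \subset vset H -> F \subset eset H -> (forall e, e \in F -> e \subset A) ->
  F != set0 ->
  (2 <= #|A|)%N /\ ((#|F| - 1) * (nv G - 2) <= (ne G - 1) * (#|A| - 2))%N.
Proof. by case/isomorphicP => f [fi fv fe]; apply: (copy_density fi fv fe). Qed.

Section copies.
Variables (V : finType) (G : graph V) (n : nat).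

Definition copies : {set graph 'I_n} := [set H | isomorphic G H].

(** Maps are taken on the vertices of [G] alone: over an ambient [V] with further points there would
    be [n ^ #|V|] of them. *)
Let sV := {x : V | x \in vset G}.

Let back (g : {ffun sV -> 'I_n}) : {set 'I_n} * {set {set 'I_n}} :=
  ([set g x | x : sV], [set [set g x | x : sV & val x \in e] | e : {set V} in eset G]).

Let exists_back (H : graph 'I_n) : H \in copies -> exists g, back g = graph_pair H.
Proof.
rewrite inE => /isomorphicP[f [fi fv fe]].
exists [ffun x => f (val x)].
rewrite [RHS]surjective_pairing -/(vset H) -/(eset H) -fv -fe /back; congr pair.
  apply/setP => y; apply/imsetP/imsetP => [[x _ ->]|[x xG ->]].
    by exists (val x); rewrite ?ffunE//; exact: (valP x).
  by exists (Sub x xG); rewrite ?ffunE.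
apply: eq_in_imset => e eG; apply/setP => y; apply/imsetP/imsetP => [[x]|[x xe ->]].
  by rewrite inE => xe ->; exists (val x); rewrite ?ffunE.
have xG := subsetP (eset_sub eG) _ xe.
by exists (Sub x xG); rewrite ?ffunE// inE.
Qed.

(* Every copy is the image of a map g from the vertices of G, and n ^ #|vset H :&: D| is then at
   most the product over the vertices x of n or 1, according as g x lies in D or not. *)
Lemma sum_copies (D : {set 'I_n}) : (0 < n)%N ->
  (\sum_(H in copies) n ^ #|vset H :&: D| <= (n * #|D|.+1) ^ nv G)%N.
Proof.
move=> n0.
pose F (g : {ffun sV -> 'I_n}) := (\prod_(x : sV) (if g x \in D then n else 1))%N.
have FE g H : back g = graph_pair H -> (n ^ #|vset H :&: D| <= F g)%N.
  move=> gH; have -> : vset H = (back g).1 by rewrite gH.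
  rewrite /F -big_mkcond/= prod_nat_const leq_pexp2l//.
  rewrite (_ : (back g).1 :&: D = [set g x | x : sV & g x \in D]).
    by rewrite (leq_trans (leq_imset_card _ _))// cardsE.
  apply/setP => y; rewrite !inE; apply/andP/imsetP => [[/imsetP[x _ ->] xD]|].
    by exists x; rewrite ?inE.
  by case=> x; rewrite inE => xD ->; rewrite xD imset_f.
apply: (@leq_trans (\sum_(H in copies) \sum_(g | back g == graph_pair H) F g)%N).
  apply: leq_sum => H /exists_back[g gH].
  by rewrite (bigD1 g) ?gH//= (leq_trans (FE _ _ gH))// leq_addr.
rewrite (exchange_big_dep xpredT)//=.
apply: (@leq_trans (\sum_g F g)%N).
  (* A map [g] determines its copy through [back g], so [F g] is counted at most once. *)
  apply: leq_sum => g _; rewrite sum_nat_cond_const.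
  rewrite -[leqRHS]mul1n leq_mul2r; apply/orP; right.
  apply/card_le1_eqP => H1 H2; rewrite !inE => /andP[_ /eqP E1] /andP[_ /eqP E2].
  by apply: val_inj; rewrite /= -E1 -E2.
rewrite /F -(bigA_distr_bigA (fun (_ : sV) y => if y \in D then n else 1%N)) /=.
rewrite prod_nat_const (_ : #|[pred _ : sV | true]| = nv G); last by rewrite card_sig.
(* After exchanging sum and product each vertex of [G] gives one factor: [n] for every point of [D],
   and 1 for each of the at most [n] others. *)
suff : (\sum_(y < n) (if y \in D then n else 1) <= n * #|D|.+1)%N.
  by case: (nv G) => // v; rewrite leq_exp2r.
rewrite (bigID (mem D))/= mulnS addnC leq_add//.
  rewrite -[leqRHS](card_ord n) -sum1_card [leqRHS](bigID (mem D))/= addnC.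
  rewrite (eq_bigr (fun=> 1%N)) ?leq_addr// => y; first by case: (y \in D).
rewrite (eq_bigr (fun=> n)); first by rewrite sum_nat_const mulnC.
by move=> y ->.
Qed.

Lemma card_copies_le : (0 < n)%N -> (#|copies| <= n ^ nv G)%N.
Proof.
move=> n0; have := sum_copies set0 n0; rewrite cards0 muln1.
by rewrite (eq_bigr (fun=> 1%N)) ?sum1_card// => H _; rewrite setI0 cards0.
Qed.

(** Every set of [nv G] vertices of K_n carries a copy, obtained by matching the enumerations of the
    two vertex sets; different vertex sets give different copies. *)
Lemma bin_le_card_copies : (0 < n)%N -> ('C(n, nv G) <= #|copies|)%N.
Proof.
move=> n0; rewrite -[X in 'C(X, _)]card_ord -card_draws.
apply: (@leq_trans #|[set vset H | H in copies]|); last exact: leq_imset_card.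
apply: subset_leq_card; apply/subsetP => A; rewrite inE => /eqP AG.
pose f x := nth (Ordinal n0) (enum A) (index x (enum (vset G))).
have sz : size (enum A) = size (enum (vset G)) by rewrite -!cardE.
have lti x : x \in vset G -> (index x (enum (vset G)) < size (enum A))%N.
  by move=> xG; rewrite sz index_mem mem_enum.
have fi : {in vset G &, injective f}.
  move=> x y xG yG /eqP; rewrite nth_uniq ?enum_uniq ?lti// => /eqP.
  by move/(congr1 (nth x (enum (vset G)))); rewrite !nth_index// mem_enum.
have fA : f @: vset G = A.
  apply/eqP; rewrite eqEcard card_in_imset// AG leqnn andbT.
  by apply/subsetP => _ /imsetP[x xG ->]; rewrite -mem_enum mem_nth// lti.
have HP : [forall e in (A, (fun e : {set V} => f @: e) @: eset G).2,
    (#|e| == 2) && (e \subset (A, (fun e : {set V} => f @: e) @: eset G).1)].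
  apply/forallP => e; apply/implyP => /imsetP[e' e'G ->] /=.
  rewrite card_in_imset ?(eset_card2 e'G) ?eqxx//=; last first.
    by move=> x y xe ye; apply: fi; exact: (subsetP (eset_sub e'G)).
  by rewrite -fA imsetS// eset_sub.
apply/imsetP; exists (Graph HP) => //; rewrite inE.
apply/isomorphicP; exists [ffun x => f x]; split.
- by move=> x y xG yG; rewrite !ffunE; exact: fi.
- by rewrite -[RHS]fA; apply: eq_imset => x; rewrite ffunE.
- by apply: eq_imset => e; apply: eq_imset => x; rewrite ffunE.
Qed.

(** This is (m / v)^v <= C(m, v). The induction step multiplies by [v ^ v] and combines (v + 1) C(m
    + 1, v + 1) = (m + 1) C(m, v) with v (m + 1) <= m (v + 1), which holds as v <= m. *)
Lemma expn_le_bin v m : (v <= m)%N -> (m ^ v <= v ^ v * 'C(m, v))%N.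
Proof.
elim: v m => [|v ih] [|m]; rewrite ?bin0// ltnS => vm.
have [->|v0] := posnP v; first by rewrite bin1 mul1n.
have h : ((v * m.+1) ^ v <= (m * v.+1) ^ v)%N.
  by rewrite leq_exp2r//; lia.
rewrite expnS [leqRHS](_ : _ = m.+1 * (v.+1 ^ v * 'C(m, v)))%N; last first.
  by rewrite expnS -mulnA mulnCA -mul_bin_diag mulnCA.
rewrite leq_mul2l /=.
rewrite -(@leq_pmul2l (v ^ v)) ?expn_gt0 ?v0// -expnMn (leq_trans h)//.
by rewrite expnMn mulnC mulnCA leq_mul2l ih// orbT.
Qed.

Lemma sqr_sum_leq (I : finType) (E : {set I}) (k : I -> nat) :
  ((\sum_(i in E) k i) ^ 2 <= #|E| * \sum_(i in E) k i ^ 2)%N.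
Proof.
rewrite -(@leq_pmul2l 2)//.
apply: (@leq_trans (\sum_(i in E) \sum_(j in E) (k i ^ 2 + k j ^ 2))%N).
  rewrite -mulnn big_distrl/= big_distrr/=; apply: leq_sum => i _.
  rewrite big_distrr/= big_distrr/=; apply: leq_sum => j _.
  by have [] := nat_Cauchy (k i) (k j).
under eq_bigr do rewrite big_split/= sum_nat_const.
by rewrite big_split/= sum_nat_const -big_distrr/= addnn mul2n.
Qed.

Definition share (a b : graph 'I_n) := eset a :&: eset b != set0.

(* Cauchy-Schwarz on the number of copies through each edge of K_n. *)
Lemma card_share : ((ne G * #|copies|) ^ 2 <=
  n ^ 2 * (ne G * \sum_(a in copies) \sum_(b in copies | share a b) 1))%N.
Proof.
pose E := [set e : {set 'I_n} | #|e| == 2].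
pose k e := (\sum_(a in copies) (e \in eset a))%N.
have -> : (ne G * #|copies| = \sum_(e in E) k e)%N.
  rewrite exchange_big/= mulnC -sum_nat_const; apply: eq_bigr => a.
  rewrite inE => aG; rewrite -(iso_ne aG) /ne -sum1_card.
  rewrite [RHS](bigID (mem (eset a)))/= [X in (_ + X)%N]big1 ?addn0; last first.
    by move=> e /andP[_ /negbTE ->].
  apply: eq_big => [e|e ->//]; rewrite inE andbC.
  by case ea : (e \in eset a) => //=; rewrite (eset_card2 ea).
apply: leq_trans (sqr_sum_leq _ _) _.
apply: leq_mul.
  rewrite card_draws card_ord bin2 -divn2 (leq_trans (leq_div _ _))//.
  by rewrite -mulnn leq_mul2l leq_pred orbT.
(* The squares count the common edges of ordered pairs of copies: at most [ne G] for a pair that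
   shares an edge, none otherwise. *)
have -> : (\sum_(e in E) k e ^ 2 = \sum_(a in copies) \sum_(b in copies)
    \sum_(e in E) (e \in eset a) * (e \in eset b))%N.
  rewrite (eq_bigr (fun e => \sum_(a in copies) \sum_(b in copies)
      (e \in eset a) * (e \in eset b))%N); last first.
    by move=> e _; rewrite -mulnn /k big_distrl/=; apply: eq_bigr => a _; rewrite big_distrr.
  by rewrite exchange_big/=; apply: eq_bigr => a _; rewrite exchange_big.
rewrite big_distrr/=; apply: leq_sum => a aG.
rewrite big_distrr/= big_mkcondr/=; apply: leq_sum => b _.
rewrite muln1; case: ifPn => [_|/negPn/eqP ab].
  move: aG; rewrite inE => /iso_ne <-.
  rewrite /ne -sum1_card [leqRHS]big_mkcond/= [leqRHS](bigID (mem E))/=.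
  rewrite (leq_trans _ (leq_addr _ _))//; apply: leq_sum => e _.
  by case: (e \in eset a); case: (e \in eset b).
rewrite big1// => e _; have : e \notin eset a :&: eset b by rewrite ab inE.
by rewrite inE; case: (e \in eset a); case: (e \in eset b).
Qed.

End copies.
End subgraph_copies.

(** * Weighted sums over overlapping copies *)

Section copies_weights.
Import mathcomp.boot.fintype mathcomp.boot.finset.
Variables (R : realFieldType) (V : finType) (G : graph V) (n : nat) (p : R).
Hypothesis n0 : (0 < n)%N.
Hypothesis p01 : 0 < p <= 1.
Let v := nv G.
Let e := ne G.
Local Notation copies := (copies G n).

Let p0 : 0 < p. Proof. by case/andP: p01. Qed.
Let p1 : p <= 1. Proof. by case/andP: p01. Qed.

Section upper.
Variable psi : R.
Hypothesis psi0 : 0 < psi.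
(** The set [A] may be larger than the union of the edges in [F]: in the sums below it consists of
    all common vertices of a copy with a given set, including those on no common edge. *)
Hypothesis hpsi : forall H (A : {set 'I_n}) (F : {set {set 'I_n}}), H \in copies ->
  A \subset vset H -> F \subset eset H -> (forall f, f \in F -> f \subset A) ->
  F != set0 -> psi <= n%:R ^+ #|A| * p ^+ #|F|.

(* p^|De u c| = p^|De| p^e / p^|De n c|, and 1 / p^|De n c| <= n^|Dv n c| / psi by hpsi. *)
Lemma sum_meeting_copies (Dv : {set 'I_n}) (De : {set {set 'I_n}}) :
  (forall f, f \in De -> f \subset Dv) ->
  \sum_(c in copies | De :&: eset c != set0) p ^+ #|De :|: eset c| <=
  p ^+ #|De| * (p ^+ e * (n * #|Dv|.+1)%:R ^+ v / psi).
Proof.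
move=> DeDv.
apply: (@le_trans _ _ (\sum_(c in copies) p ^+ #|De| * (p ^+ e / psi *
    (n ^ #|vset c :&: Dv|)%:R))).
  rewrite [leRHS](bigID (fun c => De :&: eset c != set0))/= -[leLHS]addr0.
  apply: lerD; last first.
    by apply: sumr_ge0 => c _; rewrite !mulr_ge0// ?invr_ge0 ?exprn_ge0// ltW.
  apply: ler_sum => c /andP[cC hit].
  have pF : 0 < p ^+ #|De :&: eset c| by rewrite exprn_gt0.
  rewrite -(ler_pM2r pF) -exprD cardsUI exprD -!mulrA.
  rewrite ler_pM2l ?exprn_gt0//.
  move: (cC); rewrite inE => /iso_ne ce; rewrite [#|eset c|]ce.
  rewrite -[leLHS]mulr1 ler_pM2l ?exprn_gt0// mulrC ler_pdivlMr// mul1r.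
  rewrite natrX; apply: (hpsi cC).
  - by rewrite subsetIl.
  - by rewrite subsetIr.
  - move=> f; rewrite inE => /andP[fD fc]; rewrite subsetI DeDv// andbT.
    exact: eset_sub.
  - by [].
rewrite -mulr_sumr ler_pM2l ?exprn_gt0// -mulr_sumr [leRHS]mulrAC ler_pM2l ?divr_gt0 ?exprn_gt0//.
by rewrite -natr_sum -natrX ler_nat; exact: sum_copies.
Qed.

(** [sum_meeting_copies] is applied to c against the union of a and b, then to b against a. Each
    application costs p^e n^v / psi times a power of [(2 * v).+1], since the set being met has at
    most [2 * v] vertices; the remaining sum over a is bounded by the number of copies. *)
Lemma triple_sum_le :
  \sum_(a in copies) \sum_(b in copies | share a b)
    \sum_(c in copies | share a c || share b c) p ^+ #|eset a :|: eset b :|: eset c| <=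
  ((2 * v).+1 ^ v)%:R ^+ 2 * (n%:R ^+ v * p ^+ e) ^+ 3 / psi ^+ 2.
Proof.
pose Q : R := p ^+ e * (n * (2 * v).+1)%:R ^+ v / psi.
have Q0 : 0 <= Q by rewrite !mulr_ge0 ?exprn_ge0 ?invr_ge0// ltW.
have QE Dv : (#|Dv : {set 'I_n}| <= 2 * v)%N ->
    p ^+ e * (n * #|Dv|.+1)%:R ^+ v / psi <= Q.
  move=> Dv2; rewrite ler_pM2r ?invr_gt0// ler_pM2l ?exprn_gt0//.
  by rewrite lerXn2r ?nnegrE// ler_nat leq_mul2l ltnS Dv2 orbT.
have cv (a : graph 'I_n) : a \in copies -> #|vset a| = v by rewrite inE => /iso_nv.
have step2 a b : a \in copies -> b \in copies ->
    \sum_(c in copies | share a c || share b c) p ^+ #|eset a :|: eset b :|: eset c| <=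
    p ^+ #|eset a :|: eset b| * Q.
  move=> aC bC.
  rewrite (eq_bigl (fun c => (c \in copies) && ((eset a :|: eset b) :&: eset c != set0))); last first.
    by move=> c; rewrite /share setIUl setU_eq0 negb_and.
  apply: (le_trans (@sum_meeting_copies (vset a :|: vset b) _ _)).
    move=> f; rewrite inE => /orP[fa|fb].
      by rewrite subsetU// (eset_sub fa).
    by rewrite subsetU// (eset_sub fb) orbT.
  rewrite ler_pM2l ?exprn_gt0//; apply: QE.
  by rewrite (leq_trans (leq_card_setU _ _))// !cv// mul2n addnn.
have step1 a : a \in copies ->
    \sum_(b in copies | share a b) p ^+ #|eset a :|: eset b| <= p ^+ e * Q.
  move=> aC; apply: (le_trans (@sum_meeting_copies (vset a) _ _)).
    by move=> f; exact: eset_sub.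
  move: (aC); rewrite inE => /iso_ne ae; rewrite [#|eset a|]ae.
  rewrite ler_pM2l ?exprn_gt0//; apply: QE.
  by rewrite cv// mul2n -addnn leq_addr.
apply: (@le_trans _ _ (\sum_(a in copies) p ^+ e * Q * Q)).
  apply: ler_sum => a aC.
  apply: (@le_trans _ _ (\sum_(b in copies | share a b) p ^+ #|eset a :|: eset b| * Q)).
    by apply: ler_sum => b /andP[bC _]; exact: step2.
  by rewrite -mulr_suml ler_wpM2r// step1.
rewrite sumr_const -[leLHS]mulr_natl.
apply: (@le_trans _ _ (n%:R ^+ v * (p ^+ e * Q * Q))).
  apply: ler_wpM2r.
    by apply: mulr_ge0 => //; apply: mulr_ge0 => //; rewrite exprn_ge0// ltW.
  by rewrite -natrX ler_nat; exact: card_copies_le.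
rewrite /Q natrM exprMn natrX le_eqVlt; apply/orP; left; apply/eqP.
have psin : psi != 0 by rewrite gt_eqF.
move: psin (n%:R ^+ v) (p ^+ e) ((2 * v).+1%:R ^+ v) => /= psin x y z.
by field.
Qed.

End upper.

Section lower.
Hypothesis vn : (v <= n)%N.
Hypothesis e1 : (1 <= e)%N.
Hypothesis v1 : (1 <= v)%N.
(** Two copies are counted from below, each count losing a factor [v ^ v] through [expn_le_bin]. *)
Let kappa : R := ((v ^ v)%:R ^+ 2)^-1.

Let copies_ge : (n%:R ^+ v : R) <= (v ^ v)%:R * #|copies|%:R.
Proof.
rewrite -natrX -natrM ler_nat (leq_trans (expn_le_bin vn))//.
by rewrite leq_mul2l bin_le_card_copies ?orbT.
Qed.

Let vv0 : 0 < (v ^ v)%:R :> R. Proof. by rewrite ltr0n expn_gt0 v1. Qed.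

(** Two copies with a common edge have at most [2 * e - 1] edges together, so each term is at least
    p^(2e - 1); [card_share] bounds the number of such pairs below by the squared number of copies
    over n^2. *)
Lemma pair_sum_ge_edge :
  kappa * (n%:R ^+ v * p ^+ e) ^+ 2 / (n%:R ^+ 2 * p) <=
  \sum_(a in copies) \sum_(b in copies | share a b) p ^+ #|eset a :|: eset b|.
Proof.
have N0 : 0 < n%:R :> R by rewrite ltr0n.
pose S : R := (\sum_(a in copies) \sum_(b in copies | share a b) 1)%N%:R.
apply: (@le_trans _ _ (S * (p ^+ (e + e) / p))); last first.
  rewrite /S natr_sum mulr_suml; apply: ler_sum => a aC.
  rewrite natr_sum mulr_suml; apply: ler_sum => b /andP[bC ab].
  rewrite mul1r ler_pdivrMr// -exprSr.
  apply: ler_wiXn2l => //; first exact: ltW p0.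
  have := cardsUI (eset a) (eset b).
  move: (aC) (bC); rewrite !inE => /iso_ne + /iso_ne; rewrite /ne => -> ->.
  have : (0 < #|eset a :&: eset b|)%N by rewrite card_gt0.
  by rewrite /e /ne; lia.
have h : #|copies|%:R ^+ 2 <= n%:R ^+ 2 * S.
  have := card_share G n.
  rewrite expnMn -(mulnn (ne G)) -mulnA [X in (_ <= X)%N -> _]mulnCA leq_pmul2l ?(leq_trans _ e1)//.
  move=> h; rewrite /S -!natrX -natrM ler_nat (leq_trans _ h)//.
  by rewrite leq_pmull// (leq_trans _ e1).
have h2 : n%:R ^+ v * n%:R ^+ v <= (v ^ v)%:R ^+ 2 * (n%:R ^+ 2 * S).
  apply: (@le_trans _ _ ((v ^ v)%:R ^+ 2 * #|copies|%:R ^+ 2)).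
    rewrite -expr2 -[leRHS]exprMn lerXn2r ?nnegrE ?exprn_ge0 ?mulr_ge0//.
  by rewrite ler_wpM2l// exprn_ge0// ltW.
have -> : kappa * (n%:R ^+ v * p ^+ e) ^+ 2 / (n%:R ^+ 2 * p) =
   (n%:R ^+ v * n%:R ^+ v) / ((v ^ v)%:R ^+ 2 * n%:R ^+ 2) * (p ^+ (e + e) / p).
  rewrite /kappa exprD.
  have [nz pz vz] : [/\ n%:R != 0 :> R, p != 0 & (v ^ v)%:R != 0 :> R].
    by rewrite !gt_eqF.
  move: (n%:R ^+ v) (p ^+ e) => x y.
  move: (n%:R : R) ((v ^ v)%:R : R) nz vz => z t nz vz.
  by field; rewrite nz vz pz.
rewrite ler_pM2r ?divr_gt0 ?exprn_gt0// ler_pdivrMr ?mulr_gt0 ?exprn_gt0//.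
by rewrite (le_trans h2)// mulrA mulrC.
Qed.

(** Only the terms b = a are kept. One factor [v ^ v] would suffice; the square gives the same
    constant as in [pair_sum_ge_edge]. *)
Lemma pair_sum_ge_diag :
  kappa * (n%:R ^+ v * p ^+ e) ^+ 2 / (n%:R ^+ v * p ^+ e) <=
  \sum_(a in copies) \sum_(b in copies | share a b) p ^+ #|eset a :|: eset b|.
Proof.
have N0 : 0 < n%:R :> R by rewrite ltr0n.
apply: (@le_trans _ _ (\sum_(a in copies) p ^+ e)); last first.
  apply: ler_sum => a aC.
  move: (aC); rewrite inE => /iso_ne ae.
  have aa : (a \in copies) && share a a.
    by rewrite aC /share setIid -card_gt0 [#|eset a|]ae.
  rewrite (bigD1 a)//= setUid [#|eset a|]ae lerDl sumr_ge0// => b _.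
  by rewrite exprn_ge0// ltW.
rewrite sumr_const -[leRHS]mulr_natl expr2 mulrA mulfK ?mulf_neq0 ?expf_neq0 ?gt_eqF//.
rewrite mulrA ler_pM2r ?exprn_gt0// /kappa mulrC ler_pdivrMr ?exprn_gt0//.
rewrite (le_trans copies_ge)// mulrC ler_wpM2l// expr2 ler_peMl ?(ltW vv0)//.
by rewrite ler1n expn_gt0 v1.
Qed.

End lower.
End copies_weights.

(** * Minimising n^u p^f over subgraphs of a graph of the class B *)

Section density_powers.
Variables (R : realFieldType) (N p : R) (v e u f : nat).
Hypothesis N1 : 1 <= N.
Hypothesis p01 : 0 < p <= 1.
Hypothesis v3 : (3 <= v)%N.
Hypothesis u2 : (2 <= u)%N.
Hypothesis f1 : (1 <= f)%N.
Hypothesis uf : ((f - 1) * (v - 2) <= (e - 1) * (u - 2))%N.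

Let p0 : 0 < p. Proof. by case/andP: p01. Qed.
Let p1 : p <= 1. Proof. by case/andP: p01. Qed.
Let N0 : 0 < N. Proof. exact: lt_le_trans N1. Qed.

Let split_uf : N ^+ u * p ^+ f = N ^+ 2 * p * (N ^+ (u - 2) * p ^+ (f - 1)).
Proof.
rewrite -{1}(subnKC u2) -{1}(subnKC f1) !exprD expr1; ring.
Qed.

(** The powers [u - 2] and [v - 2] equalise the exponents of [N]; those of [p] are compared by the
    density inequality [uf], and p <= 1. This keeps all exponents natural. *)
Let key : (N ^+ (v - 2) * p ^+ (e - 1)) ^+ (u - 2) <=
  (N ^+ (u - 2) * p ^+ (f - 1)) ^+ (v - 2).
Proof.
rewrite !exprMn -!exprM mulnC ler_wpM2l ?exprn_ge0// ?(ltW N0)//.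
by apply: ler_wiXn2l; rewrite ?(ltW p0).
Qed.

Let x0 k l : 0 < N ^+ k * p ^+ l. Proof. by rewrite mulr_gt0 ?exprn_gt0. Qed.

(** After the factor N^2 p of a single edge is split off, the cofactor of (u, f) must be at least 1:
    if it were below 1, so would be its power [v - 2], against [key]. *)
Lemma density_powers_dense : 1 <= N ^+ (v - 2) * p ^+ (e - 1) ->
  N ^+ 2 * p <= N ^+ u * p ^+ f.
Proof.
move=> h; rewrite split_uf ler_peMr ?(ltW (mulr_gt0 _ _)) ?exprn_gt0//.
have : 1 <= (N ^+ (u - 2) * p ^+ (f - 1)) ^+ (v - 2).
  by apply: le_trans key; rewrite exprn_ege1.
apply: contraTT; rewrite -!ltNge => lt1.
by rewrite exprn_ilt1 ?(ltW (x0 _ _))// subn_eq0 -ltnNge.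
Qed.

Lemma density_powers_sparse : (1 <= e)%N -> (u <= v)%N ->
  N ^+ (v - 2) * p ^+ (e - 1) <= 1 -> N ^+ v * p ^+ e <= N ^+ u * p ^+ f.
Proof.
move=> e1 uv h.
have -> : N ^+ v * p ^+ e = N ^+ 2 * p * (N ^+ (v - 2) * p ^+ (e - 1)).
  have v2 : (2 <= v)%N by lia.
  rewrite -{1}(subnKC v2) -{1}(subnKC e1) !exprD expr1; ring.
rewrite split_uf ler_pM2l ?mulr_gt0 ?exprn_gt0//.
rewrite -(@ler_pXn2r _ (v - 2)) ?nnegrE ?(ltW (x0 _ _))//; last by lia.
(* The base is at most 1 and [u - 2 <= v - 2], so the smaller exponent gives the larger power. *)
apply: le_trans key; apply: ler_wiXn2l => //; first exact: ltW.
by lia.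
Qed.

End density_powers.

(** * Stein's equation for the normal law *)

Local Open Scope classical_set_scope.

Lemma ndecr_derive (R : realType) (f df : R -> R) (a b : R) : a <= b ->
  (forall x, a <= x <= b -> is_derive x 1 f (df x)) ->
  (forall x, a <= x <= b -> 0 <= df x) -> f a <= f b.
Proof.
move=> ab fd df0.
have [||c cab fE] := @MVT_segment _ f df _ _ ab.
- by move=> x xab; apply: fd; rewrite !ltW ?(itvP xab).
- apply: derivable_within_continuous => x xab.
  by have /fd[] : a <= x <= b by rewrite !(itvP xab).
- by rewrite -subr_ge0 fE mulr_ge0 ?subr_ge0// df0// !(itvP cab).
Qed.

Local Notation phi := (normal_pdf 0 1).

Lemma normal_pdf01E (R : realType) (x : R) :
  phi x = normal_peak 1 * expR (- x ^+ 2 / 2).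
Proof.
by rewrite normal_pdfE ?oner_neq0// /normal_fun subr0 expr1n.
Qed.

Lemma normal_pdf01_gt0 (R : realType) (x : R) : 0 < phi x.
Proof. by rewrite normal_pdf01E mulr_gt0 ?expR_gt0// normal_peak_gt0 ?oner_neq0. Qed.

Lemma is_derive_normal_pdf01 (R : realType) (x : R) :
  is_derive x 1 (phi : R -> R) (- x * phi x).
Proof.
have -> : (phi : R -> R) = fun x => normal_peak 1 * expR (- x ^+ 2 / 2).
  by apply/funext => y; exact: normal_pdf01E.
apply: is_derive_eq.
rewrite /GRing.scale/=; set e := expR _.
by field.
Qed.

Lemma measurable_normal_pdf01 (R : realType) : measurable_fun setT (phi : R -> R).
Proof. exact: measurable_normal_pdf. Qed.

(** * Integration against the normal density *)

Section normal_integral.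
Variable R : realType.
Notation mu := (@lebesgue_measure R).
Notation N := (normal_prob (0 : R) 1).

Lemma integrable_norm_normal_pdf01 :
  mu.-integrable [set: R] (fun x => (`|x| * phi x)%:E).
Proof.
(* The density with standard deviation 2 dominates, because |x| <= 3 exp(3 x^2 / 8). This follows
   from exp s >= 1 + s and |x| <= (1 + x^2) / 2, and 3/8 is the difference of the exponents 1/2 and
   1/8. *)
pose K : R := 3 * (normal_peak 1 / normal_peak 2).
have p1 : 0 < (normal_peak 1 : R) by rewrite normal_peak_gt0 ?oner_neq0.
have p2 : 0 < (normal_peak 2 : R) by rewrite normal_peak_gt0 ?pnatr_eq0.
have K0 : 0 <= K by rewrite /K mulr_ge0// ?divr_ge0 ?ltW.
apply: (@le_integrable _ _ _ mu _ _ _ (fun x => (K * normal_pdf 0 2 x)%:E)) => //.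
- apply/measurable_EFinP; apply: measurable_funM; first exact: normr_measurable.
  exact: measurable_normal_pdf.
- move=> x _; rewrite /= lee_fin (normrM `|x|) (normrM K) normr_id (ger0_norm K0).
  rewrite (ger0_norm (normal_pdf_ge0 _ _ _)) (ger0_norm (normal_pdf_ge0 _ _ _)).
  rewrite normal_pdf01E normal_pdfE ?pnatr_eq0// /normal_fun subr0 /K.
  have -> : - x ^+ 2 / (2 ^+ 2 *+ 2) = - x ^+ 2 / 2 + 3 / 8 * x ^+ 2 :> R by field.
  rewrite expRD; set e := expR _; set s := 3 / 8 * _.
  have e0 : 0 < e by exact: expR_gt0.
  have -> : 3 * (normal_peak 1 / normal_peak 2) * (normal_peak 2 * (e * expR s)) =
            (normal_peak 1 * e) * (3 * expR s).
    by field; rewrite gt_eqF.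
  rewrite [leLHS]mulrC ler_pM2l ?mulr_gt0//.
  have : 1 + s <= expR s by exact: expR_ge1Dx.
  have := sqr_ge0 (`|x| - 1); rewrite sqrrB real_normK ?num_real// /s => h1 h2.
  nra.
- apply: (@eq_integrable _ _ _ mu _ _ (fun x => K%:E * (normal_pdf 0 2 x)%:E)%E) => //.
  by apply: integrableZl => //; exact: integrable_normal_pdf.
Qed.

Lemma Radon_Nikodym_normal_prob :
  ae_eq mu setT (Radon_Nikodym_SigmaFinite.f N mu) (fun x => (phi x)%:E).
Proof.
have dom := @normal_prob_dominates R 0 1.
apply: integral_ae_eq => //.
- exact: Radon_Nikodym_SigmaFinite.f_integrable.
- by apply/measurable_EFinP; exact: measurable_normal_pdf01.
- by move=> A _ mA; rewrite -Radon_Nikodym_SigmaFinite.f_integral.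
Qed.

(** The nonnegative case comes first: applied to |f| it transfers integrability from Lebesgue
    measure to the normal law, which the signed case presupposes. *)
Lemma ge0_integral_normal_prob (f : R -> R) : measurable_fun setT f ->
  (forall x, 0 <= f x) ->
  (\int[N]_x (f x)%:E = \int[mu]_x (f x * phi x)%:E)%E.
Proof.
move=> mf f0.
have dom := @normal_prob_dominates R 0 1.
rewrite -(Radon_Nikodym_SigmaFinite.change_of_variables dom)//; last first.
  exact/measurable_EFinP.
apply: ae_eq_integral => //.
- apply: emeasurable_funM; first exact/measurable_EFinP.
  by apply: measurable_int; exact: Radon_Nikodym_SigmaFinite.f_integrable.
- apply/measurable_EFinP; apply: measurable_funM => //.
  exact: measurable_normal_pdf01.
- under [X in ae_eq _ _ _ X]eq_fun do rewrite EFinM.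
  by apply: ae_eqe_mul2l; exact: Radon_Nikodym_normal_prob.
Qed.

Lemma integrable_normal_prob (f : R -> R) : measurable_fun setT f ->
  mu.-integrable setT (fun x => (f x * phi x)%:E) ->
  N.-integrable setT (EFin \o f).
Proof.
move=> mf /integrableP[_ fi]; apply/integrableP; split.
  exact/measurable_EFinP.
under eq_integral do rewrite /= .
rewrite (@ge0_integral_normal_prob (fun x => `|f x|))//; last first.
  exact: measurableT_comp.
under eq_integral do rewrite -(@ger0_norm _ (phi _)) ?normal_pdf_ge0// -normrM.
exact: fi.
Qed.

Lemma Rintegral_normal_prob (f : R -> R) : measurable_fun setT f ->
  mu.-integrable setT (fun x => (f x * phi x)%:E) ->
  \int[N]_x f x = \int[mu]_x (f x * phi x).
Proof.
move=> mf fi; rewrite /Rintegral.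
have nf := integrable_normal_prob mf fi.
have dom := @normal_prob_dominates R 0 1.
rewrite -(Radon_Nikodym_change_of_variables dom)//; congr fine.
apply: ae_eq_integral => //.
- apply: emeasurable_funM; first exact/measurable_EFinP.
  by apply: measurable_int; exact: Radon_Nikodym_integrable.
- apply/measurable_EFinP; apply: measurable_funM => //.
  exact: measurable_normal_pdf01.
- under [X in ae_eq _ _ _ X]eq_fun do rewrite EFinM.
  apply: ae_eqe_mul2l.
  apply: ae_eq_trans Radon_Nikodym_normal_prob.
  exact/ae_eq_sym/ae_eq_Radon_Nikodym_SigmaFinite.
Qed.

(** By dominated convergence with dominating function |psi|. This and [cvg_Rintegral_itvNyN] supply
    the limits at both ends of the line of the primitive that solves the Stein equation. *)
Lemma cvg_Rintegral_itvNy (psi : R -> R) : mu.-integrable setT (EFin \o psi) ->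
  \int[mu]_(t in `]-oo, n%:R]) psi t @[n --> \oo] --> \int[mu]_t psi t.
Proof.
move=> ipsi.
have mpsi : measurable_fun setT psi by case/integrableP : ipsi => /measurable_EFinP.
pose f n x := (psi \_ `]-oo, (n%:R : R)]) x.
under eq_fun do rewrite Rintegral_mkcond.
have [|||||_ _ c] := @dominated_convergence _ _ _ mu setT measurableT
  (fun n x => (f n x)%:E) (EFin \o psi) (fun x => `|psi x|%:E).
- move=> n; apply/measurable_EFinP.
  by apply/(measurable_restrictT _ _).1 => //; exact: measurable_funTS.
- exact/measurable_EFinP.
- apply: aeW => x _; apply: cvg_near_cst.
  near=> n; rewrite /f patchE ifT// inE/= in_itv/=.
  by near: n; exact: nbhs_infty_ger.
- exact: integrable_norm.
- apply: aeW => x n _; rewrite /f patchE; case: ifP => _; rewrite /= lee_fin//.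
  by rewrite normr0.
- by apply: fine_cvg; rewrite fineK ?integrable_fin_num.
Unshelve. all: by end_near. Qed.

Lemma cvg_Rintegral_itvNyN (psi : R -> R) : mu.-integrable setT (EFin \o psi) ->
  \int[mu]_(t in `]-oo, - n%:R]) psi t @[n --> \oo] --> (0 : R).
Proof.
move=> ipsi.
have mpsi : measurable_fun setT psi by case/integrableP : ipsi => /measurable_EFinP.
pose f n x := (psi \_ `]-oo, (- n%:R : R)]) x.
under eq_fun do rewrite Rintegral_mkcond.
have [|||||_ _ c] := @dominated_convergence _ _ _ mu setT measurableT
  (fun n x => (f n x)%:E) (cst 0%E) (fun x => `|psi x|%:E).
- move=> n; apply/measurable_EFinP.
  by apply/(measurable_restrictT _ _).1 => //; exact: measurable_funTS.
- exact: measurable_cst.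
- apply: aeW => x _; apply: cvg_near_cst.
  near=> n; rewrite /f patchE ifF// ; apply/negbTE; rewrite notin_setE/= in_itv/=.
  apply/negP; rewrite -ltNge ltrNl.
  by near: n; exact: nbhs_infty_gtr.
- exact: integrable_norm.
- apply: aeW => x n _; rewrite /f patchE; case: ifP => _; rewrite /= lee_fin//.
  by rewrite normr0.
- by apply: fine_cvg; rewrite integral0 in c.
Unshelve. all: by end_near. Qed.

End normal_integral.

(** * A priori bounds for bounded solutions of u' = x u + k *)

Section stein_bounded.
Variable R : realType.

(* If x * u x > K, then u grows at least like exp (y ^ 2 / 2) for y >= x and is unbounded. *)
Let stein_le (u k : R -> R) (B K x : R) :
  (forall x : R, is_derive x 1 u (x * u x + k x)) ->
  (forall x, `|u x| <= B) -> (forall x, `|k x| <= K) -> 0 < x -> x * u x <= K.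
Proof.
move=> du uB kK x0; rewrite leNgt; apply/negP => uK.
have K0 : 0 <= K by exact: le_trans (normr_ge0 _) (kK 0).
(* For z >= x one has c z >= K, so (u z - c) phi z, whose derivative is (k z + c z) phi z, is
   nondecreasing from its positive value [eta] at x. *)
pose c := K / x.
have c0 : 0 <= c by rewrite divr_ge0// ltW.
pose eta := (u x - c) * phi x.
have eta0 : 0 < eta.
  by rewrite mulr_gt0 ?normal_pdf01_gt0// subr_gt0 ltr_pdivrMr// mulrC.
have mono y : x <= y -> eta <= (u y - c) * phi y.
  move=> xy.
  apply: (@ndecr_derive R (fun z => (u z - c) * phi z)
    (fun z => (k z + c * z) * phi z) x y xy) => z /andP[xz zy].
    have du' := du z.
    have dp := is_derive_normal_pdf01 z.
    apply: is_derive_eq.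
    by rewrite /GRing.scale/=; ring.
  rewrite mulr_ge0 ?normal_pdf_ge0//.
  have : - K <= k z by have := kK z; rewrite ler_norml => /andP[].
  have : K <= c * z by rewrite /c mulrAC ler_pdivlMr// ler_wpM2l.
  lra.
pose P : R := normal_peak 1.
have P0 : 0 < P by rewrite /P normal_peak_gt0// oner_neq0.
have phile (y : R) : phi y * y <= P.
  rewrite normal_pdf01E -mulrA ler_piMr ?(ltW P0)//.
  rewrite mulNr expRN mulrC ler_pdivrMr ?expR_gt0// mul1r.
  apply: le_trans (expR_ge1Dx _).
  by have := sqr_ge0 (y - 1); rewrite sqrrB; lra.
have Bc : 0 < B - c.
  have := uB x; rewrite ler_norml => /andP[_ uxB].
  have : 0 < u x - c by rewrite -(pmulr_lgt0 _ (normal_pdf01_gt0 x)).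
  by move=> h; rewrite (lt_le_trans h)// lerB.
(* This y is so large that [eta * y] exceeds [(B - c) * P], although [mono] and y phi(y) <= P bound
   it by that product. *)
pose y := x + (B - c) * P / eta.
have xy : x <= y by rewrite /y lerDl; apply: divr_ge0; [apply: mulr_ge0|]; exact: ltW.
have y0 : 0 < y by exact: lt_le_trans x0 xy.
have h1 : eta <= (B - c) * phi y.
  apply: le_trans (mono _ xy) _; rewrite ler_wpM2r ?normal_pdf_ge0// lerB//.
  by have := uB y; rewrite ler_norml => /andP[].
have h2 : eta * y <= (B - c) * P.
  apply: (@le_trans _ _ ((B - c) * (phi y * y))).
    by rewrite mulrA ler_wpM2r// ltW.
  by rewrite ler_wpM2l// ltW.
have : (B - c) * P < eta * y.
  by rewrite /y mulrDr mulrCA divff ?gt_eqF// mulr1 ltrDr mulr_gt0.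
by rewrite ltNge h2.
Qed.

(** The equation is preserved by u -> -u with k -> -k, and by u(x) -> -u(-x) with k(x) -> k(-x);
    this reduces both signs of u and of x to [stein_le]. Boundedness by [B] excludes the solutions
    growing like exp(x^2 / 2), and the conclusion is uniform in [B]. *)
Lemma stein_bounded (u k : R -> R) (B K x : R) :
  (forall x : R, is_derive x 1 u (x * u x + k x)) ->
  (forall x, `|u x| <= B) -> (forall x, `|k x| <= K) -> `|x * u x| <= K.
Proof.
move=> du uB kK.
have pos (v l : R -> R) z : (forall x : R, is_derive x 1 v (x * v x + l x)) ->
    (forall x, `|v x| <= B) -> (forall x, `|l x| <= K) -> 0 < z ->
    `|z * v z| <= K.
  move=> dv vB lK z0; rewrite ler_norml (stein_le dv vB lK z0) andbT.
  rewrite lerNl -mulrN; apply: (@stein_le (fun x => - v x) (fun x => - l x) B) => //.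
  - move=> y; have dv' := dv y; apply: is_derive_eq.
    by rewrite mulrN -opprD.
  - by move=> y; rewrite normrN.
  - by move=> y; rewrite normrN.
have [x0|x0|<-] := ltgtP 0 x.
- exact: pos du uB kK x0.
- rewrite -[x in x * _]opprK mulNr -mulrN -[x in u x]opprK.
  apply: (pos (fun x => - u (- x)) (fun x => k (- x))) => //.
  + move=> y.
    have duy := du (- y).
    have dn : is_derive y 1 (-%R : R -> R) (- 1) by exact: is_deriveN.
    have := @is_derive1_comp _ u -%R y _ _ duy dn.
    move=> h.
    have := @is_deriveN _ _ _ _ _ _ _ h.
    by rewrite mulrN1 opprK mulrN mulNr.
  + by move=> y; rewrite normrN.
  + by rewrite oppr_gt0.
- by rewrite mul0r normr0; exact: le_trans (normr_ge0 _) (kK 0).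
Qed.

(* The increment D z = f (z + s) - f z solves D' = z * D + k with a bounded k. *)
Lemma stein_solution_lipschitz (f f' h : R -> R) (B x y : R) :
  (forall x : R, is_derive x 1 f (f' x)) ->
  (forall x, f' x = x * f x + h x) ->
  (forall x, `|f x| <= B) -> (forall x y, `|h x - h y| <= `|x - y|) ->
  `|f' x - f' y| <= 2 * (B + 1) * `|x - y|.
Proof.
move=> df f'E fB hL.
pose s := x - y.
have -> : x = y + s by rewrite /s addrC subrK.
have -> : y + s - y = s by rewrite addrC addKr.
pose k z := s * f (z + s) + (h (z + s) - h z).
have kB z : `|k z| <= (B + 1) * `|s|.
  rewrite /k [leRHS]mulrDl mul1r (le_trans (ler_normD _ _))// lerD//.
    by rewrite normrM mulrC ler_wpM2r.
  by rewrite (le_trans (hL _ _))// addrC addKr.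
pose D z := f (z + s) - f z.
have D'E z : f' (z + s) - f' z = z * D z + k z by rewrite !f'E /D /k; ring.
have dD (z : R) : is_derive z 1 D (z * D z + k z).
  rewrite -D'E /D.
  have d1 : is_derive z 1 (fun z => z + s) (1 : R).
    by apply: is_derive_eq; rewrite addr0.
  have := @is_derive1_comp _ f (fun z => z + s) z _ _ (df (z + s)) d1.
  rewrite mulr1 => d2; have d3 := df z.
  by apply: is_derive_eq.
have DB z : `|D z| <= B + B by rewrite (le_trans (ler_normB _ _))// lerD.
rewrite D'E (le_trans (ler_normD _ _))//.
have := stein_bounded y dD DB kB; have := kB y; lra.
Qed.

End stein_bounded.

(** * The bounded solution of the Stein equation for a Lipschitz function *)

Section stein_equation.
Variables (R : realType) (h : R -> R).
Notation mu := (@lebesgue_measure R).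
Notation N := (normal_prob (0 : R) 1).
Hypothesis hL : forall x y, `|h x - h y| <= `|x - y|.

Let M : R := \int[N]_x `|x|.
Let ht x := h x - \int[N]_x h x.
(** For |x| >= 1 this gives |ht x| <= |x| + M <= K |x|, so that in both tails the derivative of [g]
    is dominated by that of K phi. *)
Let K : R := 1 + M.

Let continuous_h : continuous h.
Proof.
move=> x; apply/(cvgrPdist_lt h) => e e0; near=> y.
apply: le_lt_trans (hL _ _) _; near: y.
exact: (@cvgr_dist_lt _ _ _ _ _ id x).
Unshelve. all: by end_near. Qed.

Let measurable_h : measurable_fun setT h.
Proof. exact: continuous_measurable_fun. Qed.

Let integrable_normN : N.-integrable setT (EFin \o (fun x : R => `|x|)).
Proof.
apply: integrable_normal_prob; first exact: normr_measurable.
exact: integrable_norm_normal_pdf01.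
Qed.

Let hle x : `|h x| <= `|h 0| + `|x|.
Proof.
have := hL x 0; rewrite subr0 => H.
by rewrite -(subrK (h 0) (h x)) (le_trans (ler_normD _ _))// addrC lerD.
Qed.

Lemma integrable_lipschitz_normal : N.-integrable setT (EFin \o h).
Proof.
apply: (@le_integrable _ _ _ N _ _ _ (fun x => (`|h 0| + `|x|)%:E)) => //.
- exact/measurable_EFinP.
- by move=> x _; rewrite /= lee_fin (@ger0_norm _ (_ + _)) ?addr_ge0.
- apply: (@integrableD _ _ _ N _ measurableT (cst `|h 0|%:E) (fun x => `|x|%:E)) => //.
  exact: finite_measure_integrable_cst.
Qed.

Lemma dist_lipschitz_normal : `|\int[N]_x h x - h 0| <= M.
Proof.
have -> : h 0 = \int[N]_x (cst (h 0) x).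
  rewrite Rintegral_cst//=.
  by rewrite [X in fine X](_ : _ = 1%E) ?mulr1//; exact: probability_setT.
rewrite -RintegralB//; [|exact: integrable_lipschitz_normal|exact: finite_measure_integrable_cst].
have i1 : N.-integrable setT (EFin \o (fun x => h x - h 0)).
  apply: (@integrableB _ _ _ N _ measurableT (EFin \o h) (cst (h 0)%:E)) => //.
    exact: integrable_lipschitz_normal.
  exact: finite_measure_integrable_cst.
apply: le_trans (le_normr_Rintegral _ i1) _ => //.
apply: le_Rintegral => //.
  exact: (integrable_norm i1).
by move=> x _; rewrite (le_trans (hL _ _))// subr0.
Qed.

Let ht_le x : `|ht x| <= `|x| + M.
Proof.
rewrite /ht (_ : _ - _ = (h x - h 0) - (\int[N]_x h x - h 0)); last by ring.
rewrite (le_trans (ler_normB _ _))// lerD ?dist_lipschitz_normal//.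
by rewrite (le_trans (hL _ _))// subr0.
Qed.

Let M0 : 0 <= M. Proof. exact: Rintegral_ge0. Qed.

Let measurable_ht : measurable_fun setT ht.
Proof. exact: measurable_funB. Qed.

Let psi x := ht x * phi x.

Let continuous_psi : continuous psi.
Proof.
move=> x; apply: cvgM; last exact: continuous_normal_pdf (oner_neq0 _) _.
by apply: cvgB; [exact: continuous_h|exact: cvg_cst].
Qed.

Let integrable_psi : mu.-integrable setT (EFin \o psi).
Proof.
apply: (@le_integrable _ _ _ mu _ _ _ (fun x => (`|x| * phi x + M * phi x)%:E)) => //.
- apply/measurable_EFinP; apply: continuous_measurable_fun.
  exact: continuous_psi.
- move=> x _; rewrite /= lee_fin [leRHS]ger0_norm//; last first.
    by rewrite addr_ge0// mulr_ge0// normal_pdf_ge0.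
  by rewrite -mulrDl normrM (ger0_norm (normal_pdf_ge0 _ _ _)) ler_wpM2r ?normal_pdf_ge0.
- apply: (@integrableD _ _ _ mu _ measurableT (fun x => (`|x| * phi x)%:E) (fun x => (M * phi x)%:E)) => //.
    exact: integrable_norm_normal_pdf01.
  apply: (@eq_integrable _ _ _ mu _ _ (fun x => M%:E * (phi x)%:E)%E) => //.
  by apply: integrableZl => //; exact: integrable_normal_pdf.
Qed.

Let psi0 : \int[mu]_x psi x = 0.
Proof.
rewrite -(Rintegral_normal_prob measurable_ht integrable_psi).
rewrite RintegralB//; [|exact: integrable_lipschitz_normal|exact: finite_measure_integrable_cst].
rewrite Rintegral_cst//=.
by rewrite [X in _ * fine X](_ : _ = 1%E) ?mulr1 ?subrr//; exact: probability_setT.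
Qed.

(** With the integrating factor phi, the equation f' = x f + ht becomes (f phi)' = ht phi, so the
    solution is f = g / phi. By [psi0], [g] vanishes at +oo as well as at -oo, which keeps f bounded
    on both sides. *)
Let g x := \int[mu]_(t in `]-oo, x]) psi t.

Let dg (x : R) : is_derive x 1 g (psi x).
Proof.
have xx1 : x < x + 1 by rewrite ltrDl.
have ipsi : mu.-integrable [set` Interval -oo%O (BRight (x + 1))] (EFin \o psi).
  exact: integrableS integrable_psi.
have cx : {for x, continuous psi} by exact: continuous_psi.
have [d1 d2] := continuous_FTC1 xx1 ipsi (ltNyr x) cx.
by split; [exact: d1|rewrite -derive1E; exact: d2].
Qed.

(** With s = 1 and s = -1, K phi + s g is nondecreasing on ]-oo, -1], its derivative being (-K z + s
    ht z) phi z, and [g] tends to 0 at -oo. *)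
Let g_leN x : x <= -1 -> `|g x| <= K * phi x.
Proof.
move=> x1.
suff H (s : R) : `|s| = 1 -> 0 <= K * phi x + s * g x.
  have := H 1; have := H (-1); rewrite normrN normr1 => /(_ erefl) + /(_ erefl).
  by rewrite mulN1r mul1r ler_norml => ? ?; apply/andP; split; lra.
move=> s1.
have c : s * g (- n%:R) @[n --> \oo] --> s * 0.
  exact: cvgM (@cvg_cst _ s _ _ _) (cvg_Rintegral_itvNyN integrable_psi).
rewrite mulr0 in c.
apply: (cvgr_to_le c); near=> n.
have nx : - n%:R <= x by rewrite lerNl; near: n; exact: nbhs_infty_ger.
apply: (@le_trans _ _ (K * phi (- n%:R) + s * g (- n%:R))).
  by rewrite lerDr mulr_ge0 ?normal_pdf_ge0// addr_ge0.
apply: (@ndecr_derive R (fun z => K * phi z + s * g z)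
  (fun z => (K * - z + s * ht z) * phi z) _ _ nx) => z /andP[_ zx].
  have d1 := dg z; have d2 := is_derive_normal_pdf01 z.
  by apply: is_derive_eq; rewrite /GRing.scale/= /psi; ring.
rewrite mulr_ge0 ?normal_pdf_ge0//.
have := ht_le z; rewrite -[X in X <= _](mul1r) -s1 -normrM ler_norml => /andP[h1 _].
rewrite ler0_norm ?(le_trans zx) ?(le_trans x1) ?lerN10// in h1.
have : M <= M * - z by rewrite ler_peMr// lerNr (le_trans zx).
rewrite /K; lra.
Unshelve. all: by end_near. Qed.

(** The mirror image of [g_leN]: here K phi + s g is nonincreasing on [1, +oo[, and its limit is
    controlled by [psi0]. *)
Let g_le x : 1 <= x -> `|g x| <= K * phi x.
Proof.
move=> x1.
suff H (s : R) : `|s| = 1 -> 0 <= K * phi x + s * g x.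
  have := H 1; have := H (-1); rewrite normrN normr1 => /(_ erefl) + /(_ erefl).
  by rewrite mulN1r mul1r ler_norml => ? ?; apply/andP; split; lra.
move=> s1.
have c : s * g (n%:R) @[n --> \oo] --> s * \int[mu]_x psi x.
  exact: cvgM (@cvg_cst _ s _ _ _) (cvg_Rintegral_itvNy integrable_psi).
rewrite psi0 mulr0 in c.
apply: (cvgr_to_le c); near=> n.
have nx : x <= n%:R by near: n; exact: nbhs_infty_ger.
apply: (@le_trans _ _ (K * phi (n%:R) + s * g (n%:R))).
  by rewrite lerDr mulr_ge0 ?normal_pdf_ge0// addr_ge0.
rewrite -lerN2.
apply: (@ndecr_derive R (fun z => - (K * phi z + s * g z))
  (fun z => (K * z - s * ht z) * phi z) _ _ nx) => z /andP[xz _].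
  have d1 := dg z; have d2 := is_derive_normal_pdf01 z.
  by apply: is_derive_eq; rewrite /GRing.scale/= /psi; ring.
rewrite mulr_ge0 ?normal_pdf_ge0//.
have := ht_le z; rewrite -[X in X <= _](mul1r) -s1 -normrM ler_norml => /andP[_ h1].
have z1 : 1 <= z by exact: le_trans xz.
rewrite ger0_norm ?(le_trans ler01)// in h1.
have : M <= M * z by rewrite ler_peMr.
rewrite /K; lra.
Unshelve. all: by end_near. Qed.

Let P : R := normal_peak 1.
(** On [-1, 1] it is the bound 3 K P on |g| over the minimum phi 1 of phi; it also exceeds the bound
    K valid in the tails. *)
Let B : R := 3 * K * P / phi 1.

Let K0 : 0 <= K. Proof. by rewrite addr_ge0. Qed.

Let phi_le x : phi x <= P. Proof. by apply: normal_pdf_ub; rewrite oner_neq0. Qed.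

(** Already |g(-1)| <= K P, and |psi| <= K P on an interval of length 2 adds at most 2 K P. *)
Let g_le_mid x : -1 <= x <= 1 -> `|g x| <= 3 * K * P.
Proof.
move=> /andP[x1 x1'].
suff H (s : R) : `|s| = 1 -> s * g x <= 3 * K * P.
  have := H 1; have := H (-1); rewrite normrN normr1 => /(_ erefl) + /(_ erefl).
  by rewrite mulN1r mul1r ler_norml => ? ?; apply/andP; split; lra.
move=> s1.
have KP0 : 0 <= K * P by rewrite mulr_ge0// normal_peak_ge0.
have h1 : K * P * -1 - s * g (-1) <= K * P * x - s * g x.
  apply: (@ndecr_derive R (fun z => K * P * z - s * g z)
    (fun z => K * P - s * psi z) _ _ x1) => z /andP[z1 zx].
    by have d1 := dg z; apply: is_derive_eq; rewrite /GRing.scale/=; ring.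
  rewrite subr_ge0 (le_trans (ler_norm _))// normrM s1 mul1r /psi normrM.
  rewrite ler_pM// ?(ger0_norm (normal_pdf_ge0 _ _ _))//.
  rewrite (le_trans (ht_le _))// lerD2r ler_norml z1/=.
  exact: le_trans x1'.
have h2 : s * g (-1) <= K * P.
  rewrite (le_trans (ler_norm _))// normrM s1 mul1r (le_trans (g_leN _))//.
  by rewrite ler_wpM2l.
have h3 : K * P * x <= K * P by rewrite ler_piMr.
lra.
Qed.

Let f x := g x / phi x.

Let f_le x : `|f x| <= B.
Proof.
have p0 (z : R) : 0 < phi z by exact: normal_pdf01_gt0.
rewrite /f normrM normfV (ger0_norm (normal_pdf_ge0 _ _ _)) ler_pdivrMr//.
have KB : K <= B.
  rewrite /B ler_pdivlMr//.
  have : K * phi 1 <= K * P by rewrite ler_wpM2l.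
  have : 0 <= K * P by rewrite mulr_ge0// normal_peak_ge0.
  lra.
have [x1|x1] := leP x (-1).
  by rewrite (le_trans (g_leN x1))// ler_wpM2r// ltW.
have [x2|x2] := leP 1 x.
  by rewrite (le_trans (g_le x2))// ler_wpM2r// ltW.
apply: (@le_trans _ _ (3 * K * P)); first by rewrite g_le_mid// !ltW.
rewrite /B [leRHS]mulrAC ler_pdivlMr// ler_wpM2l//; first by rewrite !mulr_ge0// normal_peak_ge0.
rewrite !normal_pdf01E ler_wpM2l ?normal_peak_ge0//.
rewrite ler_expR; have : 0 <= (1 - x) * (1 + x) by rewrite mulr_ge0; lra.
lra.
Qed.

Lemma stein_solution_subproof : exists f f' : R -> R,
  [/\ forall x : R, is_derive x 1 f (f' x),
      forall x, f' x = x * f x + (h x - \int[N]_x h x),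
      forall x, `|f x| <= 2 * (B + 1) &
      forall x y, `|f' x - f' y| <= 2 * (B + 1) * `|x - y| ].
Proof.
have df (x : R) : is_derive x 1 f (x * f x + ht x).
  have p0 : phi x != 0 by rewrite gt_eqF// normal_pdf01_gt0.
  have d1 := dg x; have d2 := is_derive_normal_pdf01 x.
  apply: is_derive_eq.
  by rewrite /GRing.scale/= /f /psi; field.
exists f, (fun x => x * f x + ht x); split => //.
- by move=> x; have := f_le x; have := normr_ge0 (f x); lra.
- move=> x y; apply: (@stein_solution_lipschitz R f _ ht B x y df) => //.
  by move=> z z'; rewrite /ht opprB addrA subrK.
Qed.

End stein_equation.

Definition stein_bound (R : realType) (L : R) := forall h : R -> R,
  (forall x y, `|h x - h y| <= `|x - y|) ->
  exists f f' : R -> R,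
    [/\ forall x : R, is_derive x 1 f (f' x),
        forall x : R, f' x = x * f x + (h x - \int[normal_prob 0 1]_x h x),
        forall x : R, `|f x| <= L
      & forall x y : R, `|f' x - f' y| <= L * `|x - y|].

(** The constant of [stein_solution_subproof] is built from E|N|, the peak of phi and phi 1. It does
    not mention h, so one [L] serves all h. *)
Lemma stein_solution (R : realType) : exists L : R, 0 < L /\ stein_bound L.
Proof.
have M0 : 0 <= \int[normal_prob (0 : R) 1]_x `|x| by exact: Rintegral_ge0.
eexists; split; last exact: stein_solution_subproof.
rewrite mulr_gt0// ltr_wpDl// divr_ge0 ?normal_pdf_ge0//.
by rewrite !mulr_ge0 ?addr_ge0 ?normal_peak_ge0.
Qed.

(** * Independence of blocks *)

Section indep_sigma.
Context d (T : measurableType d) (R : realType) (P : probability T R).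
Local Open Scope ereal_scope.

(** The events independent of a fixed [D] form a Dynkin system, so independence passes from a
    pi-system to the sigma-algebra it generates. [indep_sigma] uses this once in each argument. *)
Let indep_dynkin (C : set (set T)) (D : set T) :
  C `<=` measurable -> setI_closed C -> measurable D ->
  (forall E, C E -> P (E `&` D) = P E * P D) ->
  forall E, <<s C >> E -> measurable E /\ P (E `&` D) = P E * P D.
Proof.
move=> Cm CI mD CD E; rewrite -setI_closed_g_dynkin_g_sigma_algebra//.
suff : <<d C >> `<=` [set E | measurable E /\ P (E `&` D) = P E * P D] by exact.
apply: smallest_sub => [|A CA]; last by split; [exact: Cm|exact: CD].
split.
- by split => //; rewrite setTI probability_setT mul1e.
- move=> A [mA PA]; split; first exact: measurableC.
  rewrite probability_setC// muleBl ?fin_num_measure// mul1e -PA.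
  rewrite setIC -setDE measureD// ?ltey_eq ?fin_num_measure//.
  by rewrite setIC.
- move=> F tF FD; split; first by apply: bigcupT_measurable => k; have [] := FD k.
  have mF k : measurable (F k) by have [] := FD k.
  rewrite setI_bigcupl measure_bigcup//; last 2 first.
    by move=> k _; exact: measurableI.
    exact: trivIset_setIr.
  have PD : P D = (fine (P D))%:E by rewrite fineK ?fin_num_measure.
  rewrite measure_bigcup// muleC PD -nneseriesZl//.
  by apply: eq_eseriesr => k _; rewrite -PD muleC; have [] := FD k.
Qed.

Lemma indep_sigma (C1 C2 : set (set T)) :
  C1 `<=` measurable -> C2 `<=` measurable ->
  setI_closed C1 -> setI_closed C2 ->
  (forall E1 E2, C1 E1 -> C2 E2 -> P (E1 `&` E2) = P E1 * P E2) ->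
  forall E1 E2, <<s C1 >> E1 -> <<s C2 >> E2 -> P (E1 `&` E2) = P E1 * P E2.
Proof.
move=> m1 m2 I1 I2 CC E1 E2 sE1 sE2.
have mE1 : measurable E1.
  by move: E1 sE1; apply: smallest_sub m1; exact: sigma_algebra_measurable.
rewrite setIC muleC; apply: (indep_dynkin m2 I2 mE1 _ sE2).2 => E CE.
rewrite setIC muleC; apply: (indep_dynkin m1 I1 _ _ sE1).2 => //; first exact: m2.
by move=> E' CE'; exact: CC.
Qed.

End indep_sigma.

Section expectation_indep.
Context d (T : measurableType d) (R : realType) (P : probability T R).

(** The joint law agrees with the product of the laws on rectangles, hence everywhere by uniqueness
    of the product measure; Fubini's theorem then factors the integral of x y. *)
Let expectation_indep_RV (F G : {RV P >-> R}) :
  (forall A B, measurable A -> measurable B ->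
     P (F @^-1` A `&` G @^-1` B) = (P (F @^-1` A) * P (G @^-1` B))%E) ->
  P.-integrable setT (EFin \o F) -> P.-integrable setT (EFin \o G) ->
  P.-integrable setT (EFin \o (fun w => F w * G w)) ->
  \int[P]_w (F w * G w) = \int[P]_w F w * \int[P]_w G w.
Proof.
move=> ind iF iG iFG.
pose FG w : R * R := (F w, G w).
have mFG : measurable_fun setT FG by exact/measurable_fun_pair.
pose H : {RV P >-> (R * R)%type} := mfun_Sub (mem_set mFG).
have HE : H = FG :> (T -> R * R) by [].
pose muH := distribution P H.
pose muF := distribution P F.
pose muG := distribution P G.
have prodE : forall X, measurable X -> (muF \x muG)%E X = muH X.
  apply: product_measure_unique => A B mA mB.
  exact: ind.
have mxy : measurable_fun setT (fun z : R * R => z.1 * z.2).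
  by apply: measurable_funM; [exact: measurable_fst|exact: measurable_snd].
have mexy : measurable_fun setT (fun z : R * R => (z.1 * z.2)%:E).
  exact/measurable_EFinP.
have iH : muH.-integrable setT (fun z => (z.1 * z.2)%:E).
  exact: integrable_pushforward.
have iX : (muF \x muG)%E.-integrable setT (fun z => (z.1 * z.2)%:E).
  apply/integrableP; split => //.
  move/integrableP : iH => [_]; apply: le_lt_trans.
  rewrite le_eqVlt; apply/orP; left; apply/eqP.
  by apply: eq_measure_integral => A mA _; exact: prodE.
have idF : muF.-integrable setT (EFin \o idfun).
  apply: integrable_pushforward => //.
  by apply/measurable_EFinP; exact: measurable_id.
have idG : muG.-integrable setT (EFin \o idfun).
  apply: integrable_pushforward => //.
  by apply/measurable_EFinP; exact: measurable_id.
have EF : (\int[muF]_x x%:E = \int[P]_w (F w)%:E)%E.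
  by rewrite integral_distribution.
have EG : (\int[muG]_x x%:E = \int[P]_w (G w)%:E)%E.
  by rewrite integral_distribution.
have fG : (\int[P]_w (G w)%:E)%E \is a fin_num by exact: integrable_fin_num.
have fF : (\int[P]_w (F w)%:E)%E \is a fin_num by exact: integrable_fin_num.
rewrite /Rintegral -fineM//; congr fine.
transitivity (\int[muH]_z (z.1 * z.2)%:E)%E.
  by rewrite integral_distribution.
transitivity (\int[(muF \x muG)%E]_z (z.1 * z.2)%:E)%E.
  by apply: eq_measure_integral => A mA _; exact/esym/prodE.
rewrite -integral12_prod_meas1// /fubini_F.
transitivity (\int[muF]_x (x%:E * (\int[P]_w (G w)%:E)))%E.
  apply: eq_integral => x _ /=.
  under eq_integral do rewrite EFinM.
  by rewrite integralZl// EG.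
by rewrite -(fineK fG) integralZr// EF.
Qed.

Lemma expectation_indep (F G : T -> R) :
  measurable_fun setT F -> measurable_fun setT G ->
  (forall A B, measurable A -> measurable B ->
     P (F @^-1` A `&` G @^-1` B) = (P (F @^-1` A) * P (G @^-1` B))%E) ->
  P.-integrable setT (EFin \o F) -> P.-integrable setT (EFin \o G) ->
  P.-integrable setT (EFin \o (fun w => F w * G w)) ->
  \int[P]_w (F w * G w) = \int[P]_w F w * \int[P]_w G w.
Proof.
move=> mF mG.
exact: (@expectation_indep_RV (mfun_Sub (mem_set mF)) (mfun_Sub (mem_set mG))).
Qed.

End expectation_indep.

Section mutually_independent_blocks.
Context d (T : measurableType d) (R : realType) (P : probability T R).
Variables (I : finType) (F : I -> set (set T)).
Hypothesis Fm : forall i, F i `<=` measurable.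
Hypothesis FI : forall i, setI_closed (F i).
Hypothesis indF : mutually_independent P F.

Definition block (A : {set I}) : set (set T) := [set E | exists2 i, i \in A & F i E].

(** Finite intersections of events of the families in [A]: a pi-system containing [block A], which
    need not be closed under intersection itself. *)
Let pi_block (A : {set I}) : set (set T) :=
  [set E | exists (J : {set I}) (D : I -> set T), [/\ J \subset A,
     forall i, i \in J -> F i (D i) & E = \bigcap_(i in [set` J]) D i]].

Let block_pi (A : {set I}) : block A `<=` pi_block A.
Proof.
move=> E [i iA FE]; exists [set i]%SET, (fun=> E); split.
- by rewrite finset.sub1set.
- by move=> j; rewrite inE => /eqP ->.
- apply/seteqP; split => [w Ew j _//|w /(_ i)]; apply; by rewrite /= inE.
Qed.

Let pi_measurable (A : {set I}) : pi_block A `<=` measurable.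
Proof.
move=> E [J [D [_ FD ->]]]; apply: fin_bigcap_measurable => // i Ji.
exact/Fm/FD.
Qed.

Let pi_setI (A : {set I}) : setI_closed (pi_block A).
Proof.
move=> E1 E2 [J1 [D1 [J1A FD1 ->]]] [J2 [D2 [J2A FD2 ->]]].
exists (J1 :|: J2), (fun i => if i \in J1 then
  if i \in J2 then D1 i `&` D2 i else D1 i else D2 i); split.
- by rewrite finset.subUset J1A.
- move=> i; rewrite inE; case: ifPn => [i1 _|_ /= i2]; last exact: FD2.
  by case: ifPn => [i2|_]; [apply: FI; [exact: FD1|exact: FD2]|exact: FD1].
- apply/seteqP; split => w.
    move=> [w1 w2] i /=; rewrite inE => i12.
    case: ifPn i12 => [i1 _|_ /= i2]; last exact: w2.
    by case: ifPn => [i2|_]; [split; [exact: w1|exact: w2]|exact: w1].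
  move=> H; split => i /= iJ.
    have := H i; rewrite /= inE iJ => /(_ isT).
    by case: ifPn => // _ [].
  have := H i; rewrite /= inE iJ orbT => /(_ isT).
  by case: ifPn => // _ [].
Qed.

Let pi_indep (A B : {set I}) : [disjoint A & B]%B -> forall E1 E2,
  pi_block A E1 -> pi_block B E2 -> P (E1 `&` E2) = (P E1 * P E2)%E.
Proof.
move=> AB E1 E2 [J1 [D1 [J1A FD1 ->]]] [J2 [D2 [J2B FD2 ->]]].
have J12 : [disjoint J1 & J2]%B.
  by apply: disjointWl J1A _; apply: disjointWr J2B _.
pose D i := if i \in J1 then D1 i else D2 i.
have DE2 i : i \in J2 -> D i = D2 i.
  by move=> i2; rewrite /D ifF//; apply: (disjointFl J12).
have -> : \bigcap_(i in [set` J1]) D1 i `&` \bigcap_(i in [set` J2]) D2 i =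
    \bigcap_(i in [set` J1 :|: J2]) D i.
  apply/seteqP; split => w.
    move=> [w1 w2] i /=; rewrite inE /D => i12.
    by case: ifPn i12 => [i1 _|_ /= i2]; [exact: w1|exact: w2].
  move=> H; split => i /= iJ.
    have := H i; rewrite /= inE iJ => /(_ isT).
    by rewrite /D iJ.
  have := H i; rewrite /= inE iJ orbT => /(_ isT).
  by rewrite DE2.
rewrite !indF//; last first.
  by move=> i; rewrite inE /D; case: ifPn => [i1 _|_ /= i2]; [exact: FD1|exact: FD2].
rewrite (eq_bigl [predU J1 & J2]); last by move=> i; rewrite !inE.
rewrite bigU//=; congr (_ * _)%E.
  by apply: eq_bigr => i i1; rewrite /D i1.
by apply: eq_bigr => i i2; rewrite DE2.
Qed.

Lemma block_indep (A B : {set I}) (E1 E2 : set T) : [disjoint A & B]%B ->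
  <<s block A >> E1 -> <<s block B >> E2 -> P (E1 `&` E2) = (P E1 * P E2)%E.
Proof.
move=> AB s1 s2; apply: (@indep_sigma _ _ _ P (pi_block A) (pi_block B)) => //.
- exact: pi_indep AB.
- by move=> S [sS CS]; apply: s1; split => // E /block_pi; exact: CS.
- by move=> S [sS CS]; apply: s2; split => // E /block_pi; exact: CS.
Qed.

(** Stated over the generated sigma-algebra as a measurable type, so that sums, products and
    compositions inherit block measurability from the general lemmas on measurable functions. *)
Definition block_measurable (A : {set I}) (f : T -> R) :=
  measurable_fun (setT : set (g_sigma_algebraType (block A))) f.

Lemma block_measurableS (A B : {set I}) f : A \subset B ->
  block_measurable A f -> block_measurable B f.
Proof.
move=> AB mf _ Y mY.
have h : <<s block A >> (setT `&` f @^-1` Y) by exact: mf.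
suff : <<s block B >> (setT `&` f @^-1` Y) by [].
move=> S [sS CS]; apply: h; split => //.
move=> E [i iA FE]; apply: CS; exists i => //.
exact: (fintype.subsetP AB).
Qed.

Lemma block_measurableT (A : {set I}) f :
  block_measurable A f -> measurable_fun setT f.
Proof.
move=> mf _ Y mY; have := mf measurableT Y mY.
apply: smallest_sub; first exact: sigma_algebra_measurable.
by move=> E [i _]; exact: Fm.
Qed.

Lemma expectation_block (A B : {set I}) (f g : T -> R) : [disjoint A & B]%B ->
  block_measurable A f -> block_measurable B g ->
  P.-integrable setT (EFin \o f) -> P.-integrable setT (EFin \o g) ->
  P.-integrable setT (EFin \o (fun w => f w * g w)) ->
  \int[P]_w (f w * g w) = \int[P]_w f w * \int[P]_w g w.
Proof.
move=> AB mf mg; apply: expectation_indep.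
- exact: block_measurableT mf.
- exact: block_measurableT mg.
- move=> X Y mX mY; apply: (block_indep AB).
    by have := mf measurableT X mX; rewrite setTI.
  by have := mg measurableT Y mY; rewrite setTI.
Qed.

End mutually_independent_blocks.

(** * Calculus of real-valued expectations *)

Section integrable_real.
Context d (T : measurableType d) (R : realType) (P : probability T R).
Notation intg F := (P.-integrable [set: T] (EFin \o F)).

Lemma intg_cst (c : R) : intg (fun=> c).
Proof. exact: finite_measure_integrable_cst. Qed.

Lemma intgD (F G : T -> R) : intg F -> intg G -> intg (fun w => F w + G w).
Proof. by move=> iF iG; apply: (@integrableD _ _ _ P _ measurableT (EFin \o F) (EFin \o G)). Qed.

Lemma intgB (F G : T -> R) : intg F -> intg G -> intg (fun w => F w - G w).
Proof. by move=> iF iG; apply: (@integrableB _ _ _ P _ measurableT (EFin \o F) (EFin \o G)). Qed.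

Lemma intgZ (c : R) (F : T -> R) : intg F -> intg (fun w => c * F w).
Proof. by move=> iF; apply: (@integrableZl _ _ _ P _ measurableT c (EFin \o F)). Qed.

Lemma intg_sum (I : Type) (s : seq I) (Q : pred I) (F : I -> T -> R) :
  (forall i, Q i -> intg (F i)) -> intg (fun w => \sum_(i <- s | Q i) F i w).
Proof.
move=> iF; elim: s => [|i s ih].
  by under eq_fun do rewrite /= big_nil; exact: intg_cst.
have [Qi|Qi] := boolP (Q i).
  rewrite (_ : EFin \o _ = EFin \o (fun w => F i w + \sum_(j <- s | Q j) F j w)).
    by apply: intgD => //; exact: iF.
  by apply/funext => w; rewrite /= big_cons Qi.
rewrite (_ : EFin \o _ = EFin \o (fun w => \sum_(j <- s | Q j) F j w))//.
by apply/funext => w; rewrite /= big_cons (negbTE Qi).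
Qed.

Lemma intg_norm (F : T -> R) : intg F -> intg (fun w => `|F w|).
Proof. by move=> iF; exact: (integrable_norm iF). Qed.

Lemma intg_le (F G : T -> R) : measurable_fun setT F ->
  (forall w, `|F w| <= G w) -> intg G -> intg F.
Proof.
move=> mF FG iG; apply: le_integrable iG => //; first exact/measurable_EFinP.
by move=> w _; rewrite /= lee_fin (le_trans (FG w))// ler_norm.
Qed.

Lemma ERcst (c : R) : \int[P]_w c = c.
Proof.
by rewrite Rintegral_cst//= [X in fine X](_ : _ = 1%E) ?mulr1//; exact: probability_setT.
Qed.

Lemma ERZ (c : R) (F : T -> R) : intg F -> \int[P]_w (c * F w) = c * \int[P]_w F w.
Proof. by move=> iF; exact: RintegralZl. Qed.

Lemma ERsum (I : Type) (s : seq I) (Q : pred I) (F : I -> T -> R) :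
  (forall i, Q i -> intg (F i)) ->
  \int[P]_w (\sum_(i <- s | Q i) F i w) = \sum_(i <- s | Q i) \int[P]_w F i w.
Proof.
move=> iF; elim: s => [|i s ih].
  by under eq_Rintegral do rewrite big_nil; rewrite big_nil ERcst.
rewrite big_cons -ih.
under eq_Rintegral do rewrite big_cons.
by case: ifPn => // Qi; rewrite RintegralD//; [exact: iF|exact: intg_sum].
Qed.

Lemma ER_le (F G : T -> R) : intg F -> intg G -> (forall w, F w <= G w) ->
  \int[P]_w F w <= \int[P]_w G w.
Proof. by move=> iF iG FG; exact: le_Rintegral. Qed.

Lemma ER_norm (F : T -> R) : intg F -> `|\int[P]_w F w| <= \int[P]_w `|F w|.
Proof. by move=> iF; exact: le_normr_Rintegral. Qed.

Lemma ER_ge0 (F : T -> R) : (forall w, 0 <= F w) -> 0 <= \int[P]_w F w.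
Proof. by move=> F0; exact: Rintegral_ge0. Qed.

End integrable_real.

(** The mean value theorem replaces a second derivative. The derivative is taken at x, which will be
    the full sum W, so that the same f'(W) occurs for every summand. *)
Lemma taylor_lipschitz (R : realType) (f f' : R -> R) (L x y : R) :
  (forall x : R, is_derive x 1 f (f' x)) ->
  (forall x y, `|f' x - f' y| <= L * `|x - y|) ->
  `|f x - f y - (x - y) * f' x| <= L * (x - y) ^+ 2.
Proof.
move=> df f'L.
have cf (a b : R) : {within `[a, b], continuous f}.
  by apply: derivable_within_continuous => z _; have [] := df z.
have [c cx ->] : exists2 c, `|c - x| <= `|x - y| & f x - f y = (x - y) * f' c.
  have [xy|/ltW xy] := leP x y.
    have [c] := MVT_segment xy (fun z _ => df z) (@cf x y).
    rewrite in_itv/= => /andP[xc cy] E; exists c; last by rewrite -opprB E; ring.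
    by rewrite ger0_norm ?subr_ge0// ler0_norm ?subr_le0//; lra.
  have [c] := MVT_segment xy (fun z _ => df z) (@cf y x).
  rewrite in_itv/= => /andP[yc cx] E; exists c; last by rewrite E; ring.
  by rewrite ler0_norm ?subr_le0// ger0_norm ?subr_ge0//; lra.
rewrite -mulrBr normrM -[_ ^+ 2]real_normK ?num_real// expr2 mulrCA ler_wpM2l//.
have L0 : 0 <= L by have := f'L 0 1; rewrite sub0r normrN normr1 mulr1; exact: le_trans.
by rewrite (le_trans (f'L _ _))// ler_wpM2l.
Qed.

(** * Normal approximation under local dependence *)

Section poly_growth.
Context d (T : measurableType d) (R : realType) (P : probability T R).
Notation intg F := (P.-integrable [set: T] (EFin \o F)).
Variable M : T -> R.
Hypothesis M1 : forall w, 1 <= M w.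
Hypothesis iM : forall k, (k <= 3)%N -> intg (fun w => M w ^+ k).

(** Integrability is tracked by a degree: degrees add under products, and degree at most 3 suffices
    because the third power of the envelope [M] is integrable. *)
Definition growth (k : nat) (F : T -> R) :=
  measurable_fun setT F /\ exists2 C, 0 <= C & forall w, `|F w| <= C * M w ^+ k.

Let M0 w : 0 <= M w. Proof. exact: le_trans (M1 w). Qed.

Lemma growth_intg k F : (k <= 3)%N -> growth k F -> intg F.
Proof.
move=> k3 [mF [C C0 FC]]; apply: intg_le FC _ => //.
by apply: intgZ; exact: iM.
Qed.

Lemma growthS k l F : (k <= l)%N -> growth k F -> growth l F.
Proof.
move=> kl [mF [C C0 FC]]; split=> //; exists C => // w.
by rewrite (le_trans (FC w))// ler_wpM2l// ler_weXn2l.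
Qed.

Lemma growth_cst k c : growth k (fun=> c).
Proof.
split; first exact: measurable_cst.
by exists `|c| => // w; rewrite ler_peMr// exprn_ege1.
Qed.

Lemma growthD k F G : growth k F -> growth k G -> growth k (fun w => F w + G w).
Proof.
move=> [mF [C C0 FC]] [mG [D D0 GD]]; split; first exact: measurable_funD.
exists (C + D) => [|w]; first exact: addr_ge0.
by rewrite mulrDl (le_trans (ler_normD _ _))// lerD.
Qed.

Lemma growthM k l F G : growth k F -> growth l G ->
  growth (k + l) (fun w => F w * G w).
Proof.
move=> [mF [C C0 FC]] [mG [D D0 GD]]; split; first exact: measurable_funM.
exists (C * D) => [|w]; first exact: mulr_ge0.
by rewrite normrM exprD mulrACA ler_pM.
Qed.

Lemma growthZ k c F : growth k F -> growth k (fun w => c * F w).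
Proof. by move=> gF; have := growthM (growth_cst 0 c) gF. Qed.

Lemma growthN k F : growth k F -> growth k (fun w => - F w).
Proof.
move=> [mF [C C0 FC]]; split; first exact: measurable_funN.
by exists C => // w; rewrite normrN.
Qed.

Lemma growthB k F G : growth k F -> growth k G -> growth k (fun w => F w - G w).
Proof. by move=> gF gG; apply: growthD => //; exact: growthN. Qed.

Lemma growth_norm k F : growth k F -> growth k (fun w => `|F w|).
Proof.
move=> [mF [C C0 FC]]; split; first exact: measurableT_comp.
by exists C => // w; rewrite normr_id.
Qed.

Lemma growth_sum k (I : Type) (s : seq I) (Q : pred I) (F : I -> T -> R) :
  (forall i, Q i -> growth k (F i)) -> growth k (fun w => \sum_(i <- s | Q i) F i w).
Proof.
move=> gF; elim: s => [|i s ih].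
  by under eq_fun do rewrite big_nil; exact: growth_cst.
under eq_fun do rewrite big_cons.
by case Qi : (Q i) => //; apply: growthD => //; exact: gF.
Qed.

Lemma growth_comp (g : R -> R) F : continuous g ->
  (exists C, forall x, `|g x| <= C * (1 + `|x|)) ->
  growth 1 F -> growth 1 (fun w => g (F w)).
Proof.
move=> cg [C gC] [mF [D D0 FD]]; split.
  by apply: measurableT_comp => //; exact: continuous_measurable_fun.
have C0 : 0 <= C by have := gC 0; rewrite normr0 addr0 mulr1; exact: le_trans.
exists (C * (1 + D)) => [|w]; first by rewrite mulr_ge0// addr_ge0.
rewrite (le_trans (gC _))// -mulrA ler_wpM2l// mulrDl mul1r lerD//.
by rewrite expr1.
Qed.

Section stein_local.
Variables (I : finType) (Y : I -> T -> R) (r : rel I).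
Hypothesis gY : forall a, growth 1 (Y a).
(** Independence enters only through [ind1] and [ind2], for continuous test functions of linear
    growth; they will be applied to g = f and g = f'. *)
Hypothesis ind1 : forall a (g : R -> R), continuous g ->
  (exists C, forall x, `|g x| <= C * (1 + `|x|)) ->
  \int[P]_w (Y a w * g (\sum_(b | ~~ r a b) Y b w)) = 0.
Let m a b : R := \int[P]_w (Y a w * Y b w).
Hypothesis ind2 : forall a b (g : R -> R), r a b -> continuous g ->
  (exists C, forall x, `|g x| <= C * (1 + `|x|)) ->
  \int[P]_w ((Y a w * Y b w - m a b) *
    g (\sum_(c | ~~ (r a c || r b c)) Y c w)) = 0.
Hypothesis var1 : \sum_a \sum_(b | r a b) m a b = 1.

Let W w := \sum_a Y a w.

(** Let U_a omit the neighbours of a from W, and V_ab those of a and of b. Stein's equation turns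
    h(W) - E h(N) into -(S1 + S2 + Q), where S1 sums Y_a f(U_a), S2 sums (Y_a Y_b - m_ab) f'(V_ab),
    and both have mean zero. Only Q is estimated: it collects the Taylor errors of f at W and the
    cost of replacing W by V_ab in f', all of third order. *)
Lemma stein_local (L : R) (h f f' : R -> R) :
  (forall x y, `|h x - h y| <= `|x - y|) ->
  (forall x : R, is_derive x 1 f (f' x)) ->
  (forall x, f' x = x * f x + (h x - \int[normal_prob 0 1]_x h x)) ->
  (forall x, `|f x| <= L) ->
  (forall x y, `|f' x - f' y| <= L * `|x - y|) ->
  `|\int[P]_w h (W w) - \int[normal_prob 0 1]_x h x| <=
  2 * L * \sum_a \sum_(b | r a b) \sum_(c | r a c || r b c)
    (\int[P]_w `|Y a w * Y b w * Y c w| +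
     \int[P]_w `|Y a w * Y b w| * \int[P]_w `|Y c w|).
Proof.
move=> hL df f'E fL f'L.
have L0 : 0 <= L by exact: le_trans (fL 0).
have cf : continuous f.
  move=> x; apply: differentiable_continuous.
  by apply/derivable1_diffP; have [] := df x.
have cf' : continuous f'.
  move=> x; apply/(cvgrPdist_lt f') => e e0.
  have L1 : 0 < L + 1 by rewrite ltr_wpDl.
  near=> y; apply: (@le_lt_trans _ _ ((L + 1) * `|x - y|)).
    by rewrite (le_trans (f'L _ _))// ler_wpM2r// lerDl.
  rewrite mulrC -ltr_pdivlMr//; near: y.
  by apply: (@cvgr_dist_lt _ _ _ _ _ id x) => //; rewrite divr_gt0.
have lf : exists C, forall x, `|f x| <= C * (1 + `|x|).
  by exists L => x; rewrite (le_trans (fL x))// ler_peMr// lerDl.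
have lf' : exists C, forall x, `|f' x| <= C * (1 + `|x|).
  exists (`|f' 0| + L) => x.
  rewrite -(subrK (f' 0) (f' x)) (le_trans (ler_normD _ _))//.
  have := f'L x 0; rewrite subr0 => H.
  have : 0 <= `|f' 0| * `|x| by rewrite mulr_ge0.
  lra.
pose U a w := \sum_(b | ~~ r a b) Y b w.
pose Z a w := \sum_(b | r a b) Y b w.
pose V a b w := \sum_(c | ~~ (r a c || r b c)) Y c w.
have gW : growth 1 W by apply: growth_sum => a _.
have gU a : growth 1 (U a) by apply: growth_sum => b _.
have gV a b : growth 1 (V a b) by apply: growth_sum => c _.
have UZ a w : W w = U a w + Z a w.
  by rewrite /W (bigID (r a)) addrC.
pose rho a w := f (W w) - f (U a w) - Z a w * f' (W w).
have rhoL a w : `|rho a w| <= L * Z a w ^+ 2.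
  rewrite /rho (_ : Z a w = W w - U a w); last by rewrite (UZ a) addrAC subrr add0r.
  have H := taylor_lipschitz (W w) (U a w) df f'L; exact: H.
pose g a b w := Y a w * Y b w - m a b.
have gg a b : growth 2 (g a b).
  by apply: growthB; [exact: (growthM (gY a) (gY b))|exact: growth_cst].
pose S1 w := \sum_a Y a w * f (U a w).
pose S2 w := \sum_a \sum_(b | r a b) g a b w * f' (V a b w).
pose Q w := \sum_a Y a w * rho a w +
  \sum_a \sum_(b | r a b) g a b w * (f' (W w) - f' (V a b w)).
have DE w : h (W w) - \int[normal_prob 0 1]_x h x = - (S1 w + S2 w + Q w).
  have -> : h (W w) - \int[normal_prob 0 1]_x h x = f' (W w) - W w * f (W w).
    by rewrite f'E; ring.
  rewrite -opprB; congr (- _).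
  have -> : S1 w + S2 w + Q w = (S1 w + \sum_a Y a w * rho a w) +
     \sum_a \sum_(b | r a b) g a b w * f' (W w).
    rewrite /Q addrACA; congr (_ + _).
    rewrite /S2 -big_split/=; apply: eq_bigr => a _.
    rewrite -big_split/=; apply: eq_bigr => b _.
    by rewrite mulrBr addrC subrK.
  (* Unit variance allows f'(W) to be written as the sum of m_ab f'(W) over neighbouring pairs. *)
  have -> : \sum_a \sum_(b | r a b) g a b w * f' (W w) =
     \sum_a Y a w * (Z a w * f' (W w)) - f' (W w).
    rewrite -[X in _ - X]mul1r -var1 mulr_suml -sumrB; apply: eq_bigr => a _.
    rewrite mulr_suml /Z mulr_suml mulr_sumr -sumrB; apply: eq_bigr => b _.
    by rewrite /g mulrBl mulrA.
  rewrite addrA; congr (_ - _).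
  rewrite /S1 -!big_split/= /W mulr_suml; apply: eq_bigr => a _.
  by rewrite -/(W w) /rho; ring.
have gS1 a : growth 3 (fun w => Y a w * f (U a w)).
  by apply: (@growthS 2) => //; apply: (growthM (gY a)); exact: growth_comp.
have gS2 a b : growth 3 (fun w => g a b w * f' (V a b w)).
  by apply: (growthM (gg a b)); exact: growth_comp.
have grho a : growth 2 (rho a).
  apply: growthB; last first.
    by apply: (@growthM 1 1); [exact: growth_sum|exact: growth_comp].
  by apply: growthB; apply: (@growthS 1) => //; exact: growth_comp.
have gQ1 a : growth 3 (fun w => Y a w * rho a w) by exact: (growthM (gY a)).
have gQ2 a b : growth 3 (fun w => g a b w * (f' (W w) - f' (V a b w))).
  by apply: (growthM (gg a b)); apply: growthB; exact: growth_comp.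
have iS1 : intg S1.
  by apply: (@growth_intg 3) => //; apply: growth_sum.
have iS2 : intg S2.
  apply: (@growth_intg 3) => //; apply: growth_sum => a _.
  by apply: growth_sum.
have iQ : intg Q.
  apply: (@growth_intg 3) => //; apply: growthD; apply: growth_sum => a _ //.
  by apply: growth_sum.
have ES1 : \int[P]_w S1 w = 0.
  rewrite ERsum; last by move=> a _; exact: (@growth_intg 3).
  by rewrite big1// => a _; exact: ind1.
have ES2 : \int[P]_w S2 w = 0.
  rewrite ERsum; last first.
    by move=> a _; apply: (@growth_intg 3) => //; apply: growth_sum.
  rewrite big1// => a _; rewrite ERsum; last by move=> b _; exact: (@growth_intg 3).
  by rewrite big1// => b rab; exact: ind2.
(* Integrability of h(W) is read off from the decomposition [DE]. *)
have ihW : intg (fun w => h (W w)).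
  rewrite (_ : EFin \o _ = EFin \o (fun w => - (S1 w + S2 w + Q w) +
     \int[normal_prob 0 1]_x h x)).
    apply: intgD; last exact: intg_cst.
    rewrite (_ : EFin \o _ = EFin \o (fun w => -1 * (S1 w + S2 w + Q w))).
      by apply: intgZ; apply: intgD => //; exact: intgD.
    by apply/funext => w; rewrite /= mulN1r.
  by apply/funext => w; rewrite /= -DE subrK.
have -> : \int[P]_w h (W w) - \int[normal_prob 0 1]_x h x = - \int[P]_w Q w.
  rewrite -[X in _ - X](@ERcst _ _ _ P) -RintegralB//; last exact: intg_cst.
  under eq_Rintegral do rewrite DE -mulN1r.
  rewrite ERZ; last by apply: intgD => //; exact: intgD.
  rewrite RintegralD//; last exact: intgD.
  by rewrite RintegralD// ES1 ES2 !add0r mulN1r.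
rewrite normrN (le_trans (ER_norm iQ))//.
pose B w := L * \sum_a \sum_(b | r a b) \sum_(c | r a c || r b c)
  (2 * `|Y a w * Y b w * Y c w| + `|m a b| * `|Y c w|).
have g3 a b c : growth 3 (fun w => `|Y a w * Y b w * Y c w|).
  by apply: growth_norm; apply: (@growthM 2 1) => //; exact: (@growthM 1 1).
have g1 c : growth 3 (fun w => `|Y c w|).
  by apply: growth_norm; exact: (@growthS 1).
have gB a b c : growth 3 (fun w => 2 * `|Y a w * Y b w * Y c w| + `|m a b| * `|Y c w|).
  by apply: growthD; exact: growthZ.
have gB2 a b : growth 3 (fun w => \sum_(c | r a c || r b c)
     (2 * `|Y a w * Y b w * Y c w| + `|m a b| * `|Y c w|)).
  by apply: growth_sum.
have gB3 a : growth 3 (fun w => \sum_(b | r a b) \sum_(c | r a c || r b c)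
     (2 * `|Y a w * Y b w * Y c w| + `|m a b| * `|Y c w|)).
  by apply: growth_sum.
have gB4 : growth 3 B by apply: growthZ; apply: growth_sum.
apply: (@le_trans _ _ (\int[P]_w B w)).
  apply: ER_le; [exact: intg_norm|exact: (@growth_intg 3)|move=> w].
  rewrite /Q (le_trans (ler_normD _ _))//.
  have h1 : `|\sum_a Y a w * rho a w| <= L * \sum_a \sum_(b | r a b)
      \sum_(c | r a c || r b c) `|Y a w * Y b w * Y c w|.
    rewrite (le_trans (ler_norm_sum _ _ _))// mulr_sumr ler_sum// => a _.
    rewrite normrM (@le_trans _ _ (`|Y a w| * (L * Z a w ^+ 2)))//.
      by rewrite ler_wpM2l.
    rewrite mulrCA ler_wpM2l// -[Z a w ^+ 2]real_normK ?num_real// expr2.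
    have ZL : `|Z a w| <= \sum_(b | r a b) `|Y b w| by exact: ler_norm_sum.
    apply: (@le_trans _ _ (`|Y a w| * ((\sum_(b | r a b) `|Y b w|) * (\sum_(b | r a b) `|Y b w|)))).
      by rewrite ler_wpM2l// ler_pM.
    rewrite mulr_suml mulr_sumr ler_sum// => b rab.
    (* The square of Z_a only produces c adjacent to a; the terms with c adjacent to b alone are
       nonnegative. *)
    rewrite [leRHS](bigID (r a))/=.
    rewrite [X in _ <= X + _](eq_bigl (r a)); last by move=> c; case: (r a c); rewrite ?andbT ?andbF.
    rewrite mulrA mulr_sumr -[leLHS]addr0 lerD ?sumr_ge0//.
    by rewrite ler_sum// => c _; rewrite !normrM.
  have h2 : `|\sum_a \sum_(b | r a b) g a b w * (f' (W w) - f' (V a b w))| <=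
      L * \sum_a \sum_(b | r a b) \sum_(c | r a c || r b c)
        (`|Y a w * Y b w * Y c w| + `|m a b| * `|Y c w|).
    rewrite (le_trans (ler_norm_sum _ _ _))// mulr_sumr ler_sum// => a _.
    rewrite (le_trans (ler_norm_sum _ _ _))// mulr_sumr ler_sum// => b _.
    rewrite normrM.
    have WV : W w - V a b w = \sum_(c | r a c || r b c) Y c w.
      by rewrite /W (bigID (fun c => r a c || r b c))/= addrK.
    apply: (@le_trans _ _ ((`|Y a w * Y b w| + `|m a b|) *
        (L * \sum_(c | r a c || r b c) `|Y c w|))).
      apply: ler_pM => //; first exact: ler_normB.
      rewrite (le_trans (f'L _ _))// ler_wpM2l// WV.
      exact: ler_norm_sum.
    rewrite mulrCA ler_wpM2l// mulr_sumr ler_sum// => c _.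
    by rewrite mulrDl -normrM.
  apply: (le_trans (lerD h1 h2)); rewrite /B -mulrDr ler_wpM2l//.
  rewrite -big_split/= ler_sum// => a _.
  rewrite -big_split/= ler_sum// => b _.
  rewrite -big_split/= ler_sum// => c _.
  by rewrite addrA mulrDl mul1r.
rewrite /B ERZ; last by apply: (@growth_intg 3) => //; exact: growth_sum.
rewrite [leRHS]mulrAC mulrC; apply: ler_pM => //.
  apply: ER_ge0 => w; apply: sumr_ge0 => a _; apply: sumr_ge0 => b _.
  by apply: sumr_ge0 => c _; rewrite addr_ge0// mulr_ge0.
rewrite ERsum; last by move=> a _; exact: (@growth_intg 3).
rewrite mulr_sumr ler_sum// => a _.
rewrite ERsum; last by move=> b _; exact: (@growth_intg 3).
rewrite mulr_sumr ler_sum// => b _.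
rewrite ERsum; last by move=> c _; exact: (@growth_intg 3).
rewrite mulr_sumr ler_sum// => c _.
have i3 : intg (fun w => `|Y a w * Y b w * Y c w|) by exact: (@growth_intg 3).
have i1 : intg (fun w => `|Y c w|) by exact: (@growth_intg 3).
rewrite RintegralD//; [|exact: intgZ|exact: intgZ].
rewrite !ERZ// mulrDr lerD2l.
apply: (@le_trans _ _ (\int[P]_w `|Y a w * Y b w| * \int[P]_w `|Y c w|)).
  rewrite ler_wpM2r ?ER_ge0//; apply: ER_norm.
  by apply: (@growth_intg 2) => //; exact: (@growthM 1 1).
by rewrite ler_peMl ?mulr_ge0 ?ER_ge0// ler1n.
Unshelve. all: by end_near. Qed.
End stein_local.
End poly_growth.

(** * The weighted random graph *)

Section weighted_model.
Variables (R : realType) (dS : measure_display) (S : measurableType dS)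
  (Q : probability S R) (X : {RV Q >-> R}) (n : nat) (p : R)
  (d : measure_display) (T : measurableType d) (P : probability T R)
  (GG : T -> graph 'I_n) (Xe : {set 'I_n} -> {RV P >-> R}).
Hypothesis model : weighted_Gnp X p GG Xe.
Notation intg F := (P.-integrable [set: T] (EFin \o F)).
Notation intgQ F := (Q.-integrable [set: S] (EFin \o F)).

Let Fam (i : edge n + edge n) : set (set T) :=
  match i with
  | inl e => [set edge_event GG e]
  | inr e => preimage_set_system [set: T] (Xe (val e)) measurable
  end.

Let Fam_measurable i : Fam i `<=` measurable.
Proof.
have [_ mE _ _] := model.
case: i => e A /=; first by move=> ->; have [] := mE e.
by move=> [B mB <-]; exact: measurable_funP.
Qed.

Let Fam_setI i : setI_closed (Fam i).
Proof.
case: i => e A B /=; first by move=> -> ->; rewrite setIid.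
move=> [A' mA <-] [B' mB <-]; exists (A' `&` B'); first exact: measurableI.
by rewrite !setTI preimage_setI.
Qed.

Let Fam_indep : mutually_independent P Fam.
Proof. by have [] := model. Qed.

(** The independent families are indexed by two copies of the edges of K_n, the left one for
    presence and the right one for weights. Hence presence and weights always occupy disjoint
    blocks, and edge-disjoint copies have disjoint full blocks. *)
Definition edge_block (D : {set {set 'I_n}}) : {set edge n + edge n} :=
  [set i | match i with inl e => val e \in D | inr _ => false end]%SET.
Definition weight_block (D : {set {set 'I_n}}) : {set edge n + edge n} :=
  [set i | match i with inl _ => false | inr e => val e \in D end]%SET.
Definition full_block (D : {set {set 'I_n}}) : {set edge n + edge n} :=
  [set i | match i with inl e => val e \in D | inr e => val e \in D end]%SET.

Local Notation bmeas := (block_measurable Fam).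

Definition present (D : {set {set 'I_n}}) (w : T) : R := (D \subset eset (GG w))%:R.

Let all_present (D : {set {set 'I_n}}) : set T := [set w | D \subset eset (GG w)].

Let edges_only (D : {set {set 'I_n}}) := forall e, e \in D -> #|e| == 2.

Let all_presentE D : edges_only D -> all_present D =
  \bigcap_(e in [set e : edge n | val e \in D]) edge_event GG e.
Proof.
move=> D2; apply/seteqP; split => w /=.
  by move=> /fintype.subsetP DG e eD; exact: DG.
move=> H; apply/fintype.subsetP => e eD.
exact: (H (Sub e (D2 _ eD))).
Qed.

Let present_indic D : present D = \1_(all_present D).
Proof.
apply/funext => w; rewrite /present indicE.
have -> // : (w \in all_present D) = (D \subset eset (GG w)).
by apply/idP/idP; rewrite inE.
Qed.

Lemma present_block D : edges_only D -> bmeas (edge_block D) (present D).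
Proof.
move=> D2; rewrite /block_measurable present_indic.
apply: measurable_indic; rewrite all_presentE//.
apply: fin_bigcap_measurable; first exact: finite_finset.
move=> e eD; apply: sub_sigma_algebra; exists (inl e) => //.
by rewrite finset.inE.
Qed.

Lemma weight_block_measurable (e : {set 'I_n}) (D : {set {set 'I_n}}) : #|e| == 2 -> e \in D ->
  bmeas (weight_block D) (Xe e).
Proof.
move=> e2 eD _ Y mY; apply: sub_sigma_algebra.
exists (inr (Sub e e2)); first by rewrite finset.inE.
by exists Y.
Qed.

Lemma bmeas_measurable A (f : T -> R) : bmeas A f -> measurable_fun setT f.
Proof. exact: block_measurableT. Qed.

Lemma measurable_present D : edges_only D -> measurable_fun setT (present D).
Proof. by move=> D2; apply: bmeas_measurable; exact: present_block. Qed.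

Lemma ER_present D : edges_only D -> \int[P]_w present D w = p ^+ #|D|.
Proof.
move=> D2.
have -> : \int[P]_w present D w = fine (P (all_present D)).
  rewrite -[in RHS](setIT (all_present D)) -integral_indic//; last first.
    rewrite all_presentE//; apply: fin_bigcap_measurable; first exact: finite_finset.
    by move=> e _; have [_ mE _ _] := model; have [] := mE e.
  by congr fine; apply: eq_integral => w _; rewrite present_indic.
pose E (i : edge n + edge n) : set T := match i with inl e => edge_event GG e | inr _ => setT end.
have -> : all_present D = \bigcap_(i in [set` edge_block D]) E i.
  rewrite all_presentE//; apply/seteqP; split => w H.
    by case=> e /=; rewrite finset.inE// => eD; exact: H.
  move=> e eD; have := H (inl e); apply.
  by rewrite /= finset.inE.
rewrite Fam_indep; last by case=> e; rewrite finset.inE.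
rewrite (eq_bigr (fun=> p%:E)); last first.
  case=> e; rewrite finset.inE// => eD.
  by have [_ mE _ _] := model; have [] := mE e.
rewrite prodEFin prodr_const /=; congr (_ ^+ _).
(* The exponent is so far the size of the edge block; [g] maps that block bijectively onto [D]. *)
pose g (i : edge n + edge n) : {set 'I_n} :=
  match i with inl e => val e | inr _ => finset.set0 end.
have gi : {in edge_block D &, injective g}.
  by move=> [a|a] [b|b]; rewrite !finset.inE //= => aD bD /val_inj ->.
rewrite -(card_in_imset gi); congr #|pred_of_set _|.
apply/setP => e; apply/imsetP/idP.
  by case=> -[a|a]; rewrite finset.inE // => aD ->.
by move=> eD; exists (inl (Sub e (D2 _ eD))); rewrite ?finset.inE.
Qed.

(** Every moment of copies factors through this: p to the size of the union of their edge sets,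
    times a moment of the weights alone. *)
Lemma ER_present_mul D (g : T -> R) : edges_only D ->
  bmeas (weight_block [set: {set 'I_n}]%SET) g -> intg g ->
  intg (fun w => present D w * g w) /\
  \int[P]_w (present D w * g w) = p ^+ #|D| * \int[P]_w g w.
Proof.
move=> D2 mg ig.
have pres1 w : 0 <= present D w <= 1 by rewrite /present; case: (D \subset _); rewrite ?lexx ler01.
have mp := measurable_present D2.
have mg' := bmeas_measurable mg.
have i1 : intg (present D).
  apply: (@intg_le _ _ _ P _ (fun=> 1)) => //; last exact: intg_cst.
  by move=> w; have /andP[? ?] := pres1 w; rewrite ger0_norm.
have i2 : intg (fun w => present D w * g w).
  apply: (@intg_le _ _ _ P _ (fun w => `|g w|)); last exact: intg_norm.
    exact: measurable_funM.
  by move=> w; have /andP[? ?] := pres1 w; rewrite normrM ger0_norm// ler_piMl.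
split => //.
rewrite (expectation_block Fam_measurable Fam_setI Fam_indep _ (present_block D2) mg)//.
  by rewrite ER_present.
rewrite -setI_eq0; apply/eqP/setP => -[e|e]; rewrite !finset.inE ?andbF//.
Qed.

Lemma weight_law (g : R -> R) (e : edge n) : measurable_fun setT g ->
  intgQ (fun s => g (X s)) ->
  intg (fun w => g (Xe (val e) w)) /\
  \int[P]_w g (Xe (val e) w) = \int[Q]_s g (X s).
Proof.
move=> mg ig.
have [_ _ law _] := model.
have mg' : measurable_fun setT (fun x => (g x)%:E) by exact/measurable_EFinP.
have gE (h : R -> \bar R) : measurable_fun setT h -> (forall x, 0 <= h x)%E ->
    (\int[P]_w h (Xe (val e) w) = \int[Q]_s h (X s))%E.
  move=> mh h0.
  rewrite -(ge0_integral_distribution (Xe (val e)))// -(ge0_integral_distribution X)//.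
  by apply: eq_measure_integral => A mA _; exact: law.
have i1 : intg (fun w => g (Xe (val e) w)).
  apply/integrableP; split.
    by apply/measurable_EFinP; apply: measurableT_comp => //; exact: measurable_funP.
  move/integrableP : ig => [_].
  by rewrite -(gE (fun x => `|(g x)%:E|)%E)//; exact: measurableT_comp.
split => //.
rewrite /Rintegral; congr fine.
rewrite -(@integral_distribution _ _ _ _ _ P (Xe (val e)) (fun x => (g x)%:E))//.
rewrite -(@integral_distribution _ _ _ _ _ Q X (fun x => (g x)%:E))//.
by apply: eq_measure_integral => A mA _; exact: law.
Qed.

Lemma bmeas_sum A (I : finType) (C : pred I) (f : I -> T -> R) :
  (forall i, C i -> bmeas A (f i)) -> bmeas A (fun w => \sum_(i | C i) f i w).
Proof.
move=> mf; rewrite /block_measurable.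
pose f' i w := if C i then f i w else 0.
have -> : (fun w => \sum_(i | C i) f i w) = (fun w => \sum_i f' i w).
  by apply/funext => w; rewrite big_mkcond.
apply: measurable_sum => i; rewrite /f'.
by case Ci : (C i); [exact: mf|exact: measurable_cst].
Qed.

Lemma bmeasM A (f g : T -> R) : bmeas A f -> bmeas A g -> bmeas A (fun w => f w * g w).
Proof. by move=> mf mg; exact: measurable_funM. Qed.

Lemma bmeasB A (f g : T -> R) : bmeas A f -> bmeas A g -> bmeas A (fun w => f w - g w).
Proof. by move=> mf mg; exact: measurable_funB. Qed.

Lemma bmeas_cst A (c : R) : bmeas A (fun=> c).
Proof. exact: measurable_cst. Qed.

Lemma bmeas_comp A (g : R -> R) (f : T -> R) : measurable_fun setT g ->
  bmeas A f -> bmeas A (fun w => g (f w)).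
Proof. by move=> mg mf; apply: measurableT_comp. Qed.

Lemma bmeasS (A B : {set edge n + edge n}) (f : T -> R) : A \subset B -> bmeas A f -> bmeas B f.
Proof. exact: block_measurableS. Qed.

Definition wsum (a : graph 'I_n) (w : T) : R := \sum_(e in eset a) Xe e w.
(** Absolute values are taken because nonnegativity is known pointwise for [X], hence only almost
    surely for the variables [Xe e], which share its law. *)
Definition asum (a : graph 'I_n) (w : T) : R := \sum_(e in eset a) `|Xe e w|.

Lemma edges_eset (a : graph 'I_n) : edges_only (eset a).
Proof. by move=> e ea; rewrite (eset_card2 ea). Qed.

Lemma wsum_block a : bmeas (weight_block (eset a)) (wsum a).
Proof.
apply: bmeas_sum => e ea; apply: weight_block_measurable => //.
by rewrite (eset_card2 ea).
Qed.

Lemma asum_block a : bmeas (weight_block (eset a)) (asum a).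
Proof.
apply: bmeas_sum => e ea.
apply: (@bmeas_comp _ (fun x : R => `|x|)); first exact: normr_measurable.
by apply: weight_block_measurable => //; rewrite (eset_card2 ea).
Qed.

Let weight_blockT D : weight_block D \subset weight_block [set: {set 'I_n}]%SET.
Proof. by apply/fintype.subsetP => -[e|e]; rewrite !finset.inE. Qed.

Lemma wsum_blockT a : bmeas (weight_block [set: {set 'I_n}]%SET) (wsum a).
Proof. by apply: (bmeasS (weight_blockT (eset a))); exact: wsum_block. Qed.

Lemma asum_blockT a : bmeas (weight_block [set: {set 'I_n}]%SET) (asum a).
Proof. by apply: (bmeasS (weight_blockT (eset a))); exact: asum_block. Qed.

Let mom (k : nat) := \int[Q]_s `|X s| ^+ k.

Let weight_mom k (e : {set 'I_n}) : intgQ (fun s => `|X s| ^+ k) -> #|e| == 2 ->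
  intg (fun w => `|Xe e w| ^+ k) /\ \int[P]_w (`|Xe e w| ^+ k) = mom k.
Proof.
move=> ik e2; apply: (@weight_law (fun x => `|x| ^+ k) (Sub e e2)) => //.
by apply: measurable_funX; exact: normr_measurable.
Qed.

Let weight_moment k (a : graph 'I_n) e : intgQ (fun s => `|X s| ^+ k) -> e \in eset a ->
  intg (fun w => `|Xe e w| ^+ k) /\ \int[P]_w (`|Xe e w| ^+ k) = mom k.
Proof. by move=> ik ea; apply: weight_mom => //; rewrite (eset_card2 ea). Qed.

Lemma asum1 a : intgQ (fun s => `|X s| ^+ 1) ->
  intg (asum a) /\ \int[P]_w asum a w = (ne a)%:R * mom 1.
Proof.
move=> i1; have H e (ea : e \in eset a) := weight_moment i1 ea.
have i e : e \in eset a -> intg (fun w => `|Xe e w|) by move=> ea; have [] := H e ea.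
split; first exact: intg_sum.
rewrite ERsum// (eq_bigr (fun=> mom 1)); last by move=> e ea; have [] := H e ea.
by rewrite sumr_const mulr_natl.
Qed.

Lemma asum2 a b : intgQ (fun s => `|X s| ^+ 2) ->
  intg (fun w => asum a w * asum b w) /\
  \int[P]_w (asum a w * asum b w) <= (ne a)%:R * (ne b)%:R * mom 2.
Proof.
move=> i2.
pose B w := \sum_(e in eset a) \sum_(f in eset b) 2^-1 * (`|Xe e w| ^+ 2 + `|Xe f w| ^+ 2).
have le w : asum a w * asum b w <= B w.
  rewrite /asum mulr_suml; apply: ler_sum => e _; rewrite mulr_sumr; apply: ler_sum => f _.
  have := sqr_ge0 (`|Xe e w| - `|Xe f w|); nra.
have iB0 e f : e \in eset a -> f \in eset b ->
    intg (fun w => 2^-1 * (`|Xe e w| ^+ 2 + `|Xe f w| ^+ 2)).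
  move=> ea fb; apply: intgZ; apply: intgD; first by have [] := weight_moment i2 ea.
  by have [] := weight_moment i2 fb.
have iB1 e : e \in eset a ->
    intg (fun w => \sum_(f in eset b) 2^-1 * (`|Xe e w| ^+ 2 + `|Xe f w| ^+ 2)).
  by move=> ea; apply: intg_sum => f fb; exact: iB0.
have iB : intg B by exact: intg_sum.
have asum0 c w : 0 <= asum c w by apply: sumr_ge0.
have iab : intg (fun w => asum a w * asum b w).
  apply: intg_le iB => [|w].
    by apply: measurable_funM; apply: bmeas_measurable; exact: asum_block.
  by rewrite ger0_norm ?mulr_ge0.
split => //.
apply: (le_trans (ER_le iab iB le)).
rewrite /B ERsum// -mulrA mulr_natl -sumr_const.
apply: ler_sum => e ea; rewrite ERsum; last by move=> f fb; exact: iB0.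
rewrite mulr_natl -sumr_const; apply: ler_sum => f fb.
have [ie Ee] := weight_moment i2 ea; have [if_ Ef] := weight_moment i2 fb.
by rewrite ERZ ?RintegralD ?Ee ?Ef//; [lra|exact: intgD].
Qed.

(** The bound 3 x y z <= x^3 + y^3 + z^3 for nonnegative reals controls every mixed moment by
    [mom 3], whether or not the three edges coincide. *)
Lemma asum3 a b c : intgQ (fun s => `|X s| ^+ 3) ->
  intg (fun w => asum a w * asum b w * asum c w) /\
  \int[P]_w (asum a w * asum b w * asum c w) <=
    (ne a)%:R * (ne b)%:R * (ne c)%:R * mom 3.
Proof.
move=> i3.
pose h e f g w := 3^-1 * (`|Xe e w| ^+ 3 + `|Xe f w| ^+ 3 + `|Xe g w| ^+ 3).
pose B w := \sum_(e in eset a) \sum_(f in eset b) \sum_(g in eset c) h e f g w.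
have le w : asum a w * asum b w * asum c w <= B w.
  rewrite /asum 2!mulr_suml; apply: ler_sum => e _.
  rewrite [`|Xe e w| * _]mulr_sumr mulr_suml; apply: ler_sum => f _.
  rewrite mulr_sumr; apply: ler_sum => g _; rewrite /h.
  move: `|Xe e w| `|Xe f w| `|Xe g w| (normr_ge0 (Xe e w)) (normr_ge0 (Xe f w))
    (normr_ge0 (Xe g w)) => x y z x0 y0 z0.
  have E : x ^+ 3 + y ^+ 3 + z ^+ 3 - 3 * (x * y * z) =
     2^-1 * ((x + y + z) * ((x - y) ^+ 2 + (y - z) ^+ 2 + (z - x) ^+ 2)) by field.
  have : 0 <= 2^-1 * ((x + y + z) * ((x - y) ^+ 2 + (y - z) ^+ 2 + (z - x) ^+ 2)).
    by rewrite !mulr_ge0// !addr_ge0// sqr_ge0.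
  lra.
have hE e f g : e \in eset a -> f \in eset b -> g \in eset c ->
    intg (h e f g) /\ \int[P]_w h e f g w = mom 3.
  move=> ea fb gc.
  have [ie Ee] := weight_moment i3 ea; have [if_ Ef] := weight_moment i3 fb.
  have [ig Eg] := weight_moment i3 gc.
  have i2 := intgD ie if_; have i33 := intgD i2 ig.
  split; first exact: intgZ.
  by rewrite /h ERZ// RintegralD// RintegralD// Ee Ef Eg; lra.
have ih1 e f : e \in eset a -> f \in eset b ->
    intg (fun w => \sum_(g in eset c) h e f g w).
  by move=> ea fb; apply: intg_sum => g gc; have [] := hE e f g ea fb gc.
have ih2 e : e \in eset a ->
    intg (fun w => \sum_(f in eset b) \sum_(g in eset c) h e f g w).
  by move=> ea; apply: intg_sum => f fb; exact: ih1.
have iB : intg B by apply: intg_sum => e ea; exact: ih2.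
have asum0 x w : 0 <= asum x w by apply: sumr_ge0.
have iab : intg (fun w => asum a w * asum b w * asum c w).
  apply: intg_le iB => [|w].
    by apply: measurable_funM; [apply: measurable_funM|]; apply: bmeas_measurable; exact: asum_block.
  by rewrite ger0_norm ?mulr_ge0.
split => //.
apply: (le_trans (ER_le iab iB le)).
rewrite /B ERsum// -!mulrA mulr_natl -sumr_const.
apply: ler_sum => e ea; rewrite ERsum; last by move=> f fb; exact: ih1.
rewrite mulr_natl -sumr_const; apply: ler_sum => f fb.
rewrite ERsum; last by move=> g gc; have [] := hE e f g ea fb gc.
rewrite mulr_natl -sumr_const; apply: ler_sum => g gc.
by have [_ ->] := hE e f g ea fb gc.
Qed.

Definition copy_weight (a : graph 'I_n) (w : T) : R := present (eset a) w * wsum a w.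
Definition copy_bound (a : graph 'I_n) (w : T) : R := present (eset a) w * asum a w.

Let present01 D w : 0 <= present D w <= 1.
Proof. by rewrite /present; case: (D \subset _); rewrite ?lexx ler01. Qed.

Lemma presentM D D' w : present D w * present D' w = present (D :|: D')%SET w.
Proof. by rewrite /present -natrM mulnb finset.subUset. Qed.

Let asum_ge0 a w : 0 <= asum a w. Proof. exact: sumr_ge0. Qed.

Lemma copy_bound_ge0 a w : 0 <= copy_bound a w.
Proof. by rewrite mulr_ge0//; have /andP[] := present01 (eset a) w. Qed.

Lemma copy_weight_le a w : `|copy_weight a w| <= copy_bound a w.
Proof.
rewrite normrM ger0_norm; last by have /andP[] := present01 (eset a) w.
by rewrite ler_wpM2l ?ler_norm_sum//; have /andP[] := present01 (eset a) w.
Qed.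

Lemma copy_weight_block a : bmeas (full_block (eset a)) (copy_weight a).
Proof.
apply: bmeasM.
  apply: (@bmeasS (edge_block (eset a))); last exact: present_block (@edges_eset a).
  by apply/fintype.subsetP => -[e|e]; rewrite !finset.inE.
apply: (@bmeasS (weight_block (eset a))); last exact: wsum_block.
by apply/fintype.subsetP => -[e|e]; rewrite !finset.inE.
Qed.

Lemma copy_weight_mean a : intgQ (fun s => X s) ->
  intg (copy_weight a) /\
  \int[P]_w copy_weight a w = p ^+ ne a * ((ne a)%:R * \int[Q]_s X s).
Proof.
move=> iX.
have iXe e : e \in eset a -> intg (Xe e) /\ \int[P]_w Xe e w = \int[Q]_s X s.
  move=> ea; have e2 : #|e| == 2 by rewrite (eset_card2 ea).
  exact: (@weight_law id (Sub e e2) _ iX).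
have iw : intg (wsum a) by apply: intg_sum => e ea; have [] := iXe e ea.
have [i E] := ER_present_mul (@edges_eset a) (wsum_blockT a) iw.
split => //; rewrite E; congr (_ * _).
rewrite ERsum; last by move=> e ea; have [] := iXe e ea.
rewrite (eq_bigr (fun=> \int[Q]_s X s)); last by move=> e ea; have [] := iXe e ea.
by rewrite sumr_const mulr_natl.
Qed.

Lemma copy_bound_mean a : intgQ (fun s => `|X s| ^+ 1) ->
  intg (copy_bound a) /\
  \int[P]_w copy_bound a w = p ^+ ne a * ((ne a)%:R * mom 1).
Proof.
move=> i1; have [ia Ea] := asum1 a i1.
have [i E] := ER_present_mul (@edges_eset a) (asum_blockT a) ia.
by split => //; rewrite E Ea.
Qed.

Let edgesU D D' : edges_only D -> edges_only D' -> edges_only (D :|: D')%SET.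
Proof. by move=> h h' e; rewrite finset.inE => /orP[/h|/h']. Qed.

Lemma copy_bound_mean2 a b : 0 <= p -> intgQ (fun s => `|X s| ^+ 2) ->
  intg (fun w => copy_bound a w * copy_bound b w) /\
  \int[P]_w (copy_bound a w * copy_bound b w) <=
    p ^+ #|(eset a :|: eset b)%SET| * ((ne a)%:R * (ne b)%:R * mom 2).
Proof.
move=> p0 i2; have [ia Ea] := asum2 a b i2.
have e2 := edgesU (@edges_eset a) (@edges_eset b).
have [i E] := ER_present_mul e2 (bmeasM (asum_blockT a) (asum_blockT b)) ia.
have eqf : (fun w => copy_bound a w * copy_bound b w) =
    (fun w => present (eset a :|: eset b)%SET w * (asum a w * asum b w)).
  by apply/funext => w; rewrite /copy_bound mulrACA presentM.
by rewrite eqf; split => //; rewrite E ler_wpM2l// exprn_ge0.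
Qed.

Lemma copy_bound_mean3 a b c : 0 <= p -> intgQ (fun s => `|X s| ^+ 3) ->
  intg (fun w => copy_bound a w * copy_bound b w * copy_bound c w) /\
  \int[P]_w (copy_bound a w * copy_bound b w * copy_bound c w) <=
    p ^+ #|(eset a :|: eset b :|: eset c)%SET| *
      ((ne a)%:R * (ne b)%:R * (ne c)%:R * mom 3).
Proof.
move=> p0 i3; have [ia Ea] := asum3 a b c i3.
have e2 := edgesU (edgesU (@edges_eset a) (@edges_eset b)) (@edges_eset c).
have [i E] := ER_present_mul e2
  (bmeasM (bmeasM (asum_blockT a) (asum_blockT b)) (asum_blockT c)) ia.
have eqf : (fun w => copy_bound a w * copy_bound b w * copy_bound c w) =
    (fun w => present (eset a :|: eset b :|: eset c)%SET w *
       (asum a w * asum b w * asum c w)).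
  by apply/funext => w; rewrite /copy_bound (mulrACA (present (eset a) w)) presentM mulrACA presentM.
by rewrite eqf; split => //; rewrite E ler_wpM2l// exprn_ge0.
Qed.

(** E[X_e X_f] is mu^2 for distinct edges and exceeds mu^2 by the variance for e = f; the second
    case occurs once for each common edge. *)
Lemma copy_weight_mean2 a b : intgQ (fun s => X s) -> intgQ (fun s => X s ^+ 2) ->
  \int[P]_w (copy_weight a w * copy_weight b w) =
    p ^+ #|(eset a :|: eset b)%SET| * ((ne a)%:R * (ne b)%:R * (\int[Q]_s X s) ^+ 2 +
      #|(eset a :&: eset b)%SET|%:R * (\int[Q]_s X s ^+ 2 - (\int[Q]_s X s) ^+ 2)).
Proof.
move=> iX iX2; set mu := \int[Q]_s X s; set m2 := \int[Q]_s X s ^+ 2.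
have iXe (e : {set 'I_n}) : #|e| == 2 -> intg (Xe e) /\ \int[P]_w Xe e w = mu.
  by move=> e2; exact: (@weight_law id (Sub e e2) _ iX).
have iXe2 (e : {set 'I_n}) : #|e| == 2 -> intg (fun w => Xe e w ^+ 2) /\ \int[P]_w Xe e w ^+ 2 = m2.
  move=> e2; apply: (@weight_law (fun x => x ^+ 2) (Sub e e2) _ iX2).
  exact: measurable_funX.
have iXX (e f : {set 'I_n}) : #|e| == 2 -> #|f| == 2 -> intg (fun w => Xe e w * Xe f w).
  move=> e2 f2; apply: (@intg_le _ _ _ P _ (fun w => Xe e w ^+ 2 + Xe f w ^+ 2)).
  - exact: measurable_funM.
  - move=> w; rewrite normrM -(real_normK (num_real (Xe e w))) -(real_normK (num_real (Xe f w))).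
    have := sqr_ge0 (`|Xe e w| - `|Xe f w|).
    by have := sqr_ge0 (`|Xe e w| + `|Xe f w|); nra.
  - by apply: intgD; [have [] := iXe2 e e2|have [] := iXe2 f f2].
have EXX (e f : {set 'I_n}) : #|e| == 2 -> #|f| == 2 ->
    \int[P]_w (Xe e w * Xe f w) = mu ^+ 2 + (e == f)%:R * (m2 - mu ^+ 2).
  move=> e2 f2; have [<-|ef] := eqVneq e f.
    by rewrite mul1r addrC subrK; have [_ <-] := iXe2 e e2.
  rewrite mul0r addr0.
  have [ie Ee] := iXe e e2; have [if_ Ef] := iXe f f2.
  rewrite (expectation_block Fam_measurable Fam_setI Fam_indep _
    (@weight_block_measurable e [set e]%SET e2 _)
    (@weight_block_measurable f [set f]%SET f2 _))// ?finset.set11//; last 2 first.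
    - rewrite -finset.setI_eq0; apply/eqP/setP => -[g|g]; rewrite !finset.inE//.
      by apply/negbTE/negP => /andP[/eqP -> /eqP E]; rewrite E eqxx in ef.
    - exact: iXX.
  by rewrite Ee Ef expr2.
have ea2 (c : graph 'I_n) (e : {set 'I_n}) : e \in eset c -> #|e| == 2 by move=> ec; rewrite (eset_card2 ec).
have iww1 e : e \in eset a -> intg (fun w => \sum_(f in eset b) Xe e w * Xe f w).
  by move=> ea; apply: intg_sum => f fb; apply: iXX; apply: ea2; eassumption.
have wE : (fun w => wsum a w * wsum b w) =
    (fun w => \sum_(e in eset a) \sum_(f in eset b) Xe e w * Xe f w).
  by apply/funext => w; rewrite /wsum mulr_suml; apply: eq_bigr => e _; rewrite mulr_sumr.
have iww : intg (fun w => wsum a w * wsum b w) by rewrite wE; exact: intg_sum.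
have e2 := edgesU (@edges_eset a) (@edges_eset b).
have [i E] := ER_present_mul e2 (bmeasM (wsum_blockT a) (wsum_blockT b)) iww.
have -> : (fun w => copy_weight a w * copy_weight b w) =
    (fun w => present (eset a :|: eset b)%SET w * (wsum a w * wsum b w)).
  by apply/funext => w; rewrite /copy_weight mulrACA presentM.
rewrite E wE; congr (_ * _).
rewrite ERsum// (eq_bigr (fun e => \sum_(f in eset b) (mu ^+ 2 + (e == f)%:R * (m2 - mu ^+ 2)))); last first.
  move=> e ea; rewrite ERsum; last by move=> f fb; apply: iXX; apply: ea2; eassumption.
  by apply: eq_bigr => f fb; apply: EXX; apply: ea2; eassumption.
under eq_bigr do rewrite big_split/= sumr_const -mulr_suml.
rewrite big_split/= sumr_const -mulr_suml; congr (_ + _ * _).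
  by rewrite -mulrA !mulr_natl.
rewrite -sum1_card natr_sum (eq_bigl (fun e => (e \in eset a) && (e \in eset b))); last first.
  by move=> e; rewrite finset.inE.
rewrite big_mkcondr; apply: eq_bigr => e ea.
case: ifPn => eb.
  rewrite (bigD1 e)//= eqxx big1 ?addr0// => f /andP[_ /negbTE].
  by rewrite eq_sym => ->.
rewrite big1// => f fb; case: eqVneq => // ef.
by rewrite -ef (negbTE eb) in fb.
Qed.

(** One envelope for all copies: it dominates every copy weight, and the leading 1 makes its powers
    increase with the exponent. *)
Let M w := 1 + \sum_(e : edge n) `|Xe (val e) w|.

Lemma model_growth_ge1 w : 1 <= M w.
Proof. by rewrite lerDl sumr_ge0. Qed.

Lemma model_growth_intg k : intgQ (fun s => `|X s| ^+ k) -> intg (fun w => M w ^+ k).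
Proof.
move=> ik.
have mM (I : Type) (s : seq I) (F : I -> T -> R) : (forall i, measurable_fun setT (F i)) ->
    measurable_fun setT (fun w => 1 + \sum_(i <- s) F i w).
  by move=> mF; apply: measurable_funD => //; exact: measurable_sum.
have pow (x y : R) : 0 <= x -> 0 <= y -> (x + y) ^+ k <= 2 ^+ k * (x ^+ k + y ^+ k).
  wlog xy : x y / x <= y.
    move=> wl x0 y0; have [xy|/ltW yx] := leP x y; first exact: wl.
    by rewrite addrC [_ ^+ k + _]addrC; exact: wl.
  move=> x0 y0; apply: (@le_trans _ _ ((2 * y) ^+ k)).
    by rewrite lerXn2r ?nnegrE ?addr_ge0 ?mulr_ge0//; lra.
  by rewrite exprMn ler_wpM2l ?exprn_ge0// lerDr exprn_ge0.
rewrite /M; elim: (index_enum _) => [|e s ih].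
  by under eq_fun do rewrite big_nil; exact: intg_cst.
pose F w := 2 ^+ k * ((1 + \sum_(e <- s) `|Xe (val e) w|) ^+ k + `|Xe (val e) w| ^+ k).
have iF : intg F.
  apply: intgZ; apply: intgD => //.
  have e2 : #|val e| == 2 by exact: valP e.
  by have [] := weight_mom ik e2.
apply: intg_le iF => [|w].
  apply: measurable_funX; apply: mM => i.
  by apply: measurableT_comp.
rewrite big_cons addrCA addrC ger0_norm.
  by apply: pow => //; rewrite addr_ge0// sumr_ge0.
by rewrite exprn_ge0// addr_ge0// addr_ge0// sumr_ge0.
Qed.

Lemma copy_weight_growth a : growth M 1 (copy_weight a).
Proof.
split; first by apply: bmeas_measurable; exact: copy_weight_block.
exists 1 => // w; rewrite mul1r expr1 (le_trans (copy_weight_le a w))//.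
apply: (@le_trans _ _ (asum a w)).
  by rewrite /copy_bound ler_piMl//; have /andP[] := present01 (eset a) w.
apply: (@le_trans _ _ (\sum_(e : edge n) `|Xe (val e) w|)); last by rewrite lerDr.
have -> : \sum_(e : edge n) `|Xe (val e) w| =
    \sum_(e in [set val e | e in [set: edge n]]%SET) `|Xe e w|.
  by rewrite big_imset/=; [apply: eq_bigl => e; rewrite finset.inE|move=> e f _ _; exact: val_inj].
rewrite [leRHS](bigID (mem (eset a)))/= -[leLHS]addr0 lerD ?sumr_ge0//.
rewrite /asum le_eqVlt; apply/orP; left; apply/eqP; apply: eq_bigl => e.
case: (boolP (e \in eset a)) => [ea|]; last by rewrite andbF.
rewrite andbT; apply/esym/imsetP.
have e2 : #|e| == 2 by rewrite (eset_card2 ea).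
by exists (Sub e e2); rewrite ?finset.inE.
Qed.

Lemma block_compl_indep (A : {set edge n + edge n}) (f g : T -> R) :
  bmeas A f -> bmeas (~: A)%SET g ->
  intg f -> intg g -> intg (fun w => f w * g w) ->
  \int[P]_w (f w * g w) = \int[P]_w f w * \int[P]_w g w.
Proof.
move=> mf mg; apply: (expectation_block Fam_measurable Fam_setI Fam_indep _ mf mg).
by rewrite -finset.setI_eq0 finset.setICr.
Qed.

Let full_blockU (a b c : graph 'I_n) : ~~ (share a c || share b c) ->
  full_block (eset c) \subset (~: (full_block (eset a) :|: full_block (eset b)))%SET.
Proof.
rewrite negb_or !negbK => /andP[/eqP ac /eqP bc].
apply/fintype.subsetP => -[e|e]; rewrite !finset.inE => ec; rewrite negb_or.
  apply/andP; split; apply/negP => ex.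
    by have := finset.in_set0 (val e); rewrite -ac finset.inE ex ec.
  by have := finset.in_set0 (val e); rewrite -bc finset.inE ex ec.
apply/andP; split; apply/negP => ex.
  by have := finset.in_set0 (val e); rewrite -ac finset.inE ex ec.
by have := finset.in_set0 (val e); rewrite -bc finset.inE ex ec.
Qed.

(** * Variance and third moments of the centred copies *)

Section normal_approximation.
Variables (V : finType) (G : graph V).
Hypothesis p01 : 0 < p < 1.
Hypothesis e1 : (1 <= ne G)%N.
Hypothesis X0 : forall s, 0 <= X s.
Hypothesis iX : forall k, (k <= 3)%N -> intgQ (fun s => `|X s| ^+ k).

Local Notation C := (copies G n).
Let e := ne G.
Let mu := \int[Q]_s X s.
Let m2 := \int[Q]_s X s ^+ 2.
Let var := m2 - mu ^+ 2.

Let p0 : 0 < p. Proof. by case/andP: p01. Qed.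
Let p1 : p <= 1. Proof. by case/andP: p01 => _ /ltW. Qed.

Let absX s : `|X s| = X s. Proof. exact: ger0_norm. Qed.

Let iX1 : intgQ (fun s => X s).
Proof. by have := iX (isT : (1 <= 3)%N); under eq_fun do rewrite /= absX. Qed.

Let iX2 : intgQ (fun s => X s ^+ 2).
Proof. by have := iX (isT : (2 <= 3)%N); under eq_fun do rewrite /= absX. Qed.

Let mom1E : mom 1 = mu.
Proof. by rewrite /mom; under eq_Rintegral do rewrite absX. Qed.

Let mom0 k : 0 <= mom k. Proof. by apply: ER_ge0 => s; rewrite exprn_ge0. Qed.

Let iZ a : intg (copy_weight a). Proof. by have [] := copy_weight_mean a iX1. Qed.

Let zbar a := \int[P]_w copy_weight a w.

(* Extended by 0 to all graphs, so that the sums range over the whole finite type. *)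
Definition centered (a : graph 'I_n) (w : T) : R :=
  (a \in C)%:R * (copy_weight a w - zbar a).

Let Y := centered.

Let Y_block a : bmeas (full_block (eset a)) (Y a).
Proof.
apply: bmeasM; first exact: bmeas_cst.
by apply: bmeasB; [exact: copy_weight_block|exact: bmeas_cst].
Qed.

Let M1 := model_growth_ge1.
Let iM k : (k <= 3)%N -> intg (fun w => M w ^+ k).
Proof. by move=> k3; apply: model_growth_intg; exact: iX. Qed.

Let gY a : growth M 1 (Y a).
Proof.
apply: (growthZ M1).
by apply: growthB; [exact: copy_weight_growth|exact: growth_cst M1 _ _].
Qed.

Let EY a : \int[P]_w Y a w = 0.
Proof.
rewrite /Y /centered ERZ; last by apply: intgB; [exact: iZ|exact: intg_cst].
rewrite RintegralB//; last exact: intg_cst.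
by rewrite ERcst subrr mulr0.
Qed.

Let gYY a b : growth M 2 (fun w => Y a w * Y b w).
Proof. exact: growthM (gY a) (gY b). Qed.

Let cov a b := \int[P]_w (Y a w * Y b w).

Let iZZ a b : intg (fun w => copy_weight a w * copy_weight b w).
Proof.
by apply: (growth_intg iM (isT : (2 <= 3)%N)); exact: (growthM (copy_weight_growth a) (copy_weight_growth b)).
Qed.

Let covE a b : a \in C -> b \in C ->
  cov a b = p ^+ #|(eset a :|: eset b)%SET| * (e%:R ^+ 2 * mu ^+ 2 +
     #|(eset a :&: eset b)%SET|%:R * var) - (p ^+ e * (e%:R * mu)) ^+ 2.
Proof.
move=> aC bC.
have ne_ c : c \in C -> ne c = e by rewrite finset.inE => /iso_ne.
have zE c : c \in C -> zbar c = p ^+ e * (e%:R * mu).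
  by move=> cC; rewrite /zbar; have [_ ->] := copy_weight_mean c iX1; rewrite ne_.
rewrite /cov /Y /centered aC bC.
have -> : (fun w => 1%:R * (copy_weight a w - zbar a) * (1%:R * (copy_weight b w - zbar b))) =
    (fun w => (copy_weight a w * copy_weight b w - zbar b * copy_weight a w) -
     (zbar a * copy_weight b w - zbar a * zbar b)).
  by apply/funext => w; ring.
have i1 := intgZ (zbar b) (iZ a); have i2 := intgZ (zbar a) (iZ b).
have ic := intg_cst P (zbar a * zbar b).
rewrite (RintegralB measurableT (intgB (iZZ a b) i1) (intgB i2 ic)).
rewrite (RintegralB measurableT (iZZ a b) i1) (RintegralB measurableT i2 ic).
rewrite ERcst (ERZ _ (iZ a)) (ERZ _ (iZ b)) -/(zbar a) -/(zbar b).
rewrite copy_weight_mean2// !ne_// !zE// -/mu -/m2 -/var.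
by rewrite -!expr2 !subrr subr0 -?expr2.
Qed.

Let var0 : 0 <= var.
Proof.
have : 0 <= \int[Q]_s (X s - mu) ^+ 2 by apply: ER_ge0 => s; exact: sqr_ge0.
have -> : (fun s => (X s - mu) ^+ 2) = (fun s => (X s ^+ 2 - 2 * mu * X s) + mu ^+ 2).
  by apply/funext => s; ring.
have i1 : intgQ (fun s => 2 * mu * X s) by exact: intgZ.
rewrite RintegralD//; [|exact: intgB|exact: intg_cst].
rewrite RintegralB// ERZ// ERcst -/mu -/m2 /var.
lra.
Qed.

(** With k common edges and u edges in the union, p^(2e) = p^u p^k, so the covariance is p^u (e^2
    mu^2 (1 - p^k) + k var). As k >= 1, the bracket is at least var and also at least (1 - p) mu^2 +
    var >= (1 - p) m2. *)
Let cov_share a b : a \in C -> b \in C -> share a b ->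
  p ^+ #|(eset a :|: eset b)%SET| * Num.max var ((1 - p) * m2) <= cov a b.
Proof.
move=> aC bC ab; rewrite covE//.
set k := #|(eset a :&: eset b)%SET|; set u := #|(eset a :|: eset b)%SET|.
have k1 : (0 < k)%N by rewrite card_gt0.
have uk : (u + k = e + e)%N.
  by rewrite cardsUI; move: aC bC; rewrite !finset.inE => /iso_ne + /iso_ne; rewrite /ne => -> ->.
have -> : p ^+ u * (e%:R ^+ 2 * mu ^+ 2 + k%:R * var) - (p ^+ e * (e%:R * mu)) ^+ 2 =
    p ^+ u * (e%:R ^+ 2 * mu ^+ 2 * (1 - p ^+ k) + k%:R * var).
  have : p ^+ e * p ^+ e = p ^+ u * p ^+ k by rewrite -!exprD uk.
  move: (p ^+ e) (p ^+ u) (p ^+ k) (e%:R : R) (k%:R : R) => x y z t q E.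
  have -> : (x * (t * mu)) ^+ 2 = x * x * (t * mu) ^+ 2 by ring.
  by rewrite E; ring.
rewrite ler_pM2l ?exprn_gt0//.
have h1 : mu ^+ 2 * (1 - p) <= e%:R ^+ 2 * mu ^+ 2 * (1 - p ^+ k).
  apply: ler_pM; rewrite ?sqr_ge0 ?subr_ge0//.
    by rewrite ler_peMl ?sqr_ge0// exprn_ege1// ler1n.
  by rewrite lerB// -[leRHS]expr1 ler_wiXn2l// ltW.
have h2 : var <= k%:R * var by rewrite ler_peMl// ler1n.
have h3 : (1 - p) * var <= var by rewrite ler_piMl// gerBl ltW.
have h4 : 0 <= mu ^+ 2 * (1 - p) by rewrite mulr_ge0 ?sqr_ge0 ?subr_ge0.
rewrite ge_max; apply/andP; split.
  by rewrite (le_trans h2)// lerDr (le_trans h4).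
have -> : (1 - p) * m2 = mu ^+ 2 * (1 - p) + (1 - p) * var by rewrite /var; ring.
by apply: lerD => //; exact: le_trans h3 h2.
Qed.

Let cov_notshare a b : ~~ share a b -> cov a b = 0.
Proof.
move=> ab; rewrite /cov.
rewrite (@block_compl_indep (full_block (eset a))) ?EY ?mul0r//.
- apply: (@bmeasS (full_block (eset b))); last exact: Y_block.
  by have := @full_blockU a a b; rewrite orbb finset.setUid; apply.
- exact: (growth_intg iM (isT : (1 <= 3)%N)).
- exact: (growth_intg iM (isT : (1 <= 3)%N)).
- exact: (growth_intg iM (isT : (2 <= 3)%N)).
Qed.

Let Yout a w : a \notin C -> Y a w = 0.
Proof. by move=> /negbTE aC; rewrite /Y /centered aC mul0r. Qed.

Let cov0l a b : a \notin C -> cov a b = 0.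
Proof. by move=> aC; rewrite /cov; under eq_Rintegral do rewrite Yout// mul0r; rewrite ERcst. Qed.

Let cov0r a b : b \notin C -> cov a b = 0.
Proof. by move=> aC; rewrite /cov; under eq_Rintegral do rewrite (Yout _ aC) mulr0; rewrite ERcst. Qed.

(** The sum runs over sharing pairs only, the form of the normalisation in [stein_local];
    [variance_subgraph_weight] identifies it with the variance. *)
Definition total_variance := \sum_a \sum_(b | share a b) cov a b.

Lemma total_variance_ge :
  Num.max var ((1 - p) * m2) *
    \sum_(a in C) \sum_(b in C | share a b) p ^+ #|(eset a :|: eset b)%SET| <=
  total_variance.
Proof.
rewrite /total_variance [leRHS](bigID (mem C))/= [X in _ <= _ + X]big1 ?addr0; last first.
  by move=> a aC; rewrite big1// => b _; exact: cov0l.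
rewrite mulr_sumr; apply: ler_sum => a aC.
rewrite [leRHS](bigID (mem C))/= [X in _ <= _ + X]big1 ?addr0; last first.
  by move=> b /andP[_ bC]; exact: cov0r.
rewrite mulr_sumr [leRHS](eq_bigl (fun b => (b \in C) && share a b)); last by move=> b; rewrite andbC.
by apply: ler_sum => b /andP[bC ab]; rewrite mulrC; exact: cov_share.
Qed.

Let W := subgraph_weight G GG Xe.

Lemma subgraph_weightE w : W w = \sum_(a in C) copy_weight a w.
Proof.
rewrite /W /subgraph_weight; apply: eq_big => [a|a _]; first by rewrite finset.inE.
rewrite /copy_weight /present /subgraph.
have [-> _ _ _] := model.
by rewrite finset.subsetT.
Qed.

Let iW : intg W.
Proof.
have -> : W = (fun w => \sum_(a in C) copy_weight a w).
  by apply/funext => w; exact: subgraph_weightE.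
by apply: intg_sum => a _; exact: iZ.
Qed.

Let EW := \int[P]_w W w.

Lemma centered_sum w : W w - EW = \sum_a Y a w.
Proof.
rewrite /EW; under eq_Rintegral do rewrite subgraph_weightE.
rewrite ERsum; last by move=> a _; exact: iZ.
rewrite subgraph_weightE -sumrB [RHS](bigID (mem C))/= [X in _ = _ + X]big1 ?addr0; last first.
  by move=> a aC; exact: Yout.
by apply: eq_bigr => a aC; rewrite /Y /centered aC mul1r.
Qed.

Lemma variance_subgraph_weight : \int[P]_w (W w - EW) ^+ 2 = total_variance.
Proof.
have -> : (fun w => (W w - EW) ^+ 2) = (fun w => \sum_a \sum_b Y a w * Y b w).
  apply/funext => w; rewrite centered_sum expr2 mulr_suml; apply: eq_bigr => a _.
  by rewrite mulr_sumr.
have iYY a b : intg (fun w => Y a w * Y b w) by exact: (growth_intg iM (isT : (2 <= 3)%N)).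
have iYs a : intg (fun w => \sum_b Y a w * Y b w) by exact: intg_sum.
rewrite ERsum//; apply: eq_bigr => a _; rewrite ERsum//.
rewrite (bigID (share a))/= [X in _ + X]big1 ?addr0// => b ab.
exact: cov_notshare.
Qed.

Let iXk k : (k <= 3)%N -> intgQ (fun s => X s ^+ k).
Proof. by move=> /iX; under eq_fun do rewrite /= absX. Qed.

Let momE k : mom k = \int[Q]_s X s ^+ k.
Proof. by rewrite /mom; under eq_Rintegral do rewrite absX. Qed.

(** Jensen's inequality through the tangent of the cube at m: x^3 - 3 m^2 x + 2 m^3 = (x - m)^2 (x +
    2 m). *)
Let mom1_cube : mom 1 ^+ 3 <= mom 3.
Proof.
have m0 := mom0 1; set m := mom 1 in m0 *.
have i1 : intgQ (fun s => 3 * m ^+ 2 * X s) by exact: intgZ.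
have : \int[Q]_s (3 * m ^+ 2 * X s - 2 * m ^+ 3) <= \int[Q]_s X s ^+ 3.
  apply: ER_le; [by apply: intgB => //; exact: intg_cst|exact: iXk|move=> s].
  have : 0 <= (X s - m) ^+ 2 * (X s + 2 * m).
    by rewrite mulr_ge0 ?sqr_ge0// addr_ge0// mulr_ge0.
  rewrite (_ : _ * _ = X s ^+ 3 - (3 * m ^+ 2 * X s - 2 * m ^+ 3)); last by ring.
  by rewrite subr_ge0.
rewrite RintegralB//; last exact: intg_cst.
rewrite ERZ// ERcst -momE -/mu -mom1E -/m.
by rewrite (_ : _ - _ = m ^+ 3)//; ring.
Qed.

(** Integrating 3 m x^2 <= 2 x^3 + m^3, whose difference is (x - m)^2 (2 x + m), gives 3 m E[X^2] <=
    2 E[X^3] + m^3, and m^3 <= E[X^3] by [mom1_cube]. *)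
Let mom12 : mom 1 * mom 2 <= mom 3.
Proof.
have m0 := mom0 1; set m := mom 1 in m0 *.
have i2 : intgQ (fun s => 3 * m * X s ^+ 2) by apply: intgZ; exact: iXk.
have i3 : intgQ (fun s => 2 * X s ^+ 3) by apply: intgZ; exact: iXk.
have : \int[Q]_s (3 * m * X s ^+ 2) <= \int[Q]_s (2 * X s ^+ 3 + m ^+ 3).
  apply: ER_le => //; first by apply: intgD => //; exact: intg_cst.
  move=> s; have : 0 <= (X s - m) ^+ 2 * (2 * X s + m).
    by rewrite mulr_ge0 ?sqr_ge0// addr_ge0// mulr_ge0.
  rewrite (_ : _ * _ = (2 * X s ^+ 3 + m ^+ 3) - 3 * m * X s ^+ 2); last by ring.
  by rewrite subr_ge0.
rewrite RintegralD//; last exact: intg_cst.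
rewrite (ERZ _ (iXk (isT : (2 <= 3)%N))) (ERZ _ (iXk (isT : (3 <= 3)%N))).
rewrite ERcst -!momE; have := mom1_cube; rewrite -/m => h1 h2.
lra.
Qed.

Let A := copy_bound.
(** The common mean of the bounds [A a], which also bounds the mean of a copy weight; hence |Y a| <=
    A a + alpha. *)
Let alpha := p ^+ e * (e%:R * mom 1).
Let T3 (a b c : graph 'I_n) := p ^+ #|(eset a :|: eset b :|: eset c)%SET| * (e%:R ^+ 3 * mom 3).

Let neC c : c \in C -> ne c = e. Proof. by rewrite finset.inE => /iso_ne. Qed.

Let iA a : intg (A a).
Proof. by have [] := copy_bound_mean a (iX (isT : (1 <= 3)%N)). Qed.

Let EA a : a \in C -> \int[P]_w A a w = alpha.
Proof.
by move=> aC; have [_ ->] := copy_bound_mean a (iX (isT : (1 <= 3)%N)); rewrite neC.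
Qed.

Let iAA a b : intg (fun w => A a w * A b w).
Proof. by have [] := copy_bound_mean2 a b (ltW p0) (iX (isT : (2 <= 3)%N)). Qed.

Let iAAA a b c : intg (fun w => A a w * A b w * A c w).
Proof. by have [] := copy_bound_mean3 a b c (ltW p0) (iX (isT : (3 <= 3)%N)). Qed.

Let EAAA a b c : a \in C -> b \in C -> c \in C ->
  \int[P]_w (A a w * A b w * A c w) <= T3 a b c.
Proof.
move=> aC bC cC.
have [_] := copy_bound_mean3 a b c (ltW p0) (iX (isT : (3 <= 3)%N)).
by rewrite !neC// -expr2 -exprSr.
Qed.

Let alpha0 : 0 <= alpha. Proof. by rewrite mulr_ge0 ?exprn_ge0 ?mulr_ge0// ltW. Qed.

Let ppow k l (x : R) : 0 <= x -> (k <= l)%N -> p ^+ l * x <= p ^+ k * x.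
Proof. by move=> x0 kl; rewrite ler_wpM2r//; apply: ler_wiXn2l => //; exact: ltW. Qed.

(** Replacing a third copy by its mean gives p^e instead of p to the number of its new edges. As p
    <= 1 this is no larger, so mixed terms are absorbed into [T3]. *)
Let alphaAA a b k : a \in C -> b \in C -> (k <= #|(eset a :|: eset b)%SET| + e)%N ->
  alpha * \int[P]_w (A a w * A b w) <= p ^+ k * (e%:R ^+ 3 * mom 3).
Proof.
move=> aC bC ku.
have [_ h] := copy_bound_mean2 a b (ltW p0) (iX (isT : (2 <= 3)%N)).
rewrite !neC// in h.
apply: (@le_trans _ _ (p ^+ (#|(eset a :|: eset b)%SET| + e) * (e%:R ^+ 3 * mom 3))).
  apply: (le_trans (ler_wpM2l alpha0 h)); rewrite /alpha exprD.
  rewrite [leLHS](_ : _ = p ^+ #|(eset a :|: eset b)%SET| * p ^+ e * (e%:R ^+ 3 * (mom 1 * mom 2))).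
    rewrite ler_wpM2l//; first by rewrite mulr_ge0 ?exprn_ge0// ltW.
    by rewrite ler_wpM2l// exprn_ge0.
  have swap (x y z t u : R) : x * (z * t) * (y * (z * z * u)) = y * x * (z ^+ 3 * (t * u)).
    by ring.
  exact: swap.
by apply: ppow => //; rewrite mulr_ge0 ?exprn_ge0.
Qed.

Let alpha3 k : (k <= e + e + e)%N -> alpha ^+ 3 <= p ^+ k * (e%:R ^+ 3 * mom 3).
Proof.
move=> ke; apply: (@le_trans _ _ (p ^+ (e + e + e) * (e%:R ^+ 3 * mom 3))); last first.
  by apply: ppow => //; rewrite mulr_ge0 ?exprn_ge0.
rewrite /alpha !exprD 2!exprMn (_ : (p ^+ e) ^+ 3 = p ^+ e * p ^+ e * p ^+ e); last first.
  by rewrite !exprS expr0 mulr1 mulrA.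
rewrite ler_wpM2l//; first by rewrite !mulr_ge0// exprn_ge0// ltW.
by rewrite ler_wpM2l// exprn_ge0.
Qed.

Let Yle a w : a \in C -> `|Y a w| <= A a w + alpha.
Proof.
move=> aC; rewrite /Y /centered aC mul1r (le_trans (ler_normB _ _))// lerD ?copy_weight_le//.
rewrite (le_trans (ER_norm (iZ a)))// -(EA aC).
by apply: ER_le; [exact: intg_norm|exact: iA|exact: copy_weight_le].
Qed.

Let A0 a w : 0 <= A a w. Proof. exact: copy_bound_ge0. Qed.

(** The constant is 8 + 8: the product of three factors A + alpha expands into eight terms, each
    with mean at most [T3], and the product of expectations gives 2 + 6 further such terms. *)
Let YYY a b c : a \in C -> b \in C -> c \in C ->
  \int[P]_w `|Y a w * Y b w * Y c w| + \int[P]_w `|Y a w * Y b w| * \int[P]_w `|Y c w|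
  <= 16 * T3 a b c.
Proof.
move=> aC bC cC.
have card_ (x : graph 'I_n) : x \in C -> #|eset x| = e by move=> xC; rewrite -(neC xC).
set u := #|(eset a :|: eset b :|: eset c)%SET|.
have uab : (u <= #|(eset a :|: eset b)%SET| + e)%N.
  by rewrite (leq_trans (leq_card_setU _ _))// (card_ c).
have uac : (u <= #|(eset a :|: eset c)%SET| + e)%N.
  by rewrite /u finset.setUAC (leq_trans (leq_card_setU _ _))// (card_ b).
have ubc : (u <= #|(eset b :|: eset c)%SET| + e)%N.
  by rewrite /u -finset.setUA finset.setUC (leq_trans (leq_card_setU _ _))// (card_ a).
have ue : (u <= e + e + e)%N.
  rewrite (leq_trans uab)// leq_add2r (leq_trans (leq_card_setU _ _))//.
  by rewrite !card_.
have hab := alphaAA aC bC uab; have hac := alphaAA aC cC uac.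
have hbc := alphaAA bC cC ubc; have h3 := alpha3 ue.
have habc := EAAA aC bC cC.
rewrite -/(T3 a b c) in hab hac hbc h3.
have g0 : growth M 3 (fun w => `|Y a w * Y b w * Y c w|).
  by apply: growth_norm; exact: (growthM (gYY a b) (gY c)).
pose F w := A a w * A b w * A c w + (alpha * (A a w * A b w) + (alpha * (A a w * A c w) +
  (alpha * (A b w * A c w) + (alpha ^+ 2 * A a w + (alpha ^+ 2 * A b w +
  (alpha ^+ 2 * A c w + alpha ^+ 3)))))).
pose F2 w := A a w * A b w + (alpha * A a w + (alpha * A b w + alpha ^+ 2)).
pose F1 w := A c w + alpha.
have i1 k x : intg (fun w => k * A x w) by exact: intgZ.
have i2 k x y : intg (fun w => k * (A x w * A y w)) by exact: intgZ.
have ic k : intg (fun=> k) by exact: intg_cst.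
have j1 := intgD (i1 (alpha ^+ 2) c) (ic (alpha ^+ 3)).
have j2 := intgD (i1 (alpha ^+ 2) b) j1.
have j3 := intgD (i1 (alpha ^+ 2) a) j2.
have j4 := intgD (i2 alpha b c) j3.
have j5 := intgD (i2 alpha a c) j4.
have j6 := intgD (i2 alpha a b) j5.
have j7 := intgD (iAAA a b c) j6.
have EF : \int[P]_w F w <= 8 * T3 a b c.
  rewrite /F (RintegralD measurableT (iAAA a b c) j6) (RintegralD measurableT (i2 alpha a b) j5).
  rewrite (RintegralD measurableT (i2 alpha a c) j4) (RintegralD measurableT (i2 alpha b c) j3).
  rewrite (RintegralD measurableT (i1 (alpha ^+ 2) a) j2) (RintegralD measurableT (i1 (alpha ^+ 2) b) j1).
  rewrite (RintegralD measurableT (i1 (alpha ^+ 2) c) (ic (alpha ^+ 3))) ERcst.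
  rewrite !(ERZ _ (iAA _ _)) !(ERZ _ (iA _)) !EA// -exprSr.
  lra.
have k1 := intgD (i1 alpha b) (ic (alpha ^+ 2)).
have k2 := intgD (i1 alpha a) k1.
have k3 := intgD (iAA a b) k2.
have EF2 : \int[P]_w F2 w = \int[P]_w (A a w * A b w) + 3 * alpha ^+ 2.
  rewrite /F2 (RintegralD measurableT (iAA a b) k2) (RintegralD measurableT (i1 alpha a) k1).
  rewrite (RintegralD measurableT (i1 alpha b) (ic (alpha ^+ 2))) ERcst.
  by rewrite !(ERZ _ (iA _)) !EA//; ring.
have EF1 : \int[P]_w F1 w = 2 * alpha.
  by rewrite /F1 (RintegralD measurableT (iA c) (ic alpha)) EA// ERcst; ring.
have le3 : \int[P]_w `|Y a w * Y b w * Y c w| <= \int[P]_w F w.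
  apply: ER_le => //; first exact: (growth_intg iM (isT : (3 <= 3)%N)).
  move=> w; apply: (@le_trans _ _ ((A a w + alpha) * (A b w + alpha) * (A c w + alpha))).
    rewrite 2!normrM; exact: (ler_pM (mulr_ge0 (normr_ge0 _) (normr_ge0 _)) (normr_ge0 _)
      (ler_pM (normr_ge0 _) (normr_ge0 _) (Yle w aC) (Yle w bC)) (Yle w cC)).
  by rewrite le_eqVlt /F; apply/orP; left; apply/eqP; ring.
have le2 : \int[P]_w `|Y a w * Y b w| <= \int[P]_w F2 w.
  apply: ER_le => //.
    by apply: intg_norm; exact: (growth_intg iM (isT : (2 <= 3)%N)).
  move=> w; apply: (@le_trans _ _ ((A a w + alpha) * (A b w + alpha))).
    by rewrite normrM; apply: ler_pM => //; exact: Yle.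
  by rewrite le_eqVlt /F2; apply/orP; left; apply/eqP; ring.
have le1 : \int[P]_w `|Y c w| <= \int[P]_w F1 w.
  apply: ER_le => //; last by move=> w; exact: Yle.
    by apply: intg_norm; exact: (growth_intg iM (isT : (1 <= 3)%N)).
  exact: intgD.
have le21 : \int[P]_w `|Y a w * Y b w| * \int[P]_w `|Y c w| <=
    (\int[P]_w F2 w) * (\int[P]_w F1 w).
  by apply: ler_pM => //; apply: ER_ge0.
rewrite EF2 EF1 in le21.
apply: (le_trans (lerD (le_trans le3 EF) le21)).
rewrite [X in _ + X](_ : _ = 2 * (alpha * \int[P]_w (A a w * A b w)) + 6 * alpha ^+ 3); last by ring.
rewrite (_ : 16 * _ = 8 * T3 a b c + (2 * T3 a b c + 6 * T3 a b c)); last by ring.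
by rewrite lerD2l lerD// ler_pM2l.
Qed.

Definition triple_sum := \sum_(a in C) \sum_(b in C | share a b)
  \sum_(c in C | share a c || share b c) p ^+ #|(eset a :|: eset b :|: eset c)%SET|.

(** [stein_local] is applied to the centred copies divided by the standard deviation. Copies omitted
    from U_a are those with an edge of a, so the rest is measurable for the complement of the full
    block of a; for V_ab the block is the union of those of a and b. *)
Lemma normal_approximation (L : R) (h f f' : R -> R) :
  0 < total_variance ->
  (forall x y, `|h x - h y| <= `|x - y|) ->
  (forall x : R, is_derive x 1 f (f' x)) ->
  (forall x, f' x = x * f x + (h x - \int[normal_prob 0 1]_x h x)) ->
  (forall x, `|f x| <= L) ->
  (forall x y, `|f' x - f' y| <= L * `|x - y|) ->
  `|\int[P]_w h ((W w - EW) / Num.sqrt total_variance) - \int[normal_prob 0 1]_x h x| <=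
  2 * L * (16 * (e%:R ^+ 3 * mom 3) * triple_sum / Num.sqrt total_variance ^+ 3).
Proof.
move=> tv0 hL df f'E fL f'L.
pose s := Num.sqrt total_variance.
have s0 : 0 < s by rewrite sqrtr_gt0.
pose y a w := s^-1 * Y a w.
have L0 : 0 <= L by exact: le_trans (fL 0).
have WE w : (W w - EW) / s = \sum_a y a w.
  by rewrite centered_sum mulrC mulr_sumr.
under eq_Rintegral do rewrite -/s WE.
have gy a : growth M 1 (y a) by apply: (growthZ M1); exact: gY.
have yb a : bmeas (full_block (eset a)) (y a).
  by apply: bmeasM; [exact: bmeas_cst|exact: Y_block].
have growth1_intg F : growth M 1 F -> intg F.
  exact: (growth_intg iM (isT : (1 <= 3)%N)).
have growth2_intg F : growth M 2 F -> intg F.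
  exact: (growth_intg iM (isT : (2 <= 3)%N)).
have growth3_intg F : growth M 3 F -> intg F.
  exact: (growth_intg iM (isT : (3 <= 3)%N)).
have Ey a : \int[P]_w y a w = 0.
  by rewrite /y ERZ ?EY ?mulr0//; exact: growth1_intg.
have covy a b : \int[P]_w (y a w * y b w) = cov a b / total_variance.
  have -> : (fun w => y a w * y b w) = (fun w => total_variance^-1 * (Y a w * Y b w)).
    by apply/funext => w; rewrite /y mulrACA -invfM -expr2 sqr_sqrtr// ltW.
  by rewrite (ERZ _ (growth2_intg _ (gYY a b))) mulrC.
have gsum (Pr : pred (graph 'I_n)) : growth M 1 (fun w => \sum_(b | Pr b) y b w).
  by apply: (growth_sum M1).
have ind1 a (g : R -> R) : continuous g ->
    (exists C0, forall x, `|g x| <= C0 * (1 + `|x|)) ->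
    \int[P]_w (y a w * g (\sum_(b | ~~ share a b) y b w)) = 0.
  move=> cg lg.
  have gg : growth M 1 (fun w => g (\sum_(b | ~~ share a b) y b w)).
    exact: (growth_comp M1).
  rewrite (@block_compl_indep (full_block (eset a))) ?Ey ?mul0r//.
  - apply: bmeas_comp; first exact: continuous_measurable_fun.
    apply: bmeas_sum => b ab; apply: (@bmeasS (full_block (eset b))) => //.
    by have := @full_blockU a a b; rewrite orbb finset.setUid; apply.
  - exact: growth1_intg.
  - exact: growth1_intg.
  - by apply: growth2_intg; exact: growthM (gy a) gg.
have ind2 a b (g : R -> R) : share a b -> continuous g ->
    (exists C0, forall x, `|g x| <= C0 * (1 + `|x|)) ->
    \int[P]_w ((y a w * y b w - \int[P]_w (y a w * y b w)) *
       g (\sum_(c | ~~ (share a c || share b c)) y c w)) = 0.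
  move=> _ cg lg.
  set m := \int[P]_w (y a w * y b w).
  have gg : growth M 1 (fun w => g (\sum_(c | ~~ (share a c || share b c)) y c w)).
    exact: (growth_comp M1).
  have gyy : growth M 2 (fun w => y a w * y b w) by exact: growthM (gy a) (gy b).
  have gf : growth M 2 (fun w => y a w * y b w - m).
    by apply: growthB => //; exact: growth_cst M1 _ _.
  rewrite (@block_compl_indep (full_block (eset a) :|: full_block (eset b))%SET).
  - rewrite RintegralB//; [|exact: growth2_intg|exact: intg_cst].
    by rewrite ERcst subrr mul0r.
  - apply: bmeasB; last exact: bmeas_cst.
    apply: bmeasM.
      by apply: (@bmeasS (full_block (eset a))) => //; exact: finset.subsetUl.
    by apply: (@bmeasS (full_block (eset b))) => //; exact: finset.subsetUr.
  - apply: bmeas_comp; first exact: continuous_measurable_fun.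
    apply: bmeas_sum => c abc; apply: (@bmeasS (full_block (eset c))) => //.
    exact: full_blockU.
  - exact: growth2_intg.
  - exact: growth1_intg.
  - by apply: growth3_intg; exact: growthM gf gg.
have var1 : \sum_a \sum_(b | share a b) \int[P]_w (y a w * y b w) = 1.
  rewrite -(divff (lt0r_neq0 tv0)) {1}/total_variance mulr_suml; apply: eq_bigr => a _.
  by rewrite mulr_suml; apply: eq_bigr => b _; exact: covy.
apply: (le_trans (stein_local M1 iM gy ind1 ind2 var1 hL df f'E fL f'L)).
rewrite ler_wpM2l//; first by rewrite mulr_ge0.
have yout a w : a \notin C -> y a w = 0 by move=> aC; rewrite /y Yout// mulr0.
rewrite -/s.
pose q a b c := \int[P]_w `|y a w * y b w * y c w| +
      \int[P]_w `|y a w * y b w| * \int[P]_w `|y c w|.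
have E3 a b c : \int[P]_w `|y a w * y b w * y c w| = s^-1 ^+ 3 * \int[P]_w `|Y a w * Y b w * Y c w|.
  have -> : (fun w => `|y a w * y b w * y c w|) = (fun w => s^-1 ^+ 3 * `|Y a w * Y b w * Y c w|).
    apply/funext => w; rewrite (_ : y a w * y b w * y c w = s^-1 ^+ 3 * (Y a w * Y b w * Y c w)).
      by rewrite normrM ger0_norm// exprn_ge0// invr_ge0 ltW.
    by rewrite /y; ring.
  by rewrite ERZ//; apply: growth3_intg; apply: growth_norm; exact: (growthM (gYY a b) (gY c)).
have E2 a b : \int[P]_w `|y a w * y b w| = s^-1 ^+ 2 * \int[P]_w `|Y a w * Y b w|.
  have -> : (fun w => `|y a w * y b w|) = (fun w => s^-1 ^+ 2 * `|Y a w * Y b w|).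
    apply/funext => w; rewrite (_ : y a w * y b w = s^-1 ^+ 2 * (Y a w * Y b w)).
      by rewrite normrM ger0_norm// exprn_ge0// invr_ge0 ltW.
    by rewrite /y; ring.
  by rewrite ERZ//; apply: growth2_intg; exact: growth_norm.
have E1 a : \int[P]_w `|y a w| = s^-1 * \int[P]_w `|Y a w|.
  have -> : (fun w => `|y a w|) = (fun w => s^-1 * `|Y a w|).
    by apply/funext => w; rewrite /y normrM ger0_norm// invr_ge0 ltW.
  by rewrite ERZ//; apply: growth1_intg; exact: growth_norm.
have qE a b c : q a b c = s^-1 ^+ 3 * (\int[P]_w `|Y a w * Y b w * Y c w| +
      \int[P]_w `|Y a w * Y b w| * \int[P]_w `|Y c w|).
  have swap (r t u z : R) : r ^+ 3 * t + r ^+ 2 * u * (r * z) = r ^+ 3 * (t + u * z).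
    by ring.
  by rewrite /q E3 E2 E1 swap.
have Ez (F : T -> R) : (forall w, F w = 0) -> \int[P]_w F w = 0.
  by move=> F0; under eq_Rintegral do rewrite F0; exact: ERcst.
(* The sums of [stein_local] run over all graphs on n vertices; those that are not copies of [G]
   contribute 0. *)
have q0 a b c : ~~ [&& a \in C, b \in C & c \in C] -> q a b c = 0.
  rewrite qE !negb_and => /or3P[aC|bC|cC].
  - rewrite !(Ez (fun w => `|Y a w * Y b w|)) ?(Ez (fun w => `|Y a w * Y b w * Y c w|))
      ?mul0r ?addr0 ?mulr0//.
      by move=> w; rewrite Yout// !mul0r normr0.
    by move=> w; rewrite Yout// !mul0r normr0.
  - rewrite !(Ez (fun w => `|Y a w * Y b w|)) ?(Ez (fun w => `|Y a w * Y b w * Y c w|))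
      ?mul0r ?addr0 ?mulr0//.
      by move=> w; rewrite (Yout _ bC) mulr0 mul0r normr0.
    by move=> w; rewrite (Yout _ bC) mulr0 normr0.
  - rewrite !(Ez (fun w => `|Y c w|)) ?(Ez (fun w => `|Y a w * Y b w * Y c w|)) ?mulr0 ?addr0 ?mulr0//.
      by move=> w; rewrite (Yout _ cC) mulr0 normr0.
    by move=> w; rewrite (Yout _ cC) normr0.
have qle a b c : a \in C -> b \in C -> c \in C ->
    q a b c <= (16 * (e%:R ^+ 3 * mom 3) / s ^+ 3) *
       p ^+ #|(eset a :|: eset b :|: eset c)%SET|.
  move=> aC bC cC; rewrite qE.
  have swap (k t z : R) : 16 * k / t * z = t^-1 * (16 * (z * k)) by ring.
  rewrite swap -exprVn.
  by rewrite ler_wpM2l ?exprn_ge0 ?invr_ge0 ?(ltW s0)//; exact: YYY.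
rewrite (_ : _ / s ^+ 3 = (16 * (e%:R ^+ 3 * mom 3) / s ^+ 3) * triple_sum); last by rewrite mulrAC.
rewrite /triple_sum -/(q _ _ _).
rewrite [leLHS](bigID (mem C))/= [X in _ + X <= _]big1 ?addr0; last first.
  move=> a aC; rewrite big1// => b _; rewrite big1// => c _.
  by apply: q0; rewrite (negbTE aC).
rewrite mulr_sumr; apply: ler_sum => a aC.
rewrite [leLHS](bigID (mem C))/= [X in _ + X <= _]big1 ?addr0; last first.
  move=> b /andP[_ bC]; rewrite big1// => c _.
  by apply: q0; rewrite (negbTE bC) andbF.
rewrite mulr_sumr [leLHS](eq_bigl (fun b => (b \in C) && share a b)); last by move=> b; rewrite andbC.
apply: ler_sum => b /andP[bC _].
rewrite [leLHS](bigID (mem C))/= [X in _ + X <= _]big1 ?addr0; last first.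
  move=> c /andP[_ cC].
  by apply: q0; rewrite (negbTE cC) !andbF.
rewrite mulr_sumr [leLHS](eq_bigl (fun c => (c \in C) && (share a c || share b c))); last first.
  by move=> c; rewrite andbC.
by apply: ler_sum => c /andP[cC _]; exact: qle.
Qed.

End normal_approximation.

End weighted_model.

(** * Rates in the Wasserstein distance *)

Section wasserstein_bounds.
Variables (R : realType) (d : measure_display) (T : measurableType d) (P : probability T R).
Local Notation intg F := (P.-integrable [set: T] (EFin \o F)).

Lemma expectation_Rintegral (F : T -> R) : intg F -> ('E_P[F] = (\int[P]_w F w)%:E)%E.
Proof. by move=> iF; rewrite unlock fineK//; exact: integrable_fin_num. Qed.

Lemma intg_lipschitz (h : R -> R) (Y : T -> R) : (forall x y, `|h x - h y| <= `|x - y|) ->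
  intg Y -> intg (h \o Y).
Proof.
move=> hL iY; apply: (@intg_le _ _ _ _ _ (fun w => `|Y w| + `|h 0|)).
- apply: measurableT_comp; last by apply/measurable_EFinP; exact: measurable_int iY.
  by apply/measurable_EFinP; exact: measurable_int (integrable_lipschitz_normal hL).
- move=> w /=; have -> : h (Y w) = (h (Y w) - h 0) + h 0 by rewrite subrK.
  by rewrite (le_trans (ler_normD _ _))// lerD2r (le_trans (hL _ _))// subr0.
- by apply: intgD; [exact: intg_norm|exact: intg_cst].
Qed.

Lemma wasserstein_normal_le (Y : T -> R) (B : R) : intg Y ->
  (forall h : R -> R, (forall x y, `|h x - h y| <= `|x - y|) ->
     `|\int[P]_w h (Y w) - \int[normal_prob (0 : R) 1]_x h x| <= B) ->
  (wasserstein P Y (normal_prob (0 : R) 1) idfun <= B%:E)%E.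
Proof.
move=> iY hB; apply: ge_ereal_sup => _ [h /= hlip <-].
have hL x y : `|h x - h y| <= `|x - y|.
  by have := hlip (x, y); rewrite /= mul1r; apply; split.
rewrite (expectation_Rintegral (intg_lipschitz hL iY)).
rewrite [X in (_ - X)%E](_ : _ = (\int[normal_prob (0 : R) 1]_x h x)%:E); last first.
  by rewrite unlock fineK//; exact: integrable_fin_num (integrable_lipschitz_normal hL).
by rewrite lee_fin; exact: hB.
Qed.

(** Both laws are compared with the point mass at 0. The bound gives finiteness of the distance and
    settles the case of too few vertices. *)
Lemma wasserstein_normal_mean (Y : T -> R) : intg Y ->
  (wasserstein P Y (normal_prob (0 : R) 1) idfun <=
     (\int[P]_w `|Y w| + \int[normal_prob (0 : R) 1]_x `|x|)%:E)%E.
Proof.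
move=> iY; apply: wasserstein_normal_le => // h hL.
set N := normal_prob _ _.
have -> : \int[P]_w h (Y w) - \int[N]_x h x =
    \int[P]_w (h (Y w) - h 0) - (\int[N]_x h x - h 0).
  have ih := intg_lipschitz hL iY; have ic := intg_cst P (h 0).
  by rewrite (RintegralB measurableT ih ic) ERcst; ring.
rewrite (le_trans (ler_normB _ _))// lerD//; last exact: dist_lipschitz_normal.
have ihB : intg (fun w => h (Y w) - h 0).
  by apply: intgB; [exact: (intg_lipschitz hL iY)|exact: intg_cst].
rewrite (le_trans (ER_norm ihB))//.
apply: ER_le; [exact: intg_norm|exact: intg_norm|move=> w].
by rewrite (le_trans (hL _ _))// subr0.
Qed.

Lemma variance_Rintegral (X : T -> R) : intg X -> intg (fun w => X w ^+ 2) ->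
  ('V_P[X] = (\int[P]_w X w ^+ 2 - (\int[P]_w X w) ^+ 2)%:E)%E.
Proof.
move=> iX iX2; rewrite /variance unlock (expectation_Rintegral iX)/=.
set m := \int[P]_w X w.
rewrite [X in expectation _ X](_ : _ = (fun w => (X w ^+ 2 - 2 * m * X w) + m ^+ 2)); last first.
  by apply/funext => w /=; rewrite !fctE /=; ring.
have i1 := intgZ (2 * m) iX; have i2 := intgB iX2 i1; have i3 := intg_cst P (m ^+ 2).
rewrite (expectation_Rintegral (intgD i2 i3)); congr (_%:E).
rewrite (RintegralD measurableT i2 i3) (RintegralB measurableT iX2 i1) (ERZ _ iX) ERcst -/m.
by ring.
Qed.

Lemma fine_variance (X : T -> R) :
  fine 'V_P[X]%E = \int[P]_w (X w - fine 'E_P[X]%E) ^+ 2.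
Proof.
by rewrite /variance !unlock /Rintegral; congr fine.
Qed.

Lemma fine_expectation (X : T -> R) : fine 'E_P[X]%E = \int[P]_w X w.
Proof. by rewrite unlock. Qed.

End wasserstein_bounds.

(** The cube of sqrt(tv) is tv sqrt(tv): the first factor is bounded through [A], the second through
    [b * m2]. Then sqrt(m2) cancels against the bound on [m3], all powers of [N] cancel, and
    phi^(3/2) / phi^2 leaves one factor sqrt(phi) in the denominator. *)
Lemma stein_ratio_le (R : realType) (tv A b m2 m3 q k N phi del K TS : R) :
  0 < A -> 0 < b -> 0 < m2 -> 0 < k -> 0 < N -> 0 < phi -> 0 < del -> 0 <= m3 -> 0 <= TS ->
  A * (k * N ^+ 2 / phi) <= tv -> b * m2 * (k * N ^+ 2 / phi) <= tv ->
  m3 <= Num.sqrt m2 * q -> TS <= K * N ^+ 3 / (del * phi) ^+ 2 ->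
  m3 * TS / Num.sqrt tv ^+ 3 <=
    K / (k * Num.sqrt k) / del ^+ 2 * (q / (A * Num.sqrt b * Num.sqrt phi)).
Proof.
move=> A0 b0 m20 k0 N0 phi0 del0 m30 TS0 h1 h2 hm hT.
have u0 : 0 < k * N ^+ 2 / phi by rewrite divr_gt0// mulr_gt0// exprn_gt0.
have tv0 : 0 < tv by apply: lt_le_trans h1; rewrite mulr_gt0.
pose D := A * (k * N ^+ 2 / phi) * (Num.sqrt b * Num.sqrt m2 * Num.sqrt k * N / Num.sqrt phi).
have sD : Num.sqrt (b * m2 * (k * N ^+ 2 / phi)) =
    Num.sqrt b * Num.sqrt m2 * Num.sqrt k * N / Num.sqrt phi.
  rewrite [X in Num.sqrt X](_ : _ = (Num.sqrt b * Num.sqrt m2 * Num.sqrt k * N / Num.sqrt phi) ^+ 2).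
    by rewrite sqrtr_sqr ger0_norm// !mulr_ge0// ?invr_ge0 ?sqrtr_ge0// ltW.
  rewrite !exprMn exprVn !sqr_sqrtr ?(ltW b0) ?(ltW m20) ?(ltW k0) ?(ltW phi0)//.
  by rewrite !mulrA.
have D0 : 0 < D by rewrite !mulr_gt0// ?invr_gt0 ?sqrtr_gt0 ?exprn_gt0.
have Dtv : D <= Num.sqrt tv ^+ 3.
  rewrite exprSr sqr_sqrtr ?(ltW tv0)// /D -sD; apply: ler_pM => //.
    by rewrite mulr_ge0 ?(ltW A0) ?(ltW u0).
  exact: ler_wsqrtr.
apply: (@le_trans _ _ ((Num.sqrt m2 * q) * (K * N ^+ 3 / (del * phi) ^+ 2) / D)).
  apply: ler_pM; rewrite ?mulr_ge0 ?invr_ge0 ?exprn_ge0 ?sqrtr_ge0//; first exact: ler_pM.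
  by rewrite lef_pV2// posrE// exprn_gt0// sqrtr_gt0.
have sq (x : R) : 0 < x -> exists2 y : R, 0 < y & (x = y ^+ 2) /\ Num.sqrt x = y.
  move=> x0; exists (Num.sqrt x); first by rewrite sqrtr_gt0.
  by rewrite sqr_sqrtr// ltW.
rewrite /D; have [f f0 [-> ->]] := sq _ phi0; have [g g0 [-> ->]] := sq _ k0.
have := b0; rewrite -sqrtr_gt0; move: (Num.sqrt b) => t t0.
have := m20; rewrite -sqrtr_gt0; move: (Num.sqrt m2) => s s0.
rewrite le_eqVlt; apply/orP; left; apply/eqP; field.
by rewrite !lt0r_neq0.
Qed.

(** * Moment inequalities for the weight *)

Section moments.
Variables (R : realType) (d : measure_display) (T : measurableType d) (P : probability T R).
Variable X : T -> R.
Local Notation intg F := (P.-integrable [set: T] (EFin \o F)).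
Hypotheses (X0 : forall s, 0 <= X s) (mX : measurable_fun setT X).

Lemma intg_expectation (F : T -> R) : measurable_fun setT F -> (forall s, 0 <= F s) ->
  ('E_P[F] < +oo)%E -> intg F.
Proof.
move=> mF F0 EF; apply/integrableP; split; first exact/measurable_EFinP.
move: EF; rewrite unlock; congr (_ < _)%E; apply: eq_integral => s _.
by rewrite /= ger0_norm.
Qed.

Lemma intg_pow_le k l : (k <= l)%N -> intg (fun s => X s ^+ l) -> intg (fun s => X s ^+ k).
Proof.
move=> kl il; apply: (@intg_le _ _ _ _ _ (fun s => 1 + X s ^+ l)).
- exact: measurable_funX.
- move=> s; rewrite ger0_norm ?exprn_ge0//; have [x1|x1] := leP (X s) 1.
    by rewrite (le_trans (exprn_ile1 _ (X0 s) x1))// lerDl exprn_ge0.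
  by rewrite (le_trans (ler_weXn2l (ltW x1) kl))// lerDr.
- by apply: intgD => //; exact: intg_cst.
Qed.

Local Notation mom k := (\int[P]_s X s ^+ k).

Hypothesis i4 : intg (fun s => X s ^+ 4).
Let i2 := intg_pow_le (isT : (2 <= 4)%N) i4.
Let i3 := intg_pow_le (isT : (3 <= 4)%N) i4.

Lemma mom2_sqr_le : mom 2 ^+ 2 <= mom 4.
Proof.
set m := mom 2.
have j2 := intgZ (2 * m) i2; have jc := intg_cst P (m ^+ 2).
have : \int[P]_s (2 * m * X s ^+ 2 - m ^+ 2) <= mom 4.
  apply: ER_le => //; first exact: intgB.
  move=> s; rewrite -subr_ge0 (_ : _ - _ = (X s ^+ 2 - m) ^+ 2) ?sqr_ge0//; ring.
rewrite (RintegralB measurableT j2 jc) ERcst (ERZ _ i2) -/m.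
by rewrite (_ : _ - _ = m ^+ 2)//; ring.
Qed.

(** Cauchy-Schwarz for X and X^2, from the nonnegativity of (b X - a X^2)^2 with a^2 = E[X^2] and
    b^2 = E[X^4]. *)
Lemma mom3_le : 0 < mom 2 -> mom 3 <= Num.sqrt (mom 2) * Num.sqrt (mom 4).
Proof.
move=> m20.
have m40 : 0 < mom 4 by apply: lt_le_trans mom2_sqr_le; rewrite exprn_gt0.
have a0 : 0 < Num.sqrt (mom 2) by rewrite sqrtr_gt0.
have b0 : 0 < Num.sqrt (mom 4) by rewrite sqrtr_gt0.
have a2 := sqr_sqrtr (ltW m20); have b2 := sqr_sqrtr (ltW m40).
move: a0 b0 a2 b2; move: (Num.sqrt (mom 2)) (Num.sqrt (mom 4)) => a b a0 b0 a2 b2.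
have j2 := intgZ (b ^+ 2) i2; have j3 := intgZ (2 * (a * b)) i3; have j4 := intgZ (a ^+ 2) i4.
have : \int[P]_s (2 * (a * b) * X s ^+ 3) <= \int[P]_s (b ^+ 2 * X s ^+ 2 + a ^+ 2 * X s ^+ 4).
  apply: ER_le => //; first exact: intgD.
  move=> s; rewrite -subr_ge0 (_ : _ - _ = (b * X s - a * X s ^+ 2) ^+ 2) ?sqr_ge0//; ring.
rewrite (RintegralD measurableT j2 j4) (ERZ _ i2) (ERZ _ i3) (ERZ _ i4) -a2 -b2.
rewrite (_ : _ + _ = 2 * (a * b) * (a * b)); last by ring.
by rewrite ler_pM2l// !mulr_gt0.
Qed.

End moments.

(* Since 0^-1 = +oo in \bar R, the right-hand side is infinite when E4 = +oo or v = 0. *)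
Lemma lt_ereal_bound (R : realType) (W E4 : \bar R) (C a v : R) :
  0 <= C -> 0 < a -> 0 <= v -> (0 < E4)%E -> (W < +oo)%E ->
  ((E4 < +oo)%E -> 0 < v -> (W <= (C * (Num.sqrt (fine E4) / (a * v)))%:E)%E) ->
  (W < (C + 1)%:E * (sqrte E4 / (a%:E * v%:E)))%E.
Proof.
move=> C0 a0 v0 E40 Wy hW.
have C1 : (0 < (C + 1)%:E)%E by rewrite lte_fin ltr_wpDl.
have [E4y|E4fin] := eqVneq E4 +oo%E.
  have inv0 : (0 < (a%:E * v%:E)^-1)%E.
    rewrite -EFinM inver; case: ifPn => // av0.
    by rewrite lte_fin invr_gt0 lt0r av0 mulr_ge0// ltW.
  by rewrite E4y /= gt0_mulye// gt0_muley.
have E4r : E4 = (fine E4)%:E by rewrite fineK// fin_numElt (lt_trans _ E40) ?ltey.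
have e0 : 0 < fine E4 by rewrite -lte_fin -E4r.
have q0 : 0 < Num.sqrt (fine E4) by rewrite sqrtr_gt0.
move: hW; rewrite E4r/= ltry => /(_ isT) hW.
have [v00|v1] := eqVneq v 0.
  by rewrite v00 mule0 inve0 gt0_muley ?lte_fin// gt0_muley.
have vp : 0 < v by rewrite lt0r v1.
apply: (le_lt_trans (hW vp)).
rewrite -EFinM inver mulf_eq0 (gt_eqF a0) (gt_eqF vp)/= -!EFinM lte_fin.
by rewrite ltr_pM2r ?ltrDl// divr_gt0// mulr_gt0.
Qed.

(** * The bounds in the three regimes *)

Section weighted_random_graph.
Variables (R : realType) (V : finType) (G : graph V).
Variables (dS : measure_display) (S : measurableType dS) (Q : probability S R)
  (X : {RV Q >-> R}) (n : nat) (p : R)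
  (d : measure_display) (T : measurableType d) (P : probability T R)
  (GG : T -> graph 'I_n) (Xe : {set 'I_n} -> {RV P >-> R}).
Hypotheses (classG : class_B G) (isoG : no_isolated G).
Hypothesis n0 : (0 < n)%N.
Hypothesis p01 : 0 < p < 1.
Hypothesis X0 : forall s, 0 <= X s.
Hypothesis model : weighted_Gnp X p GG Xe.
Local Notation intg F := (P.-integrable [set: T] (EFin \o F)).
Local Notation intgQ F := (Q.-integrable [set: S] (EFin \o F)).
Local Notation v := (nv G).
Local Notation e := (ne G).
Local Notation W := (subgraph_weight G GG Xe).
Local Notation mom k := (\int[Q]_s X s ^+ k).
Local Notation var := (mom 2 - (\int[Q]_s X s) ^+ 2).
Local Notation dW := (wasserstein P (renormalized P W) (normal_prob (0 : R) 1) idfun).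
Local Notation normal_mean := (\int[normal_prob (0 : R) 1]_x `|x|).

Let v3 : (3 <= v)%N. Proof. by case: classG. Qed.
Let e2 : (2 <= e)%N. Proof. exact: no_isolated_ne. Qed.
Let v1 : (1 <= v)%N. Proof. exact: leq_trans v3. Qed.
Let e1 : (1 <= e)%N. Proof. exact: leq_trans e2. Qed.
Let p0 : 0 < p. Proof. by case/andP: p01. Qed.
Let p1 : p < 1. Proof. by case/andP: p01. Qed.
Let p01' : 0 < p <= 1. Proof. by rewrite p0 ltW. Qed.

Lemma intg_subgraph_weight : intgQ X -> intg W.
Proof.
move=> iX; have -> : W = (fun w => \sum_(a in copies G n) copy_weight GG Xe a w).
  by apply/funext => w; exact: (subgraph_weightE model).
by apply: intg_sum => a _; have [] := copy_weight_mean model a iX.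
Qed.

Lemma intg_renormalized : intg W -> intg (renormalized P W).
Proof.
move=> iW; set b := (Num.sqrt (fine 'V_P[W]%E))^-1.
rewrite (_ : renormalized P W = (fun w => b * (W w - fine 'E_P[W]%E))).
  by apply: intgZ; apply: intgB => //; exact: intg_cst.
by apply/funext => w; rewrite /renormalized mulrC.
Qed.

Lemma wasserstein_lty : intgQ X -> (dW < +oo)%E.
Proof.
move=> iX; apply: le_lt_trans (ltry _).
exact: (wasserstein_normal_mean (intg_renormalized (intg_subgraph_weight iX))).
Qed.

(** K_n contains no copy, so the renormalised weight is 0/0, which is 0 by convention. *)
Lemma wasserstein_few_vertices : (n < v)%N -> (dW <= normal_mean%:E)%E.
Proof.
move=> nv_lt; have W0 w : W w = 0.
  rewrite /subgraph_weight big1// => H /iso_nv nvH.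
  have : (nv H <= n)%N by rewrite (leq_trans (max_card _))// card_ord.
  by rewrite nvH leqNgt nv_lt.
have E0 : fine 'E_P[W]%E = 0.
  by rewrite fine_expectation; under eq_Rintegral do rewrite W0; exact: ERcst.
have -> : renormalized P W = (fun=> 0).
  by apply/funext => w; rewrite /renormalized E0 W0 subrr mul0r.
have := wasserstein_normal_mean (intg_cst P 0).
by under eq_Rintegral do rewrite normr0; rewrite ERcst add0r.
Qed.

Local Notation pairs :=
  (\sum_(a in copies G n) \sum_(b in copies G n | share a b) p ^+ #|(eset a :|: eset b)%SET|).
Local Notation kappa := (((v ^ v)%:R : R) ^- 2).
Local Notation Ktriple := ((((2 * v).+1 ^ v)%:R : R) ^+ 2).
Local Notation size := (n%:R ^+ v * p ^+ e).
Local Notation tv := (total_variance GG Xe G).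

Lemma wasserstein_stein (L : R) : stein_bound L -> intgQ (fun s => X s ^+ 4) -> 0 < tv ->
  (dW <= (2 * L * (16 * (e%:R ^+ 3 * mom 3) * triple_sum n p G / Num.sqrt tv ^+ 3))%:E)%E.
Proof.
move=> hstein i4 tv0.
have iX k : (k <= 3)%N -> intgQ (fun s => `|X s| ^+ k).
  move=> k3; rewrite (_ : (fun s => `|X s| ^+ k) = (fun s => X s ^+ k)).
    by apply: (intg_pow_le X0 _ _ i4) => //; exact: leq_trans k3 _.
  by apply/funext => s; rewrite ger0_norm.
have iX1 : intgQ X by exact: (intg_pow_le X0 _ (isT : (1 <= 4)%N) i4).
apply: wasserstein_normal_le.
  exact: (intg_renormalized (intg_subgraph_weight iX1)).
move=> h hL; have [f [f' [df f'E fL f'L]]] := hstein h hL.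
have -> : (fun w => h (renormalized P W w)) =
    (fun w => h ((W w - \int[P]_w W w) / Num.sqrt tv)).
  apply/funext => w; rewrite /renormalized fine_variance fine_expectation.
  by rewrite (variance_subgraph_weight model G X0 iX).
have := normal_approximation model p01 X0 iX tv0 hL df f'E fL f'L.
rewrite (_ : \int[Q]_s `|X s| ^+ 3 = mom 3)//.
by under eq_Rintegral do rewrite ger0_norm//.
Qed.

(** [phi] is the scale attained by the pair sum and visible in the rate; [del] is the loss in the
    minimum of n^|U| p^|F|, namely c^e for p > c and 1 otherwise. The constant 32 is 2 from
    [stein_local] times 16 from the third moments. *)
Lemma wasserstein_ratio (L A b phi del : R) : stein_bound L -> 0 < L ->
  intgQ (fun s => X s ^+ 4) ->
  0 < mom 2 -> 0 < A -> 0 < b -> 0 < phi -> 0 < del ->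
  A <= Num.max var ((1 - p) * mom 2) -> b <= 1 - p ->
  kappa * size ^+ 2 / phi <= pairs ->
  (forall (H : graph 'I_n) (B : {set 'I_n}) (F : {set {set 'I_n}}), H \in copies G n ->
     B \subset vset H -> F \subset eset H -> (forall f : {set 'I_n}, f \in F -> f \subset B) ->
     F != finset.set0 -> del * phi <= n%:R ^+ #|B| * p ^+ #|F|) ->
  (dW <= (32 * L * e%:R ^+ 3 * (Ktriple / (kappa * Num.sqrt kappa)) / del ^+ 2 *
     (Num.sqrt (mom 4) / (A * Num.sqrt b * Num.sqrt phi)))%:E)%E.
Proof.
move=> hstein L0 i4 m20 A0 b0 phi0 del0 hA hb hpairs hpsi.
have iX k : (k <= 3)%N -> intgQ (fun s => `|X s| ^+ k).
  move=> k3; rewrite (_ : (fun s => `|X s| ^+ k) = (fun s => X s ^+ k)).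
    by apply: (intg_pow_le X0 _ _ i4) => //; exact: leq_trans k3 _.
  by apply/funext => s; rewrite ger0_norm.
have mX : measurable_fun setT X by exact: measurable_funP.
have size0 : 0 < size by rewrite mulr_gt0// exprn_gt0// ltr0n.
have kappa0 : 0 < kappa by rewrite invr_gt0 exprn_gt0// ltr0n expn_gt0 v1.
have u0 : 0 < kappa * size ^+ 2 / phi by rewrite divr_gt0// mulr_gt0// exprn_gt0.
have tvge := total_variance_ge model p01 e1 X0 iX.
have max0 : 0 <= Num.max var ((1 - p) * mom 2) by exact: le_trans (ltW A0) hA.
have tv1 : A * (kappa * size ^+ 2 / phi) <= tv.
  apply: le_trans tvge; apply: ler_pM => //; exact: ltW.
have tv2 : b * mom 2 * (kappa * size ^+ 2 / phi) <= tv.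
  apply: le_trans tvge; apply: ler_pM => //; [by rewrite mulr_ge0// ltW|exact: ltW|].
  by rewrite le_max ler_wpM2r ?orbT// ltW.
have tv0 : 0 < tv by apply: lt_le_trans tv1; rewrite mulr_gt0.
apply: (le_trans (wasserstein_stein hstein i4 tv0)); rewrite lee_fin.
have triple0 : 0 <= triple_sum n p G.
  apply: sumr_ge0 => a _; apply: sumr_ge0 => b' _; apply: sumr_ge0 => c _.
  by rewrite exprn_ge0// ltW.
have := stein_ratio_le A0 b0 m20 kappa0 size0 phi0 del0 _ triple0 tv1 tv2
  (mom3_le X0 mX i4 m20) (triple_sum_le n0 p01' (mulr_gt0 del0 phi0) hpsi).
have m30 : 0 <= mom 3 by apply: ER_ge0 => s; rewrite exprn_ge0.
move=> /(_ m30); move: (_ / (_ * Num.sqrt phi)) => x.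
have e30 : 0 <= 32 * L * (e%:R ^+ 3) by rewrite !mulr_ge0// ltW.
move: (_ / (kappa * _)) => K /(ler_wpM2l e30) H.
rewrite [leRHS](_ : _ = 32 * L * e%:R ^+ 3 * (K / del ^+ 2 * x)); last by rewrite !mulrA.
apply: le_trans H; rewrite le_eqVlt; apply/orP; left; apply/eqP.
move: (e%:R ^+ 3) (mom 3) (triple_sum n p G) (Num.sqrt tv ^+ 3)^-1 => x1 x2 x3 x4.
ring.
Qed.

Definition stein_constant (L : R) := 32 * L * e%:R ^+ 3 * (Ktriple / (kappa * Num.sqrt kappa)).
(* The three terms serve the regimes p <= c', p > c and n < nv G. *)
Definition rate_constant (L c c' : R) :=
  stein_constant L / ((1 - c') * Num.sqrt (1 - c')) + stein_constant L / (c ^+ e) ^+ 2 +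
  normal_mean * (v ^ v)%:R.

Section rates.
Variables L c c' : R.
Hypotheses (hstein : stein_bound L) (L0 : 0 < L) (c01 : 0 < c < 1) (c'1 : c' < 1).
Hypothesis EX2 : (0 < 'E_Q[fun s => (X s ^+ 2)%R] < +oo)%E.
Local Notation EX4 := ('E_Q[fun s => (X s ^+ 4)%R])%E.
Local Notation q := (Num.sqrt (mom 4)).

Let c0 : 0 < c. Proof. by case/andP: c01. Qed.
Let c1 : 0 < 1 - c'. Proof. by rewrite subr_gt0. Qed.
Let mX : measurable_fun setT X. Proof. exact: measurable_funP. Qed.

Let i2 : intgQ (fun s => X s ^+ 2).
Proof.
case/andP: EX2 => _; apply: intg_expectation; first exact: measurable_funX.
by move=> s; exact: sqr_ge0.
Qed.

Let i1 : intgQ X. Proof. exact: (intg_pow_le X0 mX (isT : (1 <= 2)%N) i2). Qed.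

Let i4 : (EX4 < +oo)%E -> intgQ (fun s => X s ^+ 4).
Proof.
apply: intg_expectation; first exact: measurable_funX.
by move=> s; rewrite exprn_ge0.
Qed.

Let EX2E : ('E_Q[fun s => (X s ^+ 2)%R] = (mom 2)%:E)%E.
Proof. exact: expectation_Rintegral. Qed.

Let m20 : 0 < mom 2.
Proof. by rewrite -lte_fin -EX2E; case/andP: EX2. Qed.

Let EX40 : (0 < EX4)%E.
Proof.
have [E|E] := eqVneq EX4 +oo%E; first by rewrite E.
have j4 : intgQ (fun s => X s ^+ 4) by apply: i4; rewrite ltey.
rewrite (expectation_Rintegral j4) lte_fin.
by apply: lt_le_trans (mom2_sqr_le X0 mX j4); rewrite exprn_gt0.
Qed.

Let normal_mean0 : 0 <= normal_mean. Proof. exact: ER_ge0. Qed.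

Let stein_constant0 : 0 <= stein_constant L.
Proof.
by rewrite !mulr_ge0 ?invr_ge0 ?(ltW L0) ?exprn_ge0 ?mulr_ge0 ?sqrtr_ge0.
Qed.

Let dense0 : 0 <= stein_constant L / (c ^+ e) ^+ 2.
Proof. by rewrite divr_ge0// sqr_ge0. Qed.

Let sparse0 : 0 <= stein_constant L / ((1 - c') * Num.sqrt (1 - c')).
Proof. by rewrite divr_ge0// mulr_ge0 ?sqrtr_ge0// ltW. Qed.

Let few0 : 0 <= normal_mean * (v ^ v)%:R.
Proof. by rewrite mulr_ge0. Qed.

Lemma rate_constant_ge0 : 0 <= rate_constant L c c'.
Proof. by rewrite !addr_ge0. Qed.

(** For n < v the distance is at most E|N|, and the right-hand side is large enough: y <= E[X^2] <=
    sqrt(E[X^4]) and a <= v^v make v^v sqrt(E[X^4]) / (a y) at least 1. *)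
Lemma rate_lt (a y K : R) : 0 < a -> 0 <= y <= mom 2 -> K <= rate_constant L c c' ->
  ((n < v)%N -> a <= (v ^ v)%:R) ->
  ((v <= n)%N -> 0 < y -> intgQ (fun s => X s ^+ 4) -> (dW <= (K * (q / (a * y)))%:E)%E) ->
  (dW < (rate_constant L c c' + 1)%:E * (sqrte EX4 / (a%:E * y%:E)))%E.
Proof.
move=> a0 /andP[y0 ym] Kc few many.
apply: lt_ereal_bound => //; first exact: rate_constant_ge0.
  exact: wasserstein_lty.
move=> E4 yp; rewrite fine_expectation.
have j4 := i4 E4; have [nv_lt|nv_ge] := ltnP n v; last first.
  apply: (le_trans (many nv_ge yp j4)); rewrite lee_fin ler_wpM2r//.
  by rewrite divr_ge0 ?sqrtr_ge0// mulr_ge0// ltW.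
apply: (le_trans (wasserstein_few_vertices nv_lt)); rewrite lee_fin.
apply: (@le_trans _ _ (normal_mean * (v ^ v)%:R * (1 / a))).
  rewrite -mulrA ler_peMr// mul1r ler_pdivlMr// mul1r.
  exact: few.
apply: ler_pM => //; first by rewrite mul1r invr_ge0 ltW.
  by rewrite /rate_constant lerDr addr_ge0.
rewrite invfM mulrCA mul1r ler_peMr ?invr_ge0 ?(ltW a0)//.
rewrite ler_pdivlMr// mul1r (le_trans ym)//.
rewrite -[leLHS](ger0_norm (ltW m20)) -sqrtr_sqr ler_wsqrtr//.
exact: (mom2_sqr_le X0 mX j4).
Qed.

Let n1 : (1 : R) <= n%:R. Proof. by rewrite ler1n. Qed.
Let nR0 : (0 : R) < n%:R. Proof. by rewrite ltr0n. Qed.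

Let vertex_le : (n < v)%N -> (n%:R : R) <= (v ^ v)%:R.
Proof.
by move=> nv; rewrite ler_nat (leq_trans (ltnW nv))// -[leqLHS]expn1 leq_pexp2l.
Qed.

Let copies_density (H : graph 'I_n) (B : {set 'I_n}) (F : {set {set 'I_n}}) :
  H \in copies G n -> B \subset vset H -> F \subset eset H ->
  (forall f : {set 'I_n}, f \in F -> f \subset B) -> F != finset.set0 ->
  [/\ (1 < #|B|)%N, (#|B| <= v)%N, (0 < #|F|)%N, (#|F| <= e)%N &
    ((#|F| - 1) * (v - 2) <= (e - 1) * (#|B| - 2))%N].
Proof.
rewrite finset.inE => isoH BH FH FB Fne.
have [B1 dens] := iso_density isoH classG BH FH FB Fne.
split=> //.
- by rewrite -(iso_nv isoH) subset_leq_card.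
- by rewrite card_gt0.
- by rewrite -(iso_ne isoH) subset_leq_card.
Qed.

(** [wasserstein_ratio] with A = Var X, b = 1 - p, phi = n^2 and del = c^e. A nonempty set of f
    edges on u vertices has u >= 2 and f <= e, so n^u p^f >= c^e n^2. *)
Lemma rate_dense : c < p ->
  (dW < (rate_constant L c c' + 1)%:E * (sqrte EX4 / ((n%:R * Num.sqrt (1 - p))%:E * 'V_Q[X])))%E.
Proof.
move=> cp; rewrite (variance_Rintegral i1 i2).
have a0 : 0 < Num.sqrt (1 - p) by rewrite sqrtr_gt0 subr_gt0.
apply: (@rate_lt _ _ (stein_constant L / (c ^+ e) ^+ 2)).
- by rewrite mulr_gt0.
- rewrite -lee_fin -(variance_Rintegral i1 i2) variance_ge0/=.
  by rewrite gerBl sqr_ge0.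
- by rewrite /rate_constant -addrA addrCA lerDl addr_ge0.
- move=> nv_lt; apply: le_trans (vertex_le nv_lt); rewrite ler_piMr ?(ltW nR0)//.
  by rewrite -[leRHS]sqrtr1 ler_wsqrtr// gerBl ltW.
move=> nv_ge y0 j4.
have ce0 : 0 < c ^+ e by rewrite exprn_gt0.
have n20 : (0 : R) < n%:R ^+ 2 by rewrite exprn_gt0.
have := wasserstein_ratio hstein L0 j4 m20 y0 _ n20 ce0.
move=> /(_ (1 - p)); rewrite subr_gt0 => /(_ p1) H.
rewrite [X in (_ <= X%:E)%E](_ : _ = stein_constant L / (c ^+ e) ^+ 2 *
   (q / (var * Num.sqrt (1 - p) * Num.sqrt (n%:R ^+ 2)))); last first.
  rewrite sqrtr_sqr (gtr0_norm nR0); congr (_ * (_ / _)).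
  by rewrite mulrC (mulrC n%:R) mulrA.
apply: H => //.
- by rewrite le_max lexx.
- apply: (le_trans _ (pair_sum_ge_edge n0 p01' nv_ge e1 v1)).
  rewrite ler_wpM2l//; first by rewrite mulr_ge0 ?invr_ge0 ?sqr_ge0// exprn_ge0.
  by rewrite lef_pV2 ?posrE ?mulr_gt0// ler_piMr ?(ltW n20) ?(ltW p1).
move=> H' B F HC BH FH FB Fne.
have [B1 Bv F0 Fe _] := copies_density HC BH FH FB Fne.
rewrite mulrC; apply: ler_pM; rewrite ?exprn_ge0 ?(ltW c0)//.
  by rewrite ler_weXn2l.
apply: (@le_trans _ _ (c ^+ #|F|)).
  by rewrite ler_wiXn2l// ltW//; case/andP: c01.
by rewrite lerXn2r// ?nnegrE ltW.
Qed.

(** Covers both regimes below c: [phi] is n^2 p or n^v p^e. Bounding 1 - p below by 1 - c' costs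
    only the constant and removes 1 - p from the rate. *)
Lemma rate_sparse (phi : R) : 0 < phi -> ((v <= n)%N -> p <= c') ->
  ((n < v)%N -> Num.sqrt phi <= (v ^ v)%:R) ->
  ((v <= n)%N -> kappa * size ^+ 2 / phi <= pairs) ->
  (forall u f : nat, (1 < u)%N -> (u <= v)%N -> (0 < f)%N ->
     ((f - 1) * (v - 2) <= (e - 1) * (u - 2))%N -> phi <= n%:R ^+ u * p ^+ f) ->
  (dW < (rate_constant L c c' + 1)%:E *
     (sqrte EX4 / ((Num.sqrt phi)%:E * 'E_Q[fun s => (X s ^+ 2)%R])))%E.
Proof.
move=> phi0 pc few hpairs hphi; rewrite EX2E.
have sphi0 : 0 < Num.sqrt phi by rewrite sqrtr_gt0.
apply: (@rate_lt _ _ (stein_constant L / ((1 - c') * Num.sqrt (1 - c')))) => //.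
- by rewrite lexx ltW.
- by rewrite /rate_constant -addrA lerDl addr_ge0.
move=> nv_ge _ j4.
have A0 : 0 < (1 - c') * mom 2 by rewrite mulr_gt0.
have H := wasserstein_ratio hstein L0 j4 m20 A0 c1 phi0 ltr01.
rewrite [X in (_ <= X%:E)%E](_ : _ = stein_constant L / 1 ^+ 2 *
   (q / ((1 - c') * mom 2 * Num.sqrt (1 - c') * Num.sqrt phi))); last first.
  have swap (k x y m z t : R) : k / (x * y) * (z / (t * m)) = k * (z / (x * m * y * t)).
    by rewrite !invfM; ring.
  by rewrite expr1n invr1 mulr1 swap.
have pc1 : 1 - c' <= 1 - p by rewrite lerB// pc.
apply: H => //.
- by rewrite le_max ler_wpM2r ?orbT// ltW.
- exact: hpairs.
move=> H' B F HC BH FH FB Fne; rewrite mul1r.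
by have [? ? ? ? ?] := copies_density HC BH FH FB Fne; exact: hphi.
Qed.

End rates.

End weighted_random_graph.

(** The threshold t solves n^a t^b = 1, so comparing p with it is comparing n^a p^b with 1, the form
    used in [density_powers_dense] and [density_powers_sparse]. *)
Lemma powR_threshold (R : realType) (n a b : nat) (p : R) : (0 < n)%N -> (0 < b)%N -> 0 <= p ->
  let t := n%:R `^ (- (a%:R / b%:R)) in
  (t < p -> 1 <= n%:R ^+ a * p ^+ b) /\ (p <= t -> n%:R ^+ a * p ^+ b <= 1).
Proof.
move=> n0 b0 p0 t.
have na0 : (0 : R) < n%:R ^+ a by rewrite exprn_gt0// ltr0n.
have t0 : 0 <= t by exact: powR_ge0.
have tb : n%:R ^+ a * t ^+ b = 1.
  rewrite -(powR_mulrn b t0) -powRrM mulNr divfK ?pnatr_eq0 -?lt0n//.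
  by rewrite powRN powR_mulrn// mulfV// gt_eqF.
split=> tp.
  by rewrite -[leLHS]tb ler_pM2l// lerXn2r// ?nnegrE// ltW.
by rewrite -[leRHS]tb ler_pM2l// lerXn2r// nnegrE.
Qed.

Lemma sqrtr_powR (R : realType) (n v e : nat) (p : R) : 0 <= p ->
  Num.sqrt (n%:R ^+ v * p ^+ e) = n%:R `^ (v%:R / 2) * p `^ (e%:R / 2).
Proof.
move=> p0; rewrite sqrtrM ?exprn_ge0// !powRrM !powR_mulrn//.
by rewrite !powR12_sqrt// exprn_ge0.
Qed.

Theorem proposition4p5 (R : realType) (V : finType) (G : graph V) (c : R) :
  class_B G -> no_isolated G -> 0 < c < 1 ->
  exists C : R,
  forall (dS : measure_display) (S : measurableType dS) (Q : probability S R)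
    (X : {RV Q >-> R}),
  (forall s, 0 <= X s) ->
  (0 < 'E_Q[fun s => (X s ^+ 2)%R] < +oo)%E ->
  forall p : nat -> R,
  (forall n, 0 < p n < 1) ->
  forall n : nat, (0 < n)%N ->
  forall (d : measure_display) (T : measurableType d) (P : probability T R)
    (GG : T -> graph 'I_n) (Xe : {set 'I_n} -> {RV P >-> R}),
  weighted_Gnp X (p n) GG Xe ->
  let dW := wasserstein P (renormalized P (subgraph_weight G GG Xe))
              (normal_prob (0 : R) 1) idfun in
  let threshold : R :=
    n%:R `^ (- (((nv G)%:R - 2) / ((ne G)%:R - 1))) in
  let EX4 := ('E_Q[fun s => (X s ^+ 4)%R])%E in
  let EX2 := ('E_Q[fun s => (X s ^+ 2)%R])%E in
  [/\ c < p n ->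
        (dW < C%:E *
          (sqrte EX4 / ((n%:R * Num.sqrt (1 - p n))%:E * 'V_Q[X])))%E,
      threshold < p n -> p n <= c ->
        (dW < C%:E * (sqrte EX4 / ((n%:R * Num.sqrt (p n))%:E * EX2)))%E
    & p n <= threshold ->
        (dW < C%:E *
          (sqrte EX4 /
            ((n%:R `^ ((nv G)%:R / 2) * p n `^ ((ne G)%:R / 2))%:E * EX2)))%E].
Proof.
move=> classG isoG c01; have [L [L0 hstein]] := stein_solution R.
have v3 : (3 <= nv G)%N by case: classG.
have e2 : (2 <= ne G)%N by exact: no_isolated_ne.
pose thr n : R := n%:R `^ (- ((nv G - 2)%:R / (ne G - 1)%:R)).
(* For n >= nv G the threshold stays away from 1, so that 1 - p is bounded below also in
   the third case, where p <= c is not assumed. *)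
pose c' := Num.max c (thr 2).
have r0 : 0 < (nv G - 2)%:R / (ne G - 1)%:R :> R by rewrite divr_gt0// ltr0n subn_gt0.
have thr_inv n : thr n = (n%:R `^ ((nv G - 2)%:R / (ne G - 1)%:R))^-1 by rewrite /thr powRN.
have c'1 : c' < 1.
  rewrite gt_max; apply/andP; split; first by case/andP: c01.
  rewrite thr_inv invf_lt1 ?powR_gt0//.
  have := gt0_ltr_powR r0 (ler01 : 1 \is Num.nneg) (ler0n R 2 : 2 \is Num.nneg) (ltr1n R 2).
  by rewrite powR1.
exists (rate_constant G L c c' + 1).
move=> dS S Q X X0 EX2 pn pn01 n n0 d T P GG Xe.
have := pn01 n; move: (pn n) => p p01 model dW threshold EX4 EX2'.
have thrE : threshold = thr n by rewrite /threshold /thr !natrB// ltnW.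
have p0 : 0 < p by case/andP: p01.
have p01' : 0 < p <= 1 by rewrite p0 ltW//; case/andP: p01.
have e1 : (0 < ne G - 1)%N by rewrite subn_gt0.
have [dense sparse] := powR_threshold (nv G - 2) n0 e1 (ltW p0).
have nR0 : (0 : R) < n%:R by rewrite ltr0n.
have n1 : (1 : R) <= n%:R by rewrite ler1n.
have v0 : (0 < nv G)%N by exact: leq_trans v3.
have self_pow : (nv G <= nv G ^ nv G)%N by rewrite -[leqLHS]expn1 leq_pexp2l.
have sqrt_le (x y : R) : 0 <= y -> x <= y ^+ 2 -> Num.sqrt x <= y.
  by move=> y0 xy; rewrite -[leRHS](ger0_norm y0) -sqrtr_sqr ler_wsqrtr.
split.
- exact: (rate_dense classG isoG n0 p01 X0 model hstein L0 c01 c'1 EX2).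
- rewrite thrE => /dense dens pc.
  (* The middle regime takes [phi] = n^2 p, the value at a single edge. *)
  have -> : n%:R * Num.sqrt p = Num.sqrt (n%:R ^+ 2 * p).
    by rewrite sqrtrM ?sqr_ge0// sqrtr_sqr ger0_norm.
  apply: (rate_sparse classG isoG n0 p01 X0 model c hstein L0 c'1 EX2).
  + by rewrite mulr_gt0// exprn_gt0.
  + by move=> _; rewrite le_max pc.
  + move=> nv_lt; apply: sqrt_le => //; apply: (@le_trans _ _ (n%:R ^+ 2)).
      by rewrite ler_piMr ?sqr_ge0//; case/andP: p01'.
    by rewrite lerXn2r ?nnegrE// ler_nat (leq_trans (ltnW nv_lt)).
  + by move=> nv_ge; apply: pair_sum_ge_edge => //; exact: ltnW.
  + by move=> u f u1 uv f0 duf; exact: (density_powers_dense n1 p01' v3 u1 f0 duf dens).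
- rewrite thrE => pt; have spar := sparse pt.
  (* The sparse regime takes [phi] = n^v p^e, the value at the whole graph. *)
  rewrite -sqrtr_powR ?(ltW p0)//.
  apply: (rate_sparse classG isoG n0 p01 X0 model c hstein L0 c'1 EX2).
  + by rewrite mulr_gt0// exprn_gt0.
  (* The threshold decreases in n and n >= 2, so p <= [thr n] <= [thr 2] <= [c']. *)
  + move=> nv_ge; rewrite le_max; apply/orP; right; apply: (le_trans pt).
    have n2 : (2 <= n)%N by apply: leq_trans nv_ge; exact: ltnW.
    rewrite !thr_inv lef_pV2 ?posrE ?powR_gt0//.
    by rewrite ge0_ler_powR ?nnegrE ?ler_nat// ltW.
  + move=> nv_lt; apply: sqrt_le => //; apply: (@le_trans _ _ (n%:R ^+ nv G)).
      by rewrite ler_piMr ?exprn_ge0// exprn_ile1 ?(ltW p0)//; case/andP: p01'.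
    rewrite -!natrX ler_nat (@leq_trans (nv G ^ nv G))//.
      by rewrite leq_exp2r// ltnW.
    by rewrite -[leqLHS]expn1 leq_pexp2l// expn_gt0 v0.
  + by move=> nv_ge; apply: pair_sum_ge_diag => //; exact: ltnW.
  + move=> u f u1 uv f0 duf.
    exact: (density_powers_sparse n1 p01' v3 u1 f0 duf (ltnW e2) uv spar).
Qed.
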